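(* Let $u,v>0$, $\Gamma>0$, $\Xi>v$. Let $\psi$ be a shearlet of the form $\psi=\frac{\partial^M}{\partial x_1^M}\theta$, $\theta\in L^2(\mathbb{R}^2)$, having $M$ vanishing moments in $x_1$-direction and Fourier decay of order $L_1$ in the first variable, and such that $\theta$ has Fourier decay of order $L_2$ in the second variable, where $2M-1/2>L_2>M>1/2$. Let $W$ be defined by $$\Delta_{u,v}(\psi)(\xi)+|\hat W(\xi)|^2=C_\psi\chi_{\mathcal{C}_{u,v}}(\xi).$$ Then the system $$(P_{\mathcal{C}_{u,v}}\psi_{ast})_{a\in[0,\Gamma],\,s\in[-\Xi,\Xi],\,t\in\mathbb{R}^2}\cup(T_tP_{\mathcal{C}_{u,v}}W)_{t\in\mathbb{R}^2}$$ constitutes a tight frame for $L^2(\mathcal{C}_{u,v})^\vee$ with frame constant $C_\psi$. For $f\in L^2(\mathcal{C}_{u,v})^\vee$ we have the representation (in the weak sense) $$f=\frac1{C_\psi}\int_{\mathbb{R}^2}\langle f,T_tW\rangle T_tP_{\mathcal{C}_{u,v}}W\,dt+\frac1{C_\psi}\int_{\mathbb{R}^2}\int_{-\Xi}^{\Xi}\int_0^\Gamma\mathcal{SH}_\psi f(a,s,t)\,P_{\mathcal{C}_{u,v}}\psi_{ast}\,a^{-3}da\,ds\,dt.$$ The window function $W$ satisfies $|\hat W(\xi)|^2=O(|\xi|^{-2\min(L_1,L_2-M)})$ as $|\xi|\to\infty$.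
   Context: Fourier transform: $\hat f(\omega)=\int_{\mathbb{R}^2}f(x)e^{-2\pi i x\omega}dx$; $T_tg=g(\cdot-t)$. For $a>0$, $s\in\mathbb{R}$, $t\in\mathbb{R}^2$ let $\psi_{ast}(x)=a^{-3/4}\psi\big(\frac{x_1-t_1+s(x_2-t_2)}{a},\frac{x_2-t_2}{a^{1/2}}\big)$ and $\mathcal{SH}_\psi f(a,s,t)=\langle f,\psi_{ast}\rangle$. $\mathcal{C}_{u,v}=\{\xi\in\mathbb{R}^2:|\xi_1|\ge u,\ |\xi_2|\le v|\xi_1|\}$, $\chi_{\mathcal{C}_{u,v}}$ is its characteristic function, $L^2(\mathcal{C}_{u,v})^\vee=\{f\in L^2(\mathbb{R}^2):\operatorname{supp}\hat f\subseteq\mathcal{C}_{u,v}\}$, $P_{\mathcal{C}_{u,v}}$ is the orthogonal projection onto it (on the Fourier side, multiplication by $\chi_{\mathcal{C}_{u,v}}$), and $$\Delta_{u,v}(\psi)(\xi)=\chi_{\mathcal{C}_{u,v}}(\xi)\int_{0<a<\Gamma,\ |s|<\Xi}|\hat\psi(a\xi_1,\sqrt a(\xi_2-s\xi_1))|^2a^{-3/2}\,da\,ds.$$ $W$ is specified through a (bounded, measurable) $\hat W$ with the prescribed modulus; $\langle f,T_tW\rangle$ is understood on the Fourier side, as $\int\hat f(\xi)\overline{\hat W(\xi)}e^{2\pi i t\xi}d\xi$. A shearlet is an admissible function $\psi\in L^2(\mathbb R^2)$, $\psi\neq 0$, with $C_\psi:=\int_{\mathbb{R}^2}\frac{|\hat\psi(\omega)|^2}{|\omega_1|^2}d\omega=\int_{\mathbb{R}}\int_0^\infty|\hat\psi(a\xi_1,\sqrt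 a(\xi_2-s\xi_1))|^2a^{-3/2}\,da\,ds<\infty$ for all $\xi$ with $\xi_1\ne0$. $\psi$ has $n$ vanishing moments in $x_1$-direction if $\int_{\mathbb{R}^2}|\hat\psi(\omega)|^2|\omega_1|^{-2n}d\omega<\infty$. A function $g$ has Fourier decay of order $r$ in the second variable if $\hat g(\xi_1,\xi_2)=O(|\xi_2|^{-r})$ for large $\xi_2$, used in the paper in the form $|\hat g(\xi)|\le C(1+|\xi_2|^r)^{-1}$; analogously for the first variable. A family $(\varphi_x)_{x\in X}$ in a Hilbert space $\mathcal{H}$, indexed by a measure space $(X,m)$, is a tight frame with frame constant $A>0$ if $\int_X|\langle f,\varphi_x\rangle|^2dm(x)=A\|f\|^2$ for all $f\in\mathcal{H}$. The measure is $a^{-3}da\,ds\,dt$ on $(a,s,t)$ and $dt$ on the translates of $W$; for the union, the integrals are added.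
   Formalization: As written, C_ψ equals both a full-plane and a half-plane integral, forcing ψ=0. Here C_ψ is the integral over a>0 and all s of |ψ̂(aξ₁,√a(ξ₂−sξ₁))|²a^{-3/2}, the same for all ξ with ξ₁≠0; the full-plane integral is only required to be finite. *)

(* Defs.v *)
From HB Require Import structures.
From mathcomp Require Export all_boot all_order all_algebra.
From mathcomp Require Export all_classical all_reals all_analysis.
From mathcomp Require Export complex.
Export numFieldNormedType.Exports.

Set Implicit Arguments.
Unset Strict Implicit.
Unset Printing Implicit Defensive.

Import Order.TTheory GRing.Theory Num.Theory.

Local Open Scope classical_set_scope.
Local Open Scope ring_scope.

Section Defs.
Context {R : realType}.
Local Notation C := R[i].
Local Notation R2 := (R * R)%type.

(* Lebesgue measure lives on [measurableTypeR R], the same type as R with another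
   instance of the Borel sigma-algebra. *)
Local Notation plane := (measurableTypeR R * measurableTypeR R)%type.

Local Notation mu := (@lebesgue_measure R).

Definition mu2 : set plane -> \bar R := (mu \x mu)%E.

HB.instance Definition _ := Measure.on mu2.

(* The library's sigma-finite instance on product measures is shadowed by its
   sub-probability one, so it is declared again on [mu2]. *)
Let mu2_sigma_finite : sigma_finite setT mu2.
Proof.
have /sigma_finiteP[F [TF ndF Foo]] := sigma_finiteT mu.
exists (fun n => F n `*` F n).
  rewrite -setXTT TF predeqE => -[x y]; split.
    move=> [/= [n _ Fnx] [k _ Fky]]; exists (maxn n k) => //; split.
    - by move: x Fnx; exact/subsetPset/ndF/leq_maxl.
    - by move: y Fky; exact/subsetPset/ndF/leq_maxr.
  by move=> [n _ []/= ? ?]; split; exists n.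
move=> k; have [? ?] := Foo k.
split; first exact: measurableX.
by rewrite /mu2 product_measure1E// lte_mul_pinfty// ge0_fin_numE.
Qed.

HB.instance Definition _ :=
  Measure_isSigmaFinite.Build _ _ _ mu2 mu2_sigma_finite.

(* da ds dt at the point ((a, s), t) *)
Definition mu4 : set (plane * plane) -> \bar R := (mu2 \x mu2)%E.

HB.instance Definition _ := Measure.on mu4.

Definition cabs (z : C) : R := ComplexField.Normc.normc z.

Definition cmeasurable d (T : measurableType d) (D : set T) (f : T -> C) : Prop :=
  measurable_fun D (fun x => complex.Re (f x)) /\
  measurable_fun D (fun x => complex.Im (f x)).

Definition cintegrable d (T : measurableType d) (m : {measure set T -> \bar R})
    (D : set T) (f : T -> C) : Prop :=
  m.-integrable D (fun x => (complex.Re (f x))%:E) /\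
  m.-integrable D (fun x => (complex.Im (f x))%:E).

Definition cintegral d (T : measurableType d) (m : {measure set T -> \bar R})
    (D : set T) (f : T -> C) : C :=
  (Rintegral m D (fun x => complex.Re (f x)) +i*
   Rintegral m D (fun x => complex.Im (f x)))%C.

Definition sqnorm2 (f : R2 -> C) : \bar R :=
  (\int[mu2]_x (cabs (f x) ^+ 2)%:E)%E.

Definition L2R2 : set (R2 -> C) :=
  [set f | cmeasurable [set: plane] f /\ (sqnorm2 f < +oo)%E].

Definition dot (f g : R2 -> C) : C :=
  cintegral mu2 setT (fun x => f x * (g x)^*%C).

Definition cis (t : R) : C := (cos t +i* sin t)%C.

Definition dot2 (x w : R2) : R := x.1 * w.1 + x.2 * w.2.

Definition fourier_int (f : R2 -> C) (w : R2) : C :=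
  cintegral mu2 setT (fun x => f x * cis (- (2 * pi * dot2 x w))).

Definition truncate (n : nat) (f : R2 -> C) (x : R2) : C :=
  if (`|x.1| <= n%:R) && (`|x.2| <= n%:R) then f x else 0.

(* The Fourier-Plancherel transform: the integral need not converge for a
   square-integrable f, so it is the L^2 limit of the transforms of the
   truncations of f (which are integrable). *)
Definition is_fourier (f fhat : R2 -> C) : Prop :=
  L2R2 fhat /\
  (fun n : nat => sqnorm2 (fun w => fourier_int (truncate n f) w - fhat w))
    @ \oo --> 0%E.

(* A representative of the a.e. class of the transform. *)
Definition fourier (f : R2 -> C) : R2 -> C :=
  xget (fun=> 0) [set fhat | is_fourier f fhat].

Definition ifourier (g : R2 -> C) (x : R2) : C := fourier g (- x.1, - x.2).

Definition cone (u v : R) : set R2 :=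
  [set xi | u <= `|xi.1| /\ `|xi.2| <= v * `|xi.1|].

(* As the cone is closed, the support condition says that the transform
   vanishes almost everywhere off it. *)
Definition L2cone (u v : R) : set (R2 -> C) :=
  [set f | L2R2 f /\ {ae mu2, forall xi, ~ cone u v xi -> fourier f xi = 0}].

(* orthogonal projection onto a subspace V of L^2 *)
Definition orthproj (V : set (R2 -> C)) (g : R2 -> C) : R2 -> C :=
  xget (fun=> 0)
    [set h | V h /\ forall k, V k -> dot (fun x => g x - h x) k = 0].

Definition Pcone (u v : R) := orthproj (L2cone u v).

Definition dilate (psi : R2 -> C) (a s : R) (t : R2) (x : R2) : C :=
  (a `^ (- (3 / 4)))%:C%C *
  psi ((x.1 - t.1 + s * (x.2 - t.2)) / a, (x.2 - t.2) / (a `^ (1 / 2))).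

Definition SH (psi f : R2 -> C) (a s : R) (t : R2) : C :=
  dot f (dilate psi a s t).

Definition shear_int (psi : R2 -> C) (D : set R2) (xi : R2) : \bar R :=
  (\int[mu2]_(q in D)
    (cabs (fourier psi (q.1 * xi.1, Num.sqrt q.1 * (xi.2 - q.2 * xi.1))) ^+ 2
     * q.1 `^ (- (3 / 2)))%:E)%E.

Definition Delta (u v Gamma Xi : R) (psi : R2 -> C) (xi : R2) : \bar R :=
  ((\1_(cone u v) xi)%:E *
   shear_int psi [set q | (0 < q.1 < Gamma)%R /\ (`|q.2| < Xi)%R] xi)%E.

Definition moment_int (psi : R2 -> C) (n : nat) : \bar R :=
  (\int[mu2]_w (cabs (fourier psi w) ^+ 2 / `|w.1| ^+ (2 * n))%:E)%E.

Definition vanishing_moments (psi : R2 -> C) (n : nat) : Prop :=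
  (moment_int psi n < +oo)%E.

(* [shearlet psi c]: psi is a shearlet and c is its constant C_psi.
   Substituting w = (a xi_1, sqrt a (xi_2 - s xi_1)) with a > 0 only covers the
   half plane where w_1 has the sign of xi_1, so the integral over (a, s) is
   that of |psihat(w)|^2 / |w_1|^2 over this half plane.  Asking it to equal, for
   both signs, the integral over the whole plane would force psi = 0.  The
   constant is hence the common value of the integrals over (a, s), and of the
   integral over the plane, equal to 2 c, only finiteness is recorded. *)
Definition shearlet (psi : R2 -> C) (c : R) : Prop :=
  [/\ L2R2 psi, ~ {ae mu2, forall x, psi x = 0}, (moment_int psi 1 < +oo)%E &
      forall xi : R2, xi.1 != 0 -> shear_int psi [set q | (0 < q.1)%R] xi = c%:E].

Definition dir (b : bool) : R2 := if b then (0, 1) else (1, 0).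

Definition partial (phi : R2 -> R) (b : bool) : R2 -> R :=
  fun x => 'D_(dir b) phi x.

Definition smooth (phi : R2 -> R) : Prop :=
  forall w : seq bool, continuous (foldl partial phi w) /\
    forall b x, derivable (foldl partial phi w) x (dir b).

Definition test_function (phi : R2 -> R) : Prop :=
  smooth phi /\ exists r : R, forall x, r < `|x| -> phi x = 0.

(* psi = (d/dx_1)^n theta in the sense of distributions *)
Definition weak_partial1 (n : nat) (theta psi : R2 -> C) : Prop :=
  forall phi, test_function phi ->
    cintegral mu2 setT (fun x => psi x * (phi x)%:C%C) =
    (-1) ^+ n *
    cintegral mu2 setT
      (fun x => theta x * (iter n (fun h => partial h false) phi x)%:C%C).

Definition fourier_decay1 (r : R) (g : R2 -> C) : Prop :=
  exists K : R, {ae mu2, forall xi, cabs (fourier g xi) <= K / (1 + `|xi.1| `^ r)}.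

Definition fourier_decay2 (r : R) (g : R2 -> C) : Prop :=
  exists K : R, {ae mu2, forall xi, cabs (fourier g xi) <= K / (1 + `|xi.2| `^ r)}.

(* t |-> <f, T_t W> for W given by its Fourier transform What, i.e. the integral
   of fhat(xi) conj(What(xi)) exp(2 i pi t.xi); the integrand is in L^2 but not
   necessarily in L^1, so this is an inverse Fourier-Plancherel transform. *)
Definition translate_coef (What f : R2 -> C) : R2 -> C :=
  ifourier (fun xi => fourier f xi * (What xi)^*%C).

Definition PWhat (u v : R) (What : R2 -> C) (xi : R2) : C :=
  (\1_(cone u v) xi)%:C%C * What xi.

Definition params (Gamma Xi : R) : set (plane * plane) :=
  [set p | (0 < p.1.1 <= Gamma)%R /\ (`|p.1.2| <= Xi)%R].

(* [phi] is a family in H with index measure a^-3 da ds dt on [params]; the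
   second family, indexed by dt, is only known through its coefficients
   [coef f t], which are the inner products of f with its members. *)
Definition tight_frame (H : set (R2 -> C)) (Gamma Xi : R)
    (phi : R -> R -> R2 -> R2 -> C) (coef : (R2 -> C) -> R2 -> C) (A : R) : Prop :=
  [/\ 0 < A,
      forall p, params Gamma Xi p -> H (phi p.1.1 p.1.2 p.2) &
      forall f, H f ->
        [/\ cmeasurable (params Gamma Xi)
              (fun p => dot f (phi p.1.1 p.1.2 p.2)),
            cmeasurable [set: plane] (coef f) &
            (\int[mu4]_(p in params Gamma Xi)
                (cabs (dot f (phi p.1.1 p.1.2 p.2)) ^+ 2 * p.1.1 ^- 3)%:E
             + \int[mu2]_t (cabs (coef f t) ^+ 2)%:E
             = A%:E * sqnorm2 f)%E]].

(* The reproducing formula for f, tested against an arbitrary g in L^2; the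
   pairing <T_t P W, g> is the conjugate of the coefficient of g. *)
Definition weak_representation (u v Gamma Xi : R) (psi What : R2 -> C) (c : R)
    (f : R2 -> C) : Prop :=
  forall g, L2R2 g ->
    let hW t := translate_coef What f t *
                (translate_coef (PWhat u v What) g t)^*%C in
    let hpsi p := SH psi f p.1.1 p.1.2 p.2 *
                  dot (Pcone u v (dilate psi p.1.1 p.1.2 p.2)) g *
                  (p.1.1 ^- 3)%:C%C in
    [/\ cintegrable mu2 setT hW, cintegrable mu4 (params Gamma Xi) hpsi &
        dot f g = (c^-1)%:C%C * cintegral mu2 setT hW +
                  (c^-1)%:C%C * cintegral mu4 (params Gamma Xi) hpsi].

Definition enorm (x : R2) : R := Num.sqrt (x.1 ^+ 2 + x.2 ^+ 2).

End Defs.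

(* Main.v *)
(* By Plancherel, t |-> SH psi f a s t is the inverse transform of the product of
   fhat with the conjugate of the dilated psihat, so that integrating its square over
   t and then over (a, s) turns the contribution of the shearlets into the integral of
   |fhat|^2 Delta, and that of W is the integral of |fhat|^2 |What|^2; they add up to
   Cpsi |f|^2 on the cone.  Polarization then gives the weak representation, as the
   projection P is multiplication by the indicator of the cone.  The constant Cpsi is
   positive since otherwise psihat vanishes on both half planes.

   On the cone, |What|^2 is the integral of |psihat(a xi_1, sqrt a (xi_2 - s xi_1))|^2
   a^(-3/2) over the (a, s) with a >= Gamma or |s| >= Xi.  Where a >= Gamma the decay of
   psihat in the first variable applies.  Where |s| >= Xi > v, the second argument is at
   least sqrt a (|s| - v) |xi_1|, and |psihat(w)| = (2 pi |w_1|)^M |thetahat(w)| is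
   bounded by the decay of thetahat.

   Plancherel itself is obtained from the regularization of the inversion formula by
   exp (- e |w|), whose transform is the Poisson kernel; the identity for the weak
   derivative follows by testing against smooth functions of compact support. *)
From HB Require Import structures.
Require Import Defs.
From mathcomp Require Import measurable_realfun ring lra.
Set Implicit Arguments.
Unset Strict Implicit.
Unset Printing Implicit Defensive.
Import Order.TTheory GRing.Theory Num.Theory.
Local Open Scope classical_set_scope.
Local Open Scope ring_scope.

(** * Complex-valued integration *)

(** The transform [fourier] is only a chosen representative of an almost-everywhere class, so
    identities on the Fourier side hold off a null set and must survive composition with the
    dilation and frequency maps. Changes of variables are therefore proved for all nonnegative
    functions: this transports null sets, integrals and norms at once.

    Plancherel is reached without a dense class of rapidly decreasing functions. The regularization
    alone gives a contraction of the L^2 norm, enough to extend the transform to L^2. The isometry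
    comes from testing inversion against rectangles, whose Poisson averages are explicit differences
    of arctangents.

    For a fixed (a, s) the product of fhat and the dilated psihat is integrable but need not be
    square-integrable. Plancherel in t is thus applied only at almost every (a, s), where Tonelli
    and the bound by Cpsi give finiteness.

    The conditions on L2 are integrability conditions for the outer integral: L2 < 2 M - 1/2 near a
    = 0 with |s| large, and L2 > M where a and |s| are both large. *)

Section ComplexNumbers.
Context {R : realType}.
Local Notation C := R[i].
Implicit Types z w : C.

Lemma complex_eqP z w : complex.Re z = complex.Re w ->
  complex.Im z = complex.Im w -> z = w.
Proof. by case: z w => [a b] [c d] /= -> ->. Qed.

Lemma cabs_ge0 z : 0 <= cabs z.
Proof. by case: z => a b; exact: sqrtr_ge0. Qed.

Lemma cabsE2 z : cabs z ^+ 2 = complex.Re z ^+ 2 + complex.Im z ^+ 2.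
Proof. by case: z => a b; rewrite sqr_sqrtr// addr_ge0// sqr_ge0. Qed.

Lemma cabsM z w : cabs (z * w) = cabs z * cabs w.
Proof. exact: ComplexField.Normc.normcM. Qed.

Lemma cabsD z w : cabs (z + w) <= cabs z + cabs w.
Proof. exact: le_normcD. Qed.

Lemma cabsN z : cabs (- z) = cabs z.
Proof. by case: z => a b; rewrite /cabs /= !sqrrN. Qed.

Lemma cabsJ z : cabs z^*%C = cabs z.
Proof. by case: z => a b; rewrite /cabs /= sqrrN. Qed.

Lemma cabsR (x : R) : cabs x%:C%C = `|x|.
Proof. by rewrite /cabs /= expr0n addr0 sqrtr_sqr. Qed.

Lemma cabs0 : cabs (0 : C) = 0.
Proof. by rewrite cabsR normr0. Qed.

Lemma cabs0_eq0 z : cabs z = 0 -> z = 0.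
Proof. exact: ComplexField.Normc.eq0_normc. Qed.

Lemma cabs_cis (t : R) : cabs (cis t) = 1.
Proof. by rewrite /cabs /= cos2Dsin2 sqrtr1. Qed.

Lemma cisD (s t : R) : cis (s + t) = cis s * cis t.
Proof. by apply: complex_eqP => /=; rewrite ?cosD ?sinD; ring. Qed.

Lemma cisJ (t : R) : (cis t)^*%C = cis (- t).
Proof. by apply: complex_eqP => /=; rewrite ?cosN ?sinN. Qed.

Lemma Re_le_cabs z : `|complex.Re z| <= cabs z.
Proof.
by rewrite -(ler_pXn2r (n := 2)) ?nnegrE ?cabs_ge0// real_normK ?num_real// cabsE2
  lerDl sqr_ge0.
Qed.

Lemma Im_le_cabs z : `|complex.Im z| <= cabs z.
Proof.
by rewrite -(ler_pXn2r (n := 2)) ?nnegrE ?cabs_ge0// real_normK ?num_real// cabsE2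
  lerDr sqr_ge0.
Qed.

Lemma cabs_le_ReIm z : cabs z <= `|complex.Re z| + `|complex.Im z|.
Proof.
rewrite -(ler_pXn2r (n := 2)) ?nnegrE ?cabs_ge0 ?addr_ge0// cabsE2 sqrrD.
rewrite !real_normK ?num_real// addrAC lerDl mulrn_wge0// mulr_ge0//.
Qed.

Lemma ReD z w : complex.Re (z + w) = complex.Re z + complex.Re w.
Proof. by case: z w => [a b] [c d]. Qed.
Lemma ImD z w : complex.Im (z + w) = complex.Im z + complex.Im w.
Proof. by case: z w => [a b] [c d]. Qed.
Lemma ReN z : complex.Re (- z) = - complex.Re z.
Proof. by case: z => [a b]. Qed.
Lemma ImN z : complex.Im (- z) = - complex.Im z.
Proof. by case: z => [a b]. Qed.
Lemma ReM z w : complex.Re (z * w) =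
  complex.Re z * complex.Re w - complex.Im z * complex.Im w.
Proof. by case: z w => [a b] [c d]. Qed.
Lemma ImM z w : complex.Im (z * w) =
  complex.Re z * complex.Im w + complex.Im z * complex.Re w.
Proof. by case: z w => [a b] [c d]. Qed.
Lemma ReJ z : complex.Re z^*%C = complex.Re z.
Proof. by case: z. Qed.
Lemma ImJ z : complex.Im z^*%C = - complex.Im z.
Proof. by case: z. Qed.
Definition ReImE := (ReD, ImD, ReN, ImN, ReM, ImM, ReJ, ImJ).

Lemma RtoCM (x y : R) : (x * y)%:C%C = x%:C%C * y%:C%C :> C.
Proof. by apply: complex_eqP; rewrite !ReImE /=; ring. Qed.

Lemma mulcJ z : z * z^*%C = (cabs z ^+ 2)%:C%C.
Proof. by apply: complex_eqP; rewrite ?ReImE ?cabsE2 /=; ring. Qed.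

(** The gap between the two sides is (k |z| - |w|)^2 / (2 k). The weight k stays free so that
    [CauchySchwarz] can choose it after integration. *)
Lemma cabsM_le z w (k : R) : 0 < k ->
  cabs (z * w) <= (k * cabs z ^+ 2 + k^-1 * cabs w ^+ 2) / 2.
Proof.
move=> k0; rewrite cabsM -subr_ge0.
have -> : (k * cabs z ^+ 2 + k^-1 * cabs w ^+ 2) / 2 - cabs z * cabs w =
  k^-1 / 2 * (k * cabs z - cabs w) ^+ 2 by field; rewrite gt_eqF.
by rewrite mulr_ge0 ?sqr_ge0// divr_ge0// invr_ge0 ltW.
Qed.

Lemma cabs2D z w : cabs (z + w) ^+ 2 <= 2 * cabs z ^+ 2 + 2 * cabs w ^+ 2.
Proof.
rewrite !cabsE2 !ReImE.
have := sqr_ge0 (complex.Re z - complex.Re w).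
have := sqr_ge0 (complex.Im z - complex.Im w).
lra.
Qed.

End ComplexNumbers.

Section ComplexMeasurable.
Context {R : realType} d (T : measurableType d).
Local Notation C := R[i].
Implicit Types (D : set T) (f g : T -> C).

Lemma cmeas_cabs D f : cmeasurable D f -> measurable_fun D (fun x => cabs (f x)).
Proof.
case=> mr mi.
have -> : (fun x => cabs (f x)) =
    (fun x => Num.sqrt (complex.Re (f x) ^+ 2 + complex.Im (f x) ^+ 2)).
  by apply/funext => x; case: (f x).
apply: measurableT_comp; last by apply: measurable_funD; exact: measurable_funX.
by apply: continuous_measurable_fun; exact: sqrt_continuous.
Qed.

Lemma cmeas_cabs2 D f : cmeasurable D f ->
  measurable_fun D (fun x => cabs (f x) ^+ 2).
Proof. by move=> /cmeas_cabs mf; exact: measurable_funX. Qed.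

Lemma cmeasD D f g : cmeasurable D f -> cmeasurable D g ->
  cmeasurable D (fun x => f x + g x).
Proof.
move=> [mf mf'] [mg mg']; split; under eq_fun do rewrite ReImE;
  exact: measurable_funD.
Qed.

Lemma cmeasN D f : cmeasurable D f -> cmeasurable D (fun x => - f x).
Proof.
by move=> [mf mf']; split; under eq_fun do rewrite ReImE;
  apply: measurableT_comp.
Qed.

Lemma cmeasB D f g : cmeasurable D f -> cmeasurable D g ->
  cmeasurable D (fun x => f x - g x).
Proof. by move=> mf mg; apply: cmeasD => //; exact: cmeasN. Qed.

Lemma cmeasM D f g : cmeasurable D f -> cmeasurable D g ->
  cmeasurable D (fun x => f x * g x).
Proof.
move=> [mf mf'] [mg mg']; split; under eq_fun do rewrite ReImE.
  by apply: measurable_funB; exact: measurable_funM.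
by apply: measurable_funD; exact: measurable_funM.
Qed.

Lemma cmeasJ D f : cmeasurable D f -> cmeasurable D (fun x => (f x)^*%C).
Proof.
move=> [mf mf']; split; under eq_fun do rewrite ReImE; first exact: mf.
by apply: measurableT_comp.
Qed.

Lemma cmeas_cst D (c : C) : cmeasurable D (fun=> c).
Proof. by split; exact: measurable_cst. Qed.

Lemma cmeasR D (f : T -> R) : measurable_fun D f ->
  cmeasurable D (fun x => (f x)%:C%C).
Proof. by move=> mf; split => //=; exact: measurable_cst. Qed.

Lemma cmeas_cis D (f : T -> R) : measurable_fun D f ->
  cmeasurable D (fun x => cis (f x)).
Proof.
move=> mf; split => /=; apply: measurableT_comp => //.
  by apply: continuous_measurable_fun; exact: continuous_cos.
by apply: continuous_measurable_fun; exact: continuous_sin.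
Qed.

Lemma cmeasS D E f : measurable E -> D `<=` E -> cmeasurable E f -> cmeasurable D f.
Proof. by move=> mE DE [mr mi]; split; exact: measurable_funS DE _. Qed.

Lemma cmeasT D f : cmeasurable setT f -> cmeasurable D f.
Proof. exact: cmeasS. Qed.

End ComplexMeasurable.

Lemma cmeas_comp {R : realType} d1 d2 (T1 : measurableType d1)
    (T2 : measurableType d2) (f : T2 -> R[i]) (h : T1 -> T2) (D : set T1) :
  cmeasurable setT f -> measurable_fun D h -> cmeasurable D (fun x => f (h x)).
Proof. by move=> [mr mi] mh; split; [exact: (measurableT_comp mr)|exact: (measurableT_comp mi)]. Qed.

Section ComplexIntegral.
Context {R : realType} d (T : measurableType d) (m : {measure set T -> \bar R}).
Local Notation C := R[i].
Context (D : set T) (mD : measurable D).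
Implicit Types (f g : T -> C).

Lemma cintegrable_meas f : cintegrable m D f -> cmeasurable D f.
Proof.
by move=> [/measurable_int/measurable_EFinP mr /measurable_int/measurable_EFinP mi].
Qed.

Lemma cint_dom f (g : T -> R) : cmeasurable D f ->
  (forall x, D x -> cabs (f x) <= g x) -> m.-integrable D (EFin \o g) ->
  cintegrable m D f.
Proof.
move=> [mr mi] fg ig; split; apply: (le_integrable mD _ _ ig).
- exact/measurable_EFinP.
- move=> x Dx /=; rewrite lee_fin (le_trans (Re_le_cabs _))//.
  by rewrite (le_trans (fg _ Dx))// ler_norm.
- exact/measurable_EFinP.
- move=> x Dx /=; rewrite lee_fin (le_trans (Im_le_cabs _))//.
  by rewrite (le_trans (fg _ Dx))// ler_norm.
Qed.

Lemma cint_abs f : cintegrable m D f ->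
  m.-integrable D (fun x => (cabs (f x))%:E).
Proof.
move=> fi; have mf := cintegrable_meas fi; case: fi => ir ii.
apply: (@le_integrable _ _ _ _ _ mD _
  (fun x => (`|complex.Re (f x)| + `|complex.Im (f x)|)%:E)).
- by apply/measurable_EFinP; exact: cmeas_cabs.
- move=> x Dx /=; rewrite lee_fin ger0_norm ?cabs_ge0// ger0_norm ?addr_ge0//.
  exact: cabs_le_ReIm.
- apply: (@integrableD _ _ _ m D mD (fun x => `|complex.Re (f x)|%:E)
    (fun x => `|complex.Im (f x)|%:E)).
  + exact: (integrable_norm ir).
  + exact: (integrable_norm ii).
Qed.

Lemma cint_absP f : cmeasurable D f ->
  (\int[m]_(x in D) (cabs (f x))%:E < +oo)%E -> cintegrable m D f.
Proof.
move=> mf lf; apply: (cint_dom mf (g := fun x => cabs (f x))) => //.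
apply/integrableP; split; first by apply/measurable_EFinP; exact: cmeas_cabs.
by under eq_integral do rewrite /= ger0_norm ?cabs_ge0//.
Qed.

Lemma cintD f g : cintegrable m D f -> cintegrable m D g ->
  cintegrable m D (fun x => f x + g x).
Proof.
move=> fi gi; have mf := cintegrable_meas fi; have mg := cintegrable_meas gi.
apply: (@cint_dom _ (fun x => cabs (f x) + cabs (g x))).
- exact: cmeasD.
- by move=> x _; exact: cabsD.
- by apply: (@integrableD _ _ _ m D mD (fun x => (cabs (f x))%:E)
    (fun x => (cabs (g x))%:E)); exact: cint_abs.
Qed.

Lemma cintMb f g (B : R) : cmeasurable D g -> (forall x, D x -> cabs (g x) <= B) ->
  cintegrable m D f -> cintegrable m D (fun x => f x * g x).
Proof.
move=> mg gB fi; have mf := cintegrable_meas fi.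
apply: (@cint_dom _ (fun x => B * cabs (f x))).
- exact: cmeasM.
- by move=> x Dx; rewrite cabsM mulrC ler_wpM2r ?cabs_ge0// gB.
- by apply: (@integrableZl _ _ _ m D mD B (fun x => (cabs (f x))%:E)); exact: cint_abs.
Qed.

Lemma cintZ f (c : C) : cintegrable m D f -> cintegrable m D (fun x => c * f x).
Proof.
move=> fi; under eq_fun do rewrite mulrC.
by apply: (cintMb (B := cabs c)) fi => //; exact: cmeas_cst.
Qed.

Lemma cintN f : cintegrable m D f -> cintegrable m D (fun x => - f x).
Proof. by move=> fi; under eq_fun do rewrite -mulN1r; exact: cintZ. Qed.

Lemma cintB f g : cintegrable m D f -> cintegrable m D g ->
  cintegrable m D (fun x => f x - g x).
Proof. by move=> fi gi; apply: cintD => //; exact: cintN. Qed.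

Lemma cintJ f : cintegrable m D f -> cintegrable m D (fun x => (f x)^*%C).
Proof.
move=> fi; have mf := cintegrable_meas fi.
apply: (cint_dom (cmeasJ mf) (g := fun x => cabs (f x))).
  by move=> x _; rewrite cabsJ.
exact: cint_abs.
Qed.

Lemma cintegralD f g : cintegrable m D f -> cintegrable m D g ->
  cintegral m D (fun x => f x + g x) = cintegral m D f + cintegral m D g.
Proof.
move=> [fr fi] [gr gi]; apply: complex_eqP => /=.
  by rewrite -RintegralD//; apply: eq_Rintegral => x _; rewrite ReD.
by rewrite -RintegralD//; apply: eq_Rintegral => x _; rewrite ImD.
Qed.

Lemma cintegralZ f (c : C) : cintegrable m D f ->
  cintegral m D (fun x => c * f x) = c * cintegral m D f.
Proof.
move=> [fr fi]; case: c => a b; apply: complex_eqP => /=.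
  rewrite -!RintegralZl// -RintegralB//; last 2 first.
  - exact: (@integrableZl _ _ _ m D mD a (fun x => (complex.Re (f x))%:E)).
  - exact: (@integrableZl _ _ _ m D mD b (fun x => (complex.Im (f x))%:E)).
  by apply: eq_Rintegral => x _; rewrite ReM.
rewrite -!RintegralZl// -RintegralD//; last 2 first.
- exact: (@integrableZl _ _ _ m D mD a (fun x => (complex.Im (f x))%:E)).
- exact: (@integrableZl _ _ _ m D mD b (fun x => (complex.Re (f x))%:E)).
by apply: eq_Rintegral => x _; rewrite ImM.
Qed.

Lemma cintegralN f : cintegrable m D f ->
  cintegral m D (fun x => - f x) = - cintegral m D f.
Proof.
move=> fi; rewrite -mulN1r -cintegralZ//; congr (cintegral _ _ _).
by apply/funext => x; rewrite mulN1r.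
Qed.

Lemma cintegralB f g : cintegrable m D f -> cintegrable m D g ->
  cintegral m D (fun x => f x - g x) = cintegral m D f - cintegral m D g.
Proof. by move=> fi gi; rewrite cintegralD ?cintegralN//; exact: cintN. Qed.

Lemma cintegralJ f : cintegrable m D f ->
  cintegral m D (fun x => (f x)^*%C) = (cintegral m D f)^*%C.
Proof.
move=> [fr fi]; apply: complex_eqP => /=.
  by apply: eq_Rintegral => x _; rewrite ReJ.
rewrite -mulN1r -RintegralZl//; apply: eq_Rintegral => x _.
by rewrite ImJ mulN1r.
Qed.

Lemma cintegral_real (f : T -> R) :
  cintegral m D (fun x => (f x)%:C%C) = (Rintegral m D f)%:C%C.
Proof.
apply: complex_eqP => //=.
by rewrite /Rintegral integral0.
Qed.

Lemma eq_cintegral f g : (forall x, D x -> f x = g x) ->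
  cintegral m D f = cintegral m D g.
Proof.
by move=> fg; apply: complex_eqP; apply: eq_Rintegral => x; rewrite inE => /fg ->.
Qed.

Lemma ae_eq_cintegral f g : cmeasurable D f -> cmeasurable D g ->
  {ae m, forall x, D x -> f x = g x} -> cintegral m D f = cintegral m D g.
Proof.
move=> [mfr mfi] [mgr mgi] fg; apply: complex_eqP => /=; congr fine;
  apply: ae_eq_integral => //; (try exact/measurable_EFinP);
  by apply: filterS fg => x fgx Dx; rewrite fgx.
Qed.

(** A unimodular constant rotates the integral onto the positive real axis. There its modulus is the
    integral of a real part, which is at most the integral of the modulus. *)
Lemma cabs_cintegral f : cintegrable m D f ->
  cabs (cintegral m D f) <= Rintegral m D (fun x => cabs (f x)).
Proof.
move=> fi; set I := cintegral m D f.
have [I0|I0] := eqVneq (cabs I) 0.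
  by rewrite I0 Rintegral_ge0// => x _; exact: cabs_ge0.
pose c : C := ((cabs I)^-1)%:C%C * I^*%C.
have cI : c * I = (cabs I)%:C%C.
  rewrite /c -mulrA (mulrC _ I) mulcJ; apply: complex_eqP => /=; last by ring.
  by field.
have c1 : cabs c = 1.
  by rewrite /c cabsM cabsJ cabsR ger0_norm ?invr_ge0 ?cabs_ge0// mulVf.
have -> : cabs I = complex.Re (c * I) by rewrite cI.
rewrite -cintegralZ//=; have [cfr _] := cintZ c fi.
apply: le_Rintegral => //.
  exact: cint_abs.
move=> x Dx; rewrite (le_trans (ler_norm _))// (le_trans (Re_le_cabs _))//.
by rewrite cabsM c1 mul1r.
Qed.

Lemma cabs_cintegral_le f (k : R) : cintegrable m D f ->
  (\int[m]_(x in D) (cabs (f x))%:E <= k%:E)%E -> cabs (cintegral m D f) <= k.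
Proof.
move=> fi fk; rewrite (le_trans (cabs_cintegral fi))// -lee_fin fineK//.
exact: integrable_fin_num (cint_abs fi).
Qed.

End ComplexIntegral.

Section AlmostEverywhere.
Context {R : realType} d (T : measurableType d) (m : {measure set T -> \bar R}).
Implicit Types P Q S : T -> Prop.

Lemma aeS P Q : (forall x, P x -> Q x) ->
  {ae m, forall x, P x} -> {ae m, forall x, Q x}.
Proof. by move=> PQ; apply: filterS. Qed.

Lemma aeS2 P Q S : (forall x, P x -> Q x -> S x) ->
  {ae m, forall x, P x} -> {ae m, forall x, Q x} -> {ae m, forall x, S x}.
Proof. by move=> PQ; apply: filterS2. Qed.

End AlmostEverywhere.

(** * Fubini and Tonelli for complex integrands *)

Section Fubini.
Context {R : realType} d1 d2 (T1 : measurableType d1) (T2 : measurableType d2).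
Local Notation C := R[i].

Section Measurability.
Context (m2 : {sigma_finite_measure set T2 -> \bar R}).

(** Measurability of partial integrals is a Tonelli statement on nonnegative functions. The positive
    and negative parts are treated apart, and their difference is taken in the extended reals before
    [fine]. *)
Lemma measurable_Rintegral (h : T1 * T2 -> R) : measurable_fun setT h ->
  measurable_fun setT (fun x => Rintegral m2 setT (fun y => h (x, y))).
Proof.
move=> mh; apply: measurableT_comp; first exact: fine_measurable.
have mH : measurable_fun setT (EFin \o h) by exact/measurable_EFinP.
have -> : (fun x => \int[m2]_y (h (x, y))%:E)%E =
    (fun x => fubini_F m2 ((EFin \o h)^\+)%E x - fubini_F m2 ((EFin \o h)^\-)%E x)%E.
  apply/funext => x; rewrite integralE /fubini_F; congr (_ - _)%E;
    by apply: eq_integral => y _; rewrite ?funeposE ?funenegE.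
apply: emeasurable_funB; apply: measurable_fun_fubini_tonelli_F => //.
- exact: measurable_funepos.
- exact: measurable_funeneg.
Qed.

Lemma cmeas_cintegral (h : T1 * T2 -> C) : cmeasurable setT h ->
  cmeasurable setT (fun x => cintegral m2 setT (fun y => h (x, y))).
Proof.
move=> [mr mi]; split; first exact: (measurable_Rintegral mr).
exact: (measurable_Rintegral mi).
Qed.
End Measurability.

Context (m1 : {sigma_finite_measure set T1 -> \bar R})
        (m2 : {sigma_finite_measure set T2 -> \bar R}).

(** Integrability of every section, and not only of almost every one, makes the inner integrals
    finite everywhere, so that [fine] can be removed under the outer integral. *)
Lemma RFubini (h : T1 * T2 -> R) :
  (m1 \x m2)%E.-integrable setT (EFin \o h) ->
  (forall x, m2.-integrable setT (fun y => (h (x, y))%:E)) ->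
  (forall y, m1.-integrable setT (fun x => (h (x, y))%:E)) ->
  Rintegral m1 setT (fun x => Rintegral m2 setT (fun y => h (x, y))) =
    Rintegral (m1 \x m2)%E setT h /\
  Rintegral m2 setT (fun y => Rintegral m1 setT (fun x => h (x, y))) =
    Rintegral (m1 \x m2)%E setT h.
Proof.
move=> ih i2 i1; rewrite /Rintegral; split; congr fine.
  rewrite -integral12_prod_meas1//; apply: eq_integral => x _ /=.
  by rewrite fineK// integrable_fin_num.
rewrite -integral21_prod_meas1//; apply: eq_integral => x _ /=.
by rewrite fineK// integrable_fin_num.
Qed.

Lemma cFubini (h : T1 * T2 -> C) :
  cintegrable (m1 \x m2)%E setT h ->
  (forall x, cintegrable m2 setT (fun y => h (x, y))) ->
  (forall y, cintegrable m1 setT (fun x => h (x, y))) ->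
  cintegral m1 setT (fun x => cintegral m2 setT (fun y => h (x, y))) =
    cintegral (m1 \x m2)%E setT h /\
  cintegral m2 setT (fun y => cintegral m1 setT (fun x => h (x, y))) =
    cintegral (m1 \x m2)%E setT h.
Proof.
move=> [ir ii] i2 i1.
have [|||r1 r2] := @RFubini (fun z => complex.Re (h z)) => //.
- by move=> x; case: (i2 x).
- by move=> x; case: (i1 x).
have [|||s1 s2] := @RFubini (fun z => complex.Im (h z)) => //.
- by move=> x; case: (i2 x).
- by move=> x; case: (i1 x).
by split; apply: complex_eqP.
Qed.

Lemma cint_tensor (f : T1 -> C) (g : T2 -> C) (K : T1 * T2 -> C) (B : R) :
  cintegrable m1 setT f -> cintegrable m2 setT g -> cmeasurable setT K ->
  (forall z, cabs (K z) <= B) ->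
  cintegrable (m1 \x m2)%E setT (fun z => f z.1 * K z * g z.2).
Proof.
move=> fi gi mK KB.
have mf := cintegrable_meas fi; have mg := cintegrable_meas gi.
have mf1 : cmeasurable setT (fun z : T1 * T2 => f z.1).
  exact: cmeas_comp.
have mg2 : cmeasurable setT (fun z : T1 * T2 => g z.2).
  exact: cmeas_comp.
have : cintegrable (m1 \x m2)%E setT (fun z => (f z.1 * g z.2) * K z).
  apply: (cintMb measurableT mK (B := B)) => //.
  apply: cint_absP => //; first exact: cmeasM.
  have mfg : measurable_fun setT (fun z : T1 * T2 => (cabs (f z.1 * g z.2))%:E).
    by apply/measurable_EFinP; apply: cmeas_cabs; exact: cmeasM.
  rewrite fubini_tonelli1 => [|//|z]; last by rewrite lee_fin cabs_ge0.
  rewrite /fubini_F.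
  have Ig0 : 0 <= Rintegral m2 setT (fun y => cabs (g y)).
    by apply: Rintegral_ge0 => y _; exact: cabs_ge0.
  under eq_integral => x _.
    under eq_integral do rewrite cabsM EFinM /=.
    rewrite ge0_integralZl_EFin; first last.
    - exact: cabs_ge0.
    - by apply/measurable_EFinP; exact: cmeas_cabs.
    - by move=> y _; rewrite lee_fin cabs_ge0.
    - exact: measurableT.
    rewrite -[X in (_ * X)%E]fineK ?integrable_fin_num//; last exact: cint_abs.
    over.
  rewrite /= ge0_integralZr//.
  - rewrite lte_mul_pinfty//.
    + by apply: integral_ge0 => x _; rewrite lee_fin cabs_ge0.
    + by rewrite integrable_fin_num//; exact: cint_abs.
    + exact: ltry.
  - by apply/measurable_EFinP; exact: cmeas_cabs.
  - by move=> x _; rewrite lee_fin cabs_ge0.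
by under [X in _ -> cintegrable _ _ X]eq_fun do rewrite mulrAC.
Qed.

Lemma cint_section1 (g : T2 -> C) (K : T1 * T2 -> C) (B : R) x (c : C) :
  cintegrable m2 setT g -> cmeasurable setT K -> (forall z, cabs (K z) <= B) ->
  cintegrable m2 setT (fun y => c * K (x, y) * g y).
Proof.
move=> gi mK KB.
under eq_fun do rewrite mulrC.
apply: (cintMb measurableT (B := cabs c * B)) gi.
- apply: cmeasM; first exact: cmeas_cst.
  apply: (cmeas_comp mK); exact: measurable_fun_pair.
- by move=> y _; rewrite cabsM ler_wpM2l ?cabs_ge0.
Qed.

Lemma cint_section2 (f : T1 -> C) (K : T1 * T2 -> C) (B : R) y (c : C) :
  cintegrable m1 setT f -> cmeasurable setT K -> (forall z, cabs (K z) <= B) ->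
  cintegrable m1 setT (fun x => f x * K (x, y) * c).
Proof.
move=> gi mK KB.
under eq_fun do rewrite -mulrA.
apply: (cintMb measurableT (B := B * cabs c)) gi.
- apply: cmeasM; last exact: cmeas_cst.
  apply: (cmeas_comp mK); exact: measurable_fun_pair.
- by move=> x _; rewrite cabsM ler_wpM2r ?cabs_ge0.
Qed.

(** The form of Fubini behind the manipulations of Fourier integrals, where K is a character:
    boundedness of K makes the product integrand and all its sections integrable. *)
Lemma cFubini_kernel (f : T1 -> C) (g : T2 -> C) (K : T1 * T2 -> C) (B : R) :
  cintegrable m1 setT f -> cintegrable m2 setT g -> cmeasurable setT K ->
  (forall z, cabs (K z) <= B) ->
  cintegral m1 setT (fun x => f x * cintegral m2 setT (fun y => K (x, y) * g y)) =
  cintegral m2 setT (fun y => cintegral m1 setT (fun x => f x * K (x, y)) * g y).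
Proof.
move=> fi gi mK KB.
have [|||H1 H2] := @cFubini (fun z => f z.1 * K z * g z.2).
- exact: (cint_tensor fi gi mK KB).
- by move=> x; exact: (cint_section1 x (f x) gi mK KB).
- by move=> y; exact: (cint_section2 y (g y) fi mK KB).
- transitivity (cintegral m1 setT
    (fun x => cintegral m2 setT (fun y => f x * K (x, y) * g y))).
    apply: eq_cintegral => x _; rewrite -cintegralZ//.
      by apply: eq_cintegral => y _; rewrite mulrA.
    have := cint_section1 x 1 gi mK KB.
    by under eq_fun do rewrite mul1r.
  rewrite H1 -H2; apply: eq_cintegral => y _.
  rewrite mulrC -cintegralZ//; first by apply: eq_cintegral => x _; rewrite mulrC.
  have := cint_section2 y 1 fi mK KB.
  by under eq_fun do rewrite mulr1.
Qed.

Lemma cintegral_tensor (f : T1 -> C) (g : T2 -> C) :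
  cintegrable m1 setT f -> cintegrable m2 setT g ->
  cintegral (m1 \x m2)%E setT (fun z => f z.1 * g z.2) =
  cintegral m1 setT f * cintegral m2 setT g.
Proof.
move=> fi gi; pose K (z : T1 * T2) : C := 1.
have mK : cmeasurable setT K by exact: cmeas_cst.
have KB z : cabs (K z) <= 1 by rewrite /K cabsR normr1.
have [|||H1 H2] := @cFubini (fun z => f z.1 * K z * g z.2).
- exact: (cint_tensor fi gi mK KB).
- by move=> x; exact: (cint_section1 x (f x) gi mK KB).
- by move=> y; exact: (cint_section2 y (g y) fi mK KB).
- transitivity (cintegral (m1 \x m2)%E setT (fun z => f z.1 * K z * g z.2)).
    by apply: eq_cintegral => z _; rewrite mulr1.
  rewrite -H1 mulrC -cintegralZ//; apply: eq_cintegral => x _ /=.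
  rewrite mulrC -cintegralZ//; apply: eq_cintegral => y _; by rewrite mulr1.
Qed.

End Fubini.

(** * Square-integrable functions *)

Section L2.
Context {R : realType} d (T : measurableType d) (m : {measure set T -> \bar R}).
Local Notation C := R[i].
Implicit Types (f g h : T -> C).

(** The measure is arbitrary because the same notions serve on the plane and on the parameter space.
    At [mu2] they are convertible to [sqnorm2], [L2R2] and [dot], which later proofs exploit
    silently. *)
Definition sqn f : \bar R := (\int[m]_x (cabs (f x) ^+ 2)%:E)%E.
Definition isL2 f := cmeasurable setT f /\ (sqn f < +oo)%E.
Definition n2 f : R := fine (sqn f).
Definition ip f g : C := cintegral m setT (fun x => f x * (g x)^*%C).
Definition cvgL2 (f_ : nat -> T -> C) f :=
  (fun n => sqn (fun x => f_ n x - f x)) @ \oo --> 0%E.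

Lemma sqn_ge0 f : (0 <= sqn f)%E.
Proof. by apply: integral_ge0 => x _; rewrite lee_fin sqr_ge0. Qed.

Lemma n2_ge0 f : 0 <= n2 f. Proof. by rewrite fine_ge0// sqn_ge0. Qed.

Lemma sqnE f : isL2 f -> sqn f = (n2 f)%:E.
Proof. by move=> [_ l]; rewrite fineK// ge0_fin_numE// sqn_ge0. Qed.

Lemma mcabs2 f : cmeasurable setT f -> measurable_fun setT (fun x => (cabs (f x) ^+ 2)%:E).
Proof. by move=> mf; apply/measurable_EFinP; exact: cmeas_cabs2. Qed.

Lemma isL2_int f : isL2 f -> m.-integrable setT (fun x => (cabs (f x) ^+ 2)%:E).
Proof.
move=> [mf lf]; apply/integrableP; split; first exact: mcabs2.
by under eq_integral do rewrite /= ger0_norm ?sqr_ge0//.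
Qed.

Lemma isL2P f : cmeasurable setT f ->
  m.-integrable setT (fun x => (cabs (f x) ^+ 2)%:E) -> isL2 f.
Proof. by move=> mf /integrable_lty lf; split => //; exact: lf. Qed.

Lemma le_sqn f g : cmeasurable setT f -> cmeasurable setT g ->
  (forall x, cabs (f x) <= cabs (g x)) -> (sqn f <= sqn g)%E.
Proof.
move=> mf mg fg; apply: ge0_le_integral => //.
- by move=> x _; rewrite lee_fin sqr_ge0.
- exact: mcabs2.
- exact: mcabs2.
- by move=> x _; rewrite lee_fin ler_pXn2r ?nnegrE ?cabs_ge0.
Qed.

Lemma le_isL2 f g : cmeasurable setT f -> isL2 g ->
  (forall x, cabs (f x) <= cabs (g x)) -> isL2 f.
Proof. by move=> mf [mg lg] fg; split => //; exact: le_lt_trans (le_sqn mf mg fg) lg. Qed.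

Lemma eq_sqn f g : (forall x, cabs (f x) = cabs (g x)) -> sqn f = sqn g.
Proof. by move=> fg; apply: eq_integral => x _; rewrite fg. Qed.

Lemma ae_eq_sqn f g : cmeasurable setT f -> cmeasurable setT g ->
  {ae m, forall x, f x = g x} -> sqn f = sqn g.
Proof.
move=> mf mg fg; apply: ae_eq_integral => //; [exact: mcabs2|exact: mcabs2|].
by apply: filterS fg => x fgx _; rewrite fgx.
Qed.

Lemma sqnZ f (c : C) : cmeasurable setT f ->
  sqn (fun x => c * f x) = ((cabs c ^+ 2)%:E * sqn f)%E.
Proof.
move=> mf; rewrite /sqn -ge0_integralZl_EFin ?sqr_ge0//.
- by apply: eq_integral => x _; rewrite cabsM exprMn EFinM.
- by move=> x _; rewrite lee_fin sqr_ge0.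
- exact: mcabs2.
Qed.

(** This crude bound plays the part of Minkowski's inequality throughout: closure under sums and all
    convergence arguments only need some constant in front of the squared norms. *)
Lemma sqnD_le f g : cmeasurable setT f -> cmeasurable setT g ->
  (sqn (fun x => (f x + g x)%R) <= 2%:E * sqn f + 2%:E * sqn g)%E.
Proof.
move=> mf mg; rewrite /sqn -!ge0_integralZl_EFin//; last 4 first.
- by move=> x _; rewrite lee_fin sqr_ge0.
- exact: mcabs2.
- by move=> x _; rewrite lee_fin sqr_ge0.
- exact: mcabs2.
rewrite -ge0_integralD//; last 4 first.
- by move=> x _; rewrite lee_fin mulr_ge0// sqr_ge0.
- by apply/measurable_EFinP; apply: measurable_funM => //; exact: cmeas_cabs2.
- by move=> x _; rewrite lee_fin mulr_ge0// sqr_ge0.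
- by apply/measurable_EFinP; apply: measurable_funM => //; exact: cmeas_cabs2.
apply: ge0_le_integral => //.
- by move=> x _; rewrite lee_fin sqr_ge0.
- by apply: mcabs2; exact: cmeasD.
- by apply/measurable_EFinP; apply: measurable_funD;
    apply: measurable_funM => //; exact: cmeas_cabs2.
- by move=> x _; rewrite -EFinD lee_fin cabs2D.
Qed.

Lemma L2D f g : isL2 f -> isL2 g -> isL2 (fun x => f x + g x).
Proof.
move=> [mf lf] [mg lg]; split; first exact: cmeasD.
by apply: le_lt_trans (sqnD_le mf mg) _; rewrite lte_add_pinfty// lte_mul_pinfty.
Qed.

Lemma L2Z f (c : C) : isL2 f -> isL2 (fun x => c * f x).
Proof.
move=> [mf lf]; split; first by apply: cmeasM => //; exact: cmeas_cst.
by rewrite sqnZ// lte_mul_pinfty// ?lee_fin ?sqr_ge0.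
Qed.

Lemma L2J f : isL2 f -> isL2 (fun x => (f x)^*%C).
Proof. by move=> [mf lf]; split; [exact: cmeasJ|rewrite (@eq_sqn _ f)// => x; rewrite cabsJ]. Qed.

Lemma L2N f : isL2 f -> isL2 (fun x => - f x).
Proof. by move=> [mf lf]; split; [exact: cmeasN|rewrite (@eq_sqn _ f)// => x; rewrite cabsN]. Qed.

Lemma L2B f g : isL2 f -> isL2 g -> isL2 (fun x => f x - g x).
Proof. by move=> Lf Lg; apply: L2D => //; exact: L2N. Qed.

Lemma L2Mb f g (B : R) : isL2 f -> cmeasurable setT g -> (forall x, cabs (g x) <= B) ->
  isL2 (fun x => f x * g x).
Proof.
move=> Lf mg gB; apply: (@le_isL2 _ (fun x => B%:C%C * f x)).
- by apply: cmeasM => //; case: Lf.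
- exact: L2Z.
- move=> x; rewrite !cabsM mulrC ler_wpM2r ?cabs_ge0// cabsR.
  by rewrite (le_trans (gB x))// ler_norm.
Qed.

Lemma sqnBC f g : sqn (fun x => f x - g x) = sqn (fun x => g x - f x).
Proof. by apply: eq_sqn => x; rewrite -cabsN opprB. Qed.

Lemma sqn0_ae f : cmeasurable setT f -> sqn f = 0%E -> {ae m, forall x, f x = 0}.
Proof.
move=> mf f0.
have : {ae m, forall x, setT x -> (cabs (f x) ^+ 2)%:E = 0%E}.
  apply/(ae_eq_integral_abs m measurableT).
    exact: mcabs2.
  rewrite -f0; apply: eq_integral => x _.
  by rewrite gee0_abs// lee_fin sqr_ge0.
apply: filterS => x /(_ I) [] /eqP; rewrite sqrf_eq0 => /eqP.
exact: cabs0_eq0.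
Qed.

Lemma L2_prod_int f g : isL2 f -> isL2 g -> cintegrable m setT (fun x => f x * g x).
Proof.
move=> Lf Lg; have [mf _] := Lf; have [mg _] := Lg.
apply: (cint_dom measurableT
  (g := fun x => cabs (f x) ^+ 2 + cabs (g x) ^+ 2)).
- exact: cmeasM.
- move=> x _; apply: le_trans (cabsM_le _ _ (ltr01)) _.
  rewrite invr1 !mul1r ler_pdivrMr// mulrDr mulr1 lerDl.
  by rewrite addr_ge0// sqr_ge0.
- apply: (@integrableD _ _ _ m _ measurableT (fun x => (cabs (f x) ^+ 2)%:E)
    (fun x => (cabs (g x) ^+ 2)%:E)); exact: isL2_int.
Qed.

Lemma ip_int f g : isL2 f -> isL2 g -> cintegrable m setT (fun x => f x * (g x)^*%C).
Proof. by move=> Lf Lg; apply: (L2_prod_int Lf); exact: L2J. Qed.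

Lemma ipC f g : isL2 f -> isL2 g -> ip g f = (ip f g)^*%C.
Proof.
move=> Lf Lg; rewrite /ip -cintegralJ//; last exact: ip_int.
by apply: eq_cintegral => x _; apply: complex_eqP; rewrite !ReImE; ring.
Qed.

Lemma ipDl f g h : isL2 f -> isL2 g -> isL2 h ->
  ip (fun x => f x + g x) h = ip f h + ip g h.
Proof.
move=> Lf Lg Lh; rewrite /ip -cintegralD//; try exact: ip_int.
by apply: eq_cintegral => x _; rewrite mulrDl.
Qed.

Lemma ipBl f g h : isL2 f -> isL2 g -> isL2 h ->
  ip (fun x => f x - g x) h = ip f h - ip g h.
Proof.
move=> Lf Lg Lh; rewrite /ip -cintegralB//; try exact: ip_int.
by apply: eq_cintegral => x _; rewrite mulrBl.
Qed.

Lemma ipZl f g (c : C) : isL2 f -> isL2 g -> ip (fun x => c * f x) g = c * ip f g.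
Proof.
move=> Lf Lg; rewrite /ip -cintegralZ//; try exact: ip_int.
by apply: eq_cintegral => x _; rewrite mulrA.
Qed.

Lemma ipxx f : ip f f = (n2 f)%:C%C.
Proof.
rewrite /ip -[RHS](cintegral_real m setT (fun x => cabs (f x) ^+ 2)).
by apply: eq_cintegral => x _; exact: mulcJ.
Qed.

Lemma ae_eq_ip f g f' g' : cmeasurable setT f -> cmeasurable setT g ->
  cmeasurable setT f' -> cmeasurable setT g' ->
  {ae m, forall x, f x = f' x} -> {ae m, forall x, g x = g' x} ->
  ip f g = ip f' g'.
Proof.
move=> mf mg mf' mg' ff gg; apply: ae_eq_cintegral => //.
- by apply: cmeasM => //; exact: cmeasJ.
- by apply: cmeasM => //; exact: cmeasJ.
by apply: filterS2 ff gg => x fx gx _; rewrite fx gx.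
Qed.

Lemma ip_le f g (k : R) : isL2 f -> isL2 g -> 0 < k ->
  cabs (ip f g) <= (k * n2 f + k^-1 * n2 g) / 2.
Proof.
move=> Lf Lg k0; have [mf _] := Lf; have [mg _] := Lg.
apply: cabs_cintegral_le => //; first exact: ip_int.
have k20 : 0 <= k / 2 by rewrite divr_ge0// ltW.
have k30 : 0 <= k^-1 / 2 by rewrite divr_ge0// invr_ge0 ltW.
have -> : ((k * n2 f + k^-1 * n2 g) / 2)%:E =
    ((k / 2)%:E * sqn f + (k^-1 / 2)%:E * sqn g)%E.
  by rewrite !sqnE// -!EFinM -EFinD; congr EFin; ring.
rewrite /sqn -!ge0_integralZl_EFin//; last 4 first.
- by move=> x _; rewrite lee_fin sqr_ge0.
- exact: mcabs2.
- by move=> x _; rewrite lee_fin sqr_ge0.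
- exact: mcabs2.
rewrite -ge0_integralD//; last 4 first.
- by move=> x _; rewrite lee_fin mulr_ge0// sqr_ge0.
- by apply/measurable_EFinP; apply: measurable_funM => //; exact: cmeas_cabs2.
- by move=> x _; rewrite lee_fin mulr_ge0// sqr_ge0.
- by apply/measurable_EFinP; apply: measurable_funM => //; exact: cmeas_cabs2.
apply: ge0_le_integral => //.
- by move=> x _; rewrite lee_fin cabs_ge0.
- apply/measurable_EFinP; apply: cmeas_cabs; apply: cmeasM => //; exact: cmeasJ.
- by apply/measurable_EFinP; apply: measurable_funD;
    apply: measurable_funM => //; exact: cmeas_cabs2.
- move=> x _; rewrite -EFinD lee_fin; apply: le_trans (cabsM_le _ _ k0) _.
  by rewrite cabsJ; lra.
Qed.

(** Optimization of the weight in [ip_le]: at k = [A / n2 f] the first term equals A, and the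
    inequality becomes the claim. *)
Lemma CauchySchwarz f g : isL2 f -> isL2 g -> cabs (ip f g) ^+ 2 <= n2 f * n2 g.
Proof.
move=> Lf Lg; set A := cabs (ip f g).
have A0 : 0 <= A := cabs_ge0 _.
have [->|An] := eqVneq A 0; first by rewrite expr0n mulr_ge0 ?n2_ge0.
have {}A0 : 0 < A by rewrite lt_neqAle eq_sym An.
have AM k : 0 < k -> 2 * A <= k * n2 f + k^-1 * n2 g.
  by move=> k0; have := ip_le Lf Lg k0; rewrite ler_pdivlMr// mulrC.
have f0 := n2_ge0 f; have g0 := n2_ge0 g.
(* The optimal weight would be infinite here. The weight (n2 g + 1) / A already gives 2 A <= A n2 g
   / (n2 g + 1), which contradicts A > 0. *)
have [f00|fn] := eqVneq (n2 f) 0.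
  have /AM : 0 < (n2 g + 1) / A by rewrite divr_gt0// ltr_wpDl.
  rewrite f00 mulr0 add0r invf_div mulrAC ler_pdivlMr ?ltr_wpDl// => H.
  by nra.
have {}f0 : 0 < n2 f by rewrite lt_neqAle eq_sym fn.
have := AM _ (divr_gt0 A0 f0); rewrite divfK ?gt_eqF// invf_div mulrAC.
rewrite -lerBlDl ler_pdivlMr// => H.
by rewrite expr2; nra.
Qed.

Lemma n2D f g : isL2 f -> isL2 g ->
  n2 (fun x => f x + g x) = n2 f + n2 g + 2 * complex.Re (ip f g).
Proof.
move=> Lf Lg; have Lfg := L2D Lf Lg.
have -> : n2 (fun x => f x + g x) =
    complex.Re (ip (fun x => f x + g x) (fun x => f x + g x)) by rewrite ipxx.
rewrite ipDl// (ipC Lfg Lf) (ipC Lfg Lg) !ipDl// !ipxx (ipC Lf Lg) !ReImE /=.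
ring.
Qed.

End L2.

Section Limits.
Context {R : realType}.

Lemma cvg_to_EFin (u : nat -> R) (l : R) : u @ \oo --> l ->
  (fun n => (u n)%:E) @ \oo --> l%:E.
Proof. by move=> ul; apply: cvg_EFin => //; exact: nearW. Qed.

(** Serves wherever only an upper bound on the integral of the limit is wanted: completeness of L^2,
    the contraction property and the integrals of powers. *)
Lemma fatou_bound d (T : measurableType d) (m : {measure set T -> \bar R})
    (f_ : nat -> T -> \bar R) (f : T -> \bar R) (K : \bar R) :
  (forall n, measurable_fun setT (f_ n)) -> (forall n x, (0 <= f_ n x)%E) ->
  (forall x, f_ ^~ x @ \oo --> f x) -> (forall n, (\int[m]_x f_ n x <= K)%E) ->
  (\int[m]_x f x <= K)%E.
Proof.
move=> mf f0 ff fK.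
have -> : (\int[m]_x f x = \int[m]_x limn_einf (f_ ^~ x))%E.
  apply: eq_integral => x _.
  by have [-> _] := cvg_limn_einf_sup (ff x).
apply: (@le_trans _ _ (limn_einf (fun n => \int[m]_x f_ n x)%E)).
  by apply: fatou => // n x _; exact: f0.
rewrite limn_einf_lim; apply: lime_le; first exact: is_cvg_einfs.
apply: nearW => n; apply: le_trans (fK n); apply: ereal_inf_lbound.
by exists n => /=.
Qed.
End Limits.

(** * Completeness of L^2 and continuity of the inner product *)

Section RealCompleteness.
Context {R : realType} d (T : measurableType d) (m : {measure set T -> \bar R}).
Implicit Types (u : nat -> T -> R).

Let dist (f g : T -> R) : \bar R := (\int[m]_x ((f x - g x) ^+ 2)%:E)%E.

Let msq (f g : T -> R) : measurable_fun setT f -> measurable_fun setT g ->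
  measurable_fun setT (fun x => ((f x - g x) ^+ 2)%:E).
Proof.
by move=> mf mg; apply/measurable_EFinP; apply: measurable_funX; exact: measurable_funB.
Qed.

(* If S is the sum, then |v_(k+1) - v_k| <= sqrt S / 2^k.  Unlike the sum of the
   |v_(k+1) - v_k|, the sum S is integrated termwise without Minkowski's inequality. *)
Lemma cvg_weighted_increments (v : nat -> R) :
  (\sum_(k <oo) ((4 ^+ k * (v k.+1 - v k) ^+ 2)%:E) < +oo)%E -> cvgn v.
Proof.
move=> Sfin; set S := (\sum_(k <oo) _)%E in Sfin.
have S0 : (0 <= S)%E.
  by apply: nneseries_ge0 => k _ _; rewrite lee_fin mulr_ge0 ?sqr_ge0// exprn_ge0.
have SE : S = (fine S)%:E by rewrite fineK// ge0_fin_numE.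
have tv : forall k, `|telescope v k| <= geometric (Num.sqrt (fine S)) 2^-1 k.
  move=> k; rewrite /telescope /geometric /=.
  have : 4 ^+ k * (v k.+1 - v k) ^+ 2 <= fine S.
    rewrite -lee_fin -SE.
    apply: le_trans (@nneseries_lim_ge _ _ xpredT 0%N k.+1 _); last first.
      by move=> i _ _; rewrite lee_fin mulr_ge0 ?sqr_ge0// exprn_ge0.
    rewrite big_nat_recr//= leeDr// sume_ge0// => i _.
    by rewrite lee_fin mulr_ge0 ?sqr_ge0// exprn_ge0.
  rewrite exprVn ler_pdivlMr ?exprn_gt0// => H.
  rewrite -(ler_pXn2r (n := 2)) ?nnegrE ?mulr_ge0 ?exprn_ge0 ?sqrtr_ge0//.
  rewrite sqr_sqrtr; last by rewrite fine_ge0.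
  rewrite exprMn real_normK ?num_real// -exprM mulnC exprM mulrC.
  by apply: le_trans H; rewrite (_ : 2 ^+ 2 = 4 :> R)//; ring.
have cs : cvgn (series (telescope v)).
  apply: normed_cvg; apply: (series_le_cvg _ _ tv) => //.
  - by move=> k; rewrite /geometric /= mulr_ge0 ?sqrtr_ge0// exprn_ge0// invr_ge0.
  - apply: is_cvg_geometric_series.
    by rewrite ger0_norm ?invr_ge0// invf_lt1// ltr1n.
have -> : v = (fun n => v 0%N + series (telescope v) n).
  by apply/funext => n; exact: eq_sum_telescope.
by apply: is_cvgD => //; exact: is_cvg_cst.
Qed.

(** Riesz-Fischer: a fast subsequence converges almost everywhere by [cvg_weighted_increments], and
    Fatou along it turns the Cauchy bound into a bound on the distance to the limit. *)
Lemma real_L2_complete (u : nat -> T -> R) :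
  (forall n, measurable_fun setT (u n)) ->
  (forall e : R, 0 < e -> exists N, forall i j, (N <= i)%N -> (N <= j)%N ->
     (dist (u i) (u j) <= e%:E)%E) ->
  exists v, measurable_fun setT v /\
    forall e : R, 0 < e -> exists N, forall i, (N <= i)%N -> (dist (u i) v <= e%:E)%E.
Proof.
move=> mu cu.
have e0 k : 0 < (8^-1 : R) ^+ k by rewrite exprn_gt0.
pose N k := projT1 (cid (cu _ (e0 k))).
have NP k i j : (N k <= i)%N -> (N k <= j)%N -> (dist (u i) (u j) <= ((8^-1 : R) ^+ k)%:E)%E.
  by rewrite /N; case: cid => /= M; exact.
(* Summing the thresholds makes the extraction nondecreasing and above each [N k]; the added k makes
   it unbounded. *)
pose phi k := (\sum_(i < k.+1) N i + k)%N.
have phiN k : (N k <= phi k)%N by rewrite /phi big_ord_recr /= -addnA addnCA leq_addr.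
have phiS k : (phi k <= phi k.+1)%N by rewrite /phi [leqRHS]/= [in leqRHS]big_ord_recr /= -addnA leq_add2l addnS leqW// leq_addl.
have phik k : (k <= phi k)%N by rewrite /phi leq_addl.
pose v k := u (phi k).
have mv k : measurable_fun setT (v k) by exact: mu.
have dv k : (dist (v k.+1) (v k) <= ((8^-1 : R) ^+ k)%:E)%E.
  by apply: NP => //; exact: leq_trans (phiN k) (phiS k).
pose t k x := ((4 ^+ k * (v k.+1 x - v k x) ^+ 2)%:E : \bar R).
have t0 k x : (0 <= t k x)%E by rewrite lee_fin mulr_ge0 ?sqr_ge0// exprn_ge0.
have mt k : measurable_fun setT (t k).
  apply/measurable_EFinP; apply: measurable_funM => //.
  by apply: measurable_funX; exact: measurable_funB.
pose S x := (\sum_(k <oo) t k x)%E.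
have mS : measurable_fun setT S by apply: ge0_emeasurable_sum.
have S0 x : (0 <= S x)%E by apply: nneseries_ge0.
have iS : m.-integrable setT S.
  apply/integrableP; split => //.
  under eq_integral do rewrite gee0_abs//.
  rewrite integral_nneseries//.
  (* Squared increments at most 8^-k against the weight 4^k leave 2^-k, written in the form that
     [epsilon_trick0] sums. *)
  apply: (@le_lt_trans _ _ (\sum_(k <oo) ((2 / (2 ^ k.+1)%:R)%:E : \bar R))%E).
    apply: lee_nneseries => [k _ _|k _]; first exact: integral_ge0.
    rewrite /t; under eq_integral do rewrite EFinM.
    rewrite ge0_integralZl_EFin ?exprn_ge0//; last 2 first.
    - by move=> x _; rewrite lee_fin sqr_ge0.
    - exact: msq.
    apply: (@le_trans _ _ ((4 ^+ k)%:E * ((8^-1 : R) ^+ k)%:E)%E).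
      by rewrite lee_pmul2l ?lte_fin ?exprn_gt0//; exact: dv.
    rewrite -EFinM lee_fin -exprMn (_ : 4 * 8^-1 = 2^-1 :> R); last by field.
    by rewrite natrX exprS invfM mulrA divff// mul1r exprVn.
  apply: le_lt_trans (@epsilon_trick0 R 2 xpredT _) _ => //.
  exact: ltry.
have aeS : {ae m, forall x, (S x < +oo)%E}.
  have := integrable_ae measurableT iS; apply: filterS => x /(_ I).
  by rewrite ge0_fin_numE.
pose A := [set x | (S x < +oo)%E].
have mA : measurable A.
  by rewrite -[A]setTI; exact: emeasurable_fun_infty_o.
(* Cutting to [A] makes the subsequence converge at every point, so that its pointwise limit is
   measurable; off [A] it is constantly 0. *)
pose w k x := v k x * \1_A x.
have mw k : measurable_fun setT (w k) by exact: measurable_funM.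
have cw x : cvgn (w ^~ x).
  have [Ax|Ax] := pselect (A x).
    rewrite /w (_ : \1_A x = 1); last by rewrite indicE mem_set.
    by under eq_fun do rewrite mulr1; exact: cvg_weighted_increments.
  rewrite /w (_ : \1_A x = 0); last by rewrite indicE memNset.
  by under eq_fun do rewrite mulr0; exact: is_cvg_cst.
pose l x := limn (w ^~ x).
exists l; split.
  by apply: (measurable_fun_cvg mw) => x _; exact: cw.
move=> e e_gt0; have [M MP] := cu e e_gt0; exists M => i Mi.
apply: (@fatou_bound _ _ _ _ (fun k x => ((u i x - w (k + M)%N x) ^+ 2)%:E)).
- by move=> k; exact: msq.
- by move=> k x; rewrite lee_fin sqr_ge0.
- move=> x; apply: cvg_to_EFin; rewrite (expr2 (u i x - l x)).
  have H : (fun k => u i x - w (k + M)%N x) @ \oo --> u i x - l x.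
    apply: cvgB; first exact: cvg_cst.
    by have := cw x; rewrite -(cvg_shiftn M).
  exact: (cvgM H H).
- move=> k; rewrite (_ : (\int[m]_x _)%E = dist (u i) (v (k + M)%N)).
    by apply: MP => //; exact: leq_trans (leq_addl k M) (phik _).
  apply: ge0_ae_eq_integral => //.
  + exact: msq.
  + exact: msq.
  + by move=> x _; rewrite lee_fin sqr_ge0.
  + by move=> x _; rewrite lee_fin sqr_ge0.
  + apply: filterS aeS => x Sx _; rewrite /w (_ : \1_A x = 1) ?mulr1//.
    by rewrite indicE mem_set.
Qed.
End RealCompleteness.

Section L2Complete.
Context {R : realType} d (T : measurableType d) (m : {measure set T -> \bar R}).
Local Notation C := R[i].
Implicit Types (f g h : T -> C).
Local Notation sqn := (sqn m).

Lemma sqn_ReIm f : cmeasurable setT f ->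
  sqn f = (\int[m]_x (complex.Re (f x) ^+ 2)%:E +
           \int[m]_x (complex.Im (f x) ^+ 2)%:E)%E.
Proof.
move=> [mr mi]; rewrite -ge0_integralD//.
- by apply: eq_integral => x _; rewrite cabsE2.
- by move=> x _; rewrite lee_fin sqr_ge0.
- by apply/measurable_EFinP; exact: measurable_funX.
- by move=> x _; rewrite lee_fin sqr_ge0.
- by apply/measurable_EFinP; exact: measurable_funX.
Qed.

Lemma cvge0P (a : nat -> \bar R) : (forall n, 0 <= a n)%E ->
  (a @ \oo --> 0%E) <->
  (forall e : R, 0 < e -> exists N, forall i, (N <= i)%N -> (a i <= e%:E)%E).
Proof.
move=> a0; split=> [|H].
  move=> /fine_cvgP[[N1 _ fa] /cvgrPdist_le H] e /H [N2 _ N2P].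
  exists (maxn N1 N2) => i; rewrite geq_max => /andP[i1 i2].
  have := N2P i i2; rewrite sub0r normrN /= ger0_norm ?fine_ge0//.
  by rewrite -lee_fin fineK//; exact: fa.
apply/fine_cvgP; split.
  have [N NP] := H 1 ltr01; exists N => // i /NP ai.
  by rewrite /= ge0_fin_numE// (le_lt_trans ai)// ltry.
apply/cvgrPdist_le => e /H [N NP]; exists N => // i /NP ai /=.
rewrite sub0r normrN ger0_norm ?fine_ge0// -lee_fin fineK//.
by rewrite ge0_fin_numE// (le_lt_trans ai)// ltry.
Qed.

Lemma cvgL2P (f_ : nat -> T -> C) f :
  cvgL2 m f_ f <-> (forall e : R, 0 < e -> exists N, forall i, (N <= i)%N ->
    (sqn (fun x => (f_ i x - f x)%R) <= e%:E)%E).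
Proof. by apply: cvge0P => n; exact: sqn_ge0. Qed.

Lemma L2_complete (f_ : nat -> T -> C) : (forall n, isL2 m (f_ n)) ->
  (forall e : R, 0 < e -> exists N, forall i j, (N <= i)%N -> (N <= j)%N ->
     (sqn (fun x => (f_ i x - f_ j x)%R) <= e%:E)%E) ->
  exists f, isL2 m f /\ cvgL2 m f_ f.
Proof.
move=> Lf cf.
have sE (g h : T -> C) : cmeasurable setT g -> cmeasurable setT h ->
  sqn (fun x => g x - h x)%R =
    (\int[m]_x ((complex.Re (g x) - complex.Re (h x)) ^+ 2)%:E +
     \int[m]_x ((complex.Im (g x) - complex.Im (h x)) ^+ 2)%:E)%E.
  move=> mg mh; rewrite sqn_ReIm; last exact: cmeasB.
  by congr (_ + _)%E; apply: eq_integral => x _; rewrite !ReImE.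
have mf n : cmeasurable setT (f_ n) by case: (Lf n).
have sq0 (g : T -> R) : (0 <= \int[m]_x (g x ^+ 2)%:E)%E.
  by apply: integral_ge0 => x _; rewrite lee_fin sqr_ge0.
have [n|e e0|r [mr rP]] :=
    @real_L2_complete _ _ _ m (fun n x => complex.Re (f_ n x)).
- by case: (mf n).
- have [N NP] := cf e e0; exists N => i j Ni Nj; apply: le_trans (NP i j Ni Nj).
  by rewrite sE// leeDl// (sq0 (fun x => _ - _)).
have [n|e e0|s [ms sP]] :=
    @real_L2_complete _ _ _ m (fun n x => complex.Im (f_ n x)).
- by case: (mf n).
- have [N NP] := cf e e0; exists N => i j Ni Nj; apply: le_trans (NP i j Ni Nj).
  by rewrite sE// leeDr// (sq0 (fun x => _ - _)).
pose f x : C := (r x +i* s x)%C.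
have mf' : cmeasurable setT f by [].
have cvf : cvgL2 m f_ f.
  apply/cvgL2P => e e0; have e20 : 0 < e / 2 by rewrite divr_gt0.
  have [N1 N1P] := rP _ e20; have [N2 N2P] := sP _ e20.
  exists (maxn N1 N2) => i; rewrite geq_max => /andP[i1 i2].
  by rewrite sE// [e]splitr EFinD leeD//; [exact: N1P|exact: N2P].
exists f; split => //; split => //.
have /cvgL2P/(_ 1 ltr01)[N /(_ N (leqnn N)) NP] := cvf.
have L1 : isL2 m (fun x => f_ N x - f x).
  by split; [exact: cmeasB|rewrite (le_lt_trans NP)// ltry].
have [_] := L2B (Lf N) L1.
by rewrite (@eq_sqn _ _ _ _ _ f)// => x; rewrite opprB addrC subrK.
Qed.

(** Quarters take the place of the usual halves, because each squared norm is doubled by [sqnD_le]: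
    2 (e / 4) + 2 (e / 4) = e. *)
Lemma sqn_triangle f g h (e : R) : isL2 m f -> isL2 m g -> isL2 m h ->
  (sqn (fun x => (f x - g x)%R) <= (e / 4)%:E)%E ->
  (sqn (fun x => (g x - h x)%R) <= (e / 4)%:E)%E ->
  (sqn (fun x => (f x - h x)%R) <= e%:E)%E.
Proof.
move=> [mf _] [mg _] [mh _] fg gh.
rewrite (@eq_sqn _ _ _ _ _ (fun x => (f x - g x) + (g x - h x))); last first.
  by move=> x; rewrite addrA subrK.
apply: le_trans (sqnD_le m (cmeasB mf mg) (cmeasB mg mh)) _.
apply: (@le_trans _ _ (2%:E * (e / 4)%:E + 2%:E * (e / 4)%:E)%E).
  by rewrite leeD// lee_pmul2l.
by rewrite -!EFinM -EFinD lee_fin; lra.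
Qed.

Lemma cvgL2_cauchy (f_ : nat -> T -> C) f : (forall n, isL2 m (f_ n)) -> isL2 m f ->
  cvgL2 m f_ f ->
  forall e : R, 0 < e -> exists N, forall i j, (N <= i)%N -> (N <= j)%N ->
     (sqn (fun x => (f_ i x - f_ j x)%R) <= e%:E)%E.
Proof.
move=> Lf_ Lf /cvgL2P cf e e0.
have e40 : 0 < e / 4 by rewrite divr_gt0.
have [N NP] := cf _ e40; exists N => i j Ni Nj.
apply: (sqn_triangle (Lf_ i) Lf (Lf_ j)); first exact: NP.
by rewrite sqnBC; exact: NP.
Qed.

Lemma cvgL2_trans (f_ g_ : nat -> T -> C) f : (forall n, isL2 m (f_ n)) ->
  (forall n, isL2 m (g_ n)) -> isL2 m f -> cvgL2 m g_ f ->
  cvgL2 m (fun n x => f_ n x - g_ n x) (fun=> 0) -> cvgL2 m f_ f.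
Proof.
move=> Lf_ Lg_ Lf /cvgL2P cg /cvgL2P cd; apply/cvgL2P => e e0.
have e40 : 0 < e / 4 by rewrite divr_gt0.
have [N1 N1P] := cg _ e40; have [N2 N2P] := cd _ e40.
exists (maxn N1 N2) => i; rewrite geq_max => /andP[i1 i2].
apply: (sqn_triangle (Lf_ i) (Lg_ i) Lf); last exact: N1P.
by have := N2P i i2; under [X in (sqn X <= _)%E]eq_fun do rewrite subr0.
Qed.

Lemma cvgL2_cst f : cvgL2 m (fun=> f) f.
Proof.
apply/cvgL2P => e e0; exists 0%N => i _.
rewrite (_ : sqn _ = 0%E) ?lee_fin ?ltW//.
by rewrite /sqn; under eq_integral do rewrite subrr cabs0 expr0n; rewrite integral0.
Qed.

Lemma cvgL2_uniq (f_ : nat -> T -> C) f g : (forall n, isL2 m (f_ n)) ->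
  isL2 m f -> isL2 m g -> cvgL2 m f_ f -> cvgL2 m f_ g ->
  {ae m, forall x, f x = g x}.
Proof.
move=> Lf_ Lf Lg /cvgL2P cf /cvgL2P cg.
have [mf _] := Lf; have [mg _] := Lg.
have : {ae m, forall x, f x - g x = 0}.
  apply: sqn0_ae; first exact: cmeasB.
  apply/eqP; rewrite eq_le sqn_ge0 andbT; apply/lee_addgt0Pr => e e0.
  rewrite add0e; have e40 : 0 < e / 4 by rewrite divr_gt0.
  have [N1 N1P] := cf _ e40; have [N2 N2P] := cg _ e40.
  set i := maxn N1 N2; have [mi _] := Lf_ i.
    apply: (sqn_triangle Lf (Lf_ i) Lg).
    by rewrite sqnBC; apply: N1P; rewrite leq_maxl.
  by apply: N2P; rewrite leq_maxr.
by apply: filterS => x /eqP; rewrite subr_eq0 => /eqP.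
Qed.

Definition ccvg (z_ : nat -> C) (z : C) :=
  forall e : R, 0 < e -> exists N, forall i, (N <= i)%N -> cabs (z_ i - z) <= e.

Lemma ccvg_uniq (z_ : nat -> C) z w : ccvg z_ z -> ccvg z_ w -> z = w.
Proof.
move=> zz zw; apply/eqP; rewrite -subr_eq0; apply/eqP/cabs0_eq0/eqP.
rewrite eq_le cabs_ge0 andbT; apply/ler_addgt0Pr => e e0; rewrite add0r.
have e20 : 0 < e / 2 by rewrite divr_gt0.
have [N1 N1P] := zz _ e20; have [N2 N2P] := zw _ e20.
set i := maxn N1 N2.
rewrite (_ : z - w = - (z_ i - z) + (z_ i - w)); last by ring.
rewrite (le_trans (cabsD _ _))// [e]splitr cabsN lerD//; [apply: N1P|apply: N2P].
  exact: leq_maxl.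
exact: leq_maxr.
Qed.

Lemma ccvgJ (z_ : nat -> C) z : ccvg z_ z -> ccvg (fun n => (z_ n)^*%C) z^*%C.
Proof.
move=> H e /H[N NP]; exists N => i /NP.
rewrite -cabsJ; congr (cabs _ <= _).
by apply: complex_eqP; rewrite !ReImE; ring.
Qed.

Lemma cvgL2_ip (f_ : nat -> T -> C) f g : (forall n, isL2 m (f_ n)) ->
  isL2 m f -> isL2 m g -> cvgL2 m f_ f -> ccvg (fun n => ip m (f_ n) g) (ip m f g).
Proof.
move=> Lf_ Lf Lg /cvgL2P cf e e0.
have g0 := n2_ge0 m g.
(* The added 1 covers n2 g = 0; Cauchy-Schwarz then bounds the squared error by e^2. *)
have k0 : 0 < e ^+ 2 / (n2 m g + 1) by rewrite divr_gt0 ?exprn_gt0// ltr_wpDl.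
have [N NP] := cf _ k0; exists N => i /NP.
rewrite -ipBl//; have Lfi := L2B (Lf_ i) Lf.
rewrite (sqnE Lfi) lee_fin => H.
rewrite -(ler_pXn2r (n := 2)) ?nnegrE ?cabs_ge0 ?(ltW e0)//.
apply: le_trans (CauchySchwarz Lfi Lg) _.
rewrite ler_pdivlMr ?ltr_wpDl// in H.
apply: le_trans H; rewrite ler_wpM2l ?n2_ge0//.
by rewrite lerDl.
Qed.

Lemma cvgL2_ipr (f_ : nat -> T -> C) f g : (forall n, isL2 m (f_ n)) ->
  isL2 m f -> isL2 m g -> cvgL2 m f_ f -> ccvg (fun n => ip m g (f_ n)) (ip m g f).
Proof.
move=> Lf_ Lf Lg cf; rewrite (ipC Lf Lg).
have -> : (fun n => ip m g (f_ n)) = (fun n => (ip m (f_ n) g)^*%C).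
  by apply/funext => n; rewrite (ipC (Lf_ n) Lg).
by apply: ccvgJ; exact: cvgL2_ip.
Qed.

End L2Complete.

(** * The Poisson kernel and the Plancherel theorem *)

Section AffineChange.
Context {R : realType}.
Local Notation mu := (@lebesgue_measure R).

Lemma measurable_affine (k c : R) :
  measurable_fun [set: measurableTypeR R] (fun x => k * x + c : measurableTypeR R).
Proof. by apply: measurable_funD => //; apply: measurable_funM. Qed.

(** The pushforward of the Lebesgue measure, multiplied by |k|, gives half-open intervals their
    length, and this characterizes the Lebesgue measure. *)
Lemma lebesgue_measure_affine (k c : R) (A : set (measurableTypeR R)) :
  k != 0 -> measurable A ->
  (mu ((fun x => (k * x + c)%R) @^-1` A) = (`|k|^-1)%:E * mu A)%E.
Proof.
move=> k0 mA; pose f x : measurableTypeR R := k * x + c.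
have mf : measurable_fun [set: measurableTypeR R] f := measurable_affine k c.
pose nu := mscale (NngNum (normr_ge0 k))
  (measure_function_pushforward__canonical__measure_function_Measure mu mf).
have nk0 : 0 < `|k| by rewrite normr_gt0.
have -> : mu A = nu A.
  apply: lebesgue_measure_unique => //= _ [[a b]] _ <-.
  rewrite /nu /mscale /= /pushforward.
  have [kp|kn] : 0 < k \/ k < 0 by move: k0; rewrite neq_lt => /orP[]; [right|left].
    have -> : f @^-1` `]a, b] = `](a - c) / k, (b - c) / k]%classic.
      apply/seteqP; split => x /=; rewrite /f !in_itv /= ltr_pdivrMr// ler_pdivlMr//
        ltrBlDr lerBrDr (mulrC x); exact.
    rewrite !lebesgue_measure_itv /= !lte_fin ltr_pM2r ?invr_gt0// ltrD2r.
    case: ifPn => ab; last by rewrite mule0.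
    by rewrite -!EFinB -EFinM gtr0_norm//; congr EFin; field.
  (* A negative slope reverses the interval, so the closed end moves to the left; the length is
     unaffected. *)
  have -> : f @^-1` `]a, b] = `[(b - c) / k, (a - c) / k[%classic.
    apply/seteqP; split => x /=; rewrite /f !in_itv /= ltr_ndivlMr// ler_ndivrMr//
      ltrBlDr lerBrDr (mulrC x) andbC; exact.
  rewrite !lebesgue_measure_itv /= !lte_fin ltr_nM2r ?invr_lt0// ltrD2r.
  case: ifPn => ab; last by rewrite mule0.
  by rewrite -!EFinB -EFinM ltr0_norm//; congr EFin; field; rewrite lt_eqF.
rewrite /nu /mscale /= muleA -EFinM mulVf ?mul1e// gt_eqF//.
Qed.

Lemma ge0_integral_affine (k c : R) (g : R -> \bar R) : k != 0 ->
  measurable_fun [set: measurableTypeR R] g -> (forall x, 0 <= g x)%E ->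
  (\int[mu]_x g (k * x + c)%R = (`|k|^-1)%:E * \int[mu]_x g x)%E.
Proof.
move=> k0 mg g0; pose f x : measurableTypeR R := k * x + c.
have mf : measurable_fun [set: measurableTypeR R] f := measurable_affine k c.
transitivity (\int[pushforward mu f]_x g x)%E.
  rewrite ge0_integral_pushforward//; by [].
have k1 : 0 <= `|k|^-1 by rewrite invr_ge0.
rewrite (eq_measure_integral (mscale (NngNum k1) mu)); last first.
  by move=> A mA _ /=; rewrite /pushforward /mscale /= -(lebesgue_measure_affine c k0 mA).
by rewrite ge0_integral_mscale.
Qed.

End AffineChange.

Section Calculus.
Context {R : realType}.
Local Notation mu := (@lebesgue_measure R).

Lemma FTC2_total (f F : R -> R) (a b : R) : a < b -> continuous f ->
  (forall x, is_derive (x : R) 1 F (f x)) ->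
  (\int[mu]_(x in `[a, b]) (f x)%:E = (F b - F a)%:E)%E.
Proof.
move=> ab cf dF.
have cF : continuous F.
  by move=> x; apply/differentiable_continuous/derivable1_diffP; case: (dF x).
rewrite (@continuous_FTC2 _ f F)//.
- by apply: continuous_subspaceT => x; exact: cf.
- split.
  + by move=> x _; case: (dF x).
  + by apply: cvg_at_right_filter; exact: cF.
  + by apply: cvg_at_left_filter; exact: cF.
- by move=> x _; rewrite derive1E derive_val.
Qed.

Lemma FTC2y_total (f F : R -> R) (a l : R) : continuous f ->
  (forall x, a <= x -> 0 <= f x) -> F x @[x --> +oo] --> l ->
  (forall x, is_derive (x : R) 1 F (f x)) ->
  (\int[mu]_(x in `[a, +oo[) (f x)%:E = (l - F a)%:E)%E.
Proof.
move=> cf f0 Fl dF.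
have cF : continuous F.
  by move=> x; apply/differentiable_continuous/derivable1_diffP; case: (dF x).
rewrite (@ge0_continuous_FTC2y _ f F a l)//.
- by apply: continuous_subspaceT => x; exact: cf.
- by apply: cvg_at_right_filter; exact: cF.
- by move=> x _; rewrite derive1E derive_val.
Qed.

Lemma cvg_expR_bounded (e K : R) (B : R -> R) : 0 < e -> (forall x, `|B x| <= K) ->
  expR (- (e * x)) * B x @[x --> +oo] --> (0 : R).
Proof.
move=> e0 BK.
have K0 : 0 <= K by apply: le_trans (BK 0).
have ex : (e * x) @[x --> +oo] --> +oo%R.
  apply/cvgryPge => A; apply: filterS (nbhs_pinfty_ge (num_real (A / e))) => x.
  by rewrite ler_pdivrMr// mulrC.
have c0 : expR (- (e * x)) @[x --> +oo] --> (0 : R).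
  exact: (cvg_comp _ _ ex (@cvgr_expR R)).
apply/cvgr0Pnorm_le => d d0.
have dK : 0 < d / (K + 1) by rewrite divr_gt0// ltr_wpDl.
move/cvgr0Pnorm_le: c0 => /(_ _ dK) c0.
near=> x; rewrite normrM.
have : `|expR (- (e * x))| <= d / (K + 1) by near: x.
rewrite ler_pdivlMr ?ltr_wpDl// => H; apply: le_trans H.
by rewrite ler_wpM2l// (le_trans (BK x))// lerDl.
Unshelve. all: by end_near. Qed.

End Calculus.

(** * The Fourier transform of exp (- e |w|) on the line *)

Section Poisson.
Context {R : realType}.
Local Notation C := R[i].
Local Notation mu := (@lebesgue_measure R).
Context (e : R) (e0 : 0 < e).

Definition poisson (z : R) : R := 2 * e / (e ^+ 2 + (2 * pi * z) ^+ 2).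

Let den_gt0 (b : R) : 0 < e ^+ 2 + b ^+ 2.
Proof. by rewrite ltr_pwDl ?exprn_gt0// sqr_ge0. Qed.

Lemma poisson_ge0 z : 0 <= poisson z.
Proof. by rewrite divr_ge0 ?(ltW (den_gt0 _))// mulr_ge0// ltW. Qed.

Lemma poissonN z : poisson (- z) = poisson z.
Proof. by rewrite /poisson mulrN sqrrN. Qed.

Lemma poisson_le z : poisson z <= 2 / e.
Proof.
rewrite /poisson ler_pdivrMr// mulrDr expr2 mulrA divfK ?gt_eqF// lerDl.
by rewrite mulr_ge0 ?sqr_ge0// divr_ge0// ltW.
Qed.

Lemma continuous_poisson : continuous poisson.
Proof.
move=> z; apply: cvgM; first exact: cvg_cst.
apply: cvgV; first by rewrite gt_eqF.
apply: cvgD; first exact: cvg_cst.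
rewrite (_ : (fun y => (2 * pi * y) ^+ 2) = (fun y => (2 * pi * y) * (2 * pi * y)))//.
by apply: cvgM; apply: cvgM => //; exact: cvg_cst.
Qed.

Lemma is_derive_atan_affine (k x y : R) :
  is_derive (y : R) (1 : R) (fun y => atan (k * (y - x))) (k / (1 + (k * (y - x)) ^+ 2)).
Proof.
have H : is_derive (y : R) (1 : R) (fun y : R => k * (y - x)) k.
  have : is_derive (y : R) (1 : R) (k \*: (id - cst x)) (k *: (1 - 0)).
    exact: is_deriveZ.
  by rewrite subr0 [_ *: _]mulr1.
have := @is_derive1_comp R atan (fun y : R => k * (y - x)) y _ _
  (is_derive1_atan (k * (y - x))) H.
by rewrite mulrC.
Qed.

Lemma is_derive_atan_poisson x y :
  is_derive (y : R) (1 : R) (fun y => pi^-1 * atan (2 * pi / e * (y - x))) (poisson (x - y)).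
Proof.
have := is_deriveZ pi^-1 (is_derive_atan_affine (2 * pi / e) x y).
move=> H; apply: (is_derive_eq H); rewrite /poisson /GRing.scale /=.
have p0 : pi != 0 :> R by rewrite gt_eqF// pi_gt0.
have e1 : e != 0 by rewrite gt_eqF.
set q := 2 * pi * (y - x).
rewrite (_ : 2 * pi * (x - y) = - q); last by rewrite /q; ring.
rewrite (_ : 2 * pi / e * (y - x) = q / e); last by rewrite /q; field.
rewrite sqrrN; have D0 : e ^+ 2 + q ^+ 2 != 0 by rewrite gt_eqF.
by clearbody q; move: (pi : R) p0 => P p0; field; rewrite p0 e1 D0.
Qed.

Lemma integral_poisson_itv x (a b : R) : a < b ->
  (\int[mu]_(y in `[a, b]) (poisson (x - y))%:E =
    (pi^-1 * (atan (2 * pi / e * (b - x)) - atan (2 * pi / e * (a - x))))%:E)%E.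
Proof.
move=> ab.
rewrite (FTC2_total ab _ (is_derive_atan_poisson x)).
  by congr EFin; rewrite [RHS]mulrBr.
move=> y; apply: (@continuous_comp _ _ _ (fun y => x - y) poisson); last exact: continuous_poisson.
by apply: cvgB => //; exact: cvg_cst.
Qed.

(** The antiderivative is an arctangent divided by pi, which varies by less than 1 over any
    interval; symmetric intervals exhaust the line. An upper bound on the mass is all that the
    contraction property asks for. *)
Lemma integral_poisson_le1 x : (\int[mu]_y (poisson (x - y))%:E <= 1)%E.
Proof.
have mp : measurable_fun [set: measurableTypeR R] (fun y => (poisson (x - y))%:E).
  apply/measurable_EFinP; apply: continuous_measurable_fun => y.
  apply: (@continuous_comp _ _ _ (fun y => x - y) poisson); last exact: continuous_poisson.
  by apply: cvgB => //; exact: cvg_cst.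
pose F n := `[- n.+1%:R, n.+1%:R]%classic : set (measurableTypeR R).
have := @ge0_nondecreasing_set_cvg_integral _ _ _ F (fun y => (poisson (x - y))%:E) mu.
rewrite (_ : \bigcup_i F i = setT); last first.
  apply/seteqP; split => // y _; exists (Num.truncn `|y|) => //=.
  by rewrite /F /= in_itv /= -ler_norml ltW// truncnS_gt.
move=> H; apply: (cvge_le _ (H _ _ _ _)).
- apply: nearW => n; rewrite integral_poisson_itv; last first.
    by apply: (@lt_trans _ _ 0); rewrite ?oppr_lt0 ltr0n.
  rewrite lee_fin ler_pdivrMl ?pi_gt0// mulr1.
  have := atan_ltpi2 (2 * pi / e * (n.+1%:R - x)).
  have := atan_gtNpi2 (2 * pi / e * (- n.+1%:R - x)).
  lra.
- apply/nondecreasing_seqP => n; apply/subsetPset; apply: subset_itv;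
    by rewrite bnd_simp ?lerN2 ler_nat.
- by move=> n; exact: measurable_itv.
- by move=> n; exact: measurable_funTS.
- by move=> n y _; rewrite lee_fin poisson_ge0.
Qed.

Definition expabs (w : R) : R := expR (- (e * `|w|)).

Lemma continuous_expabs : continuous expabs.
Proof.
move=> w; apply: (@continuous_comp _ _ _ (fun w => - (e * `|w|)) expR); last exact: continuous_expR.
by apply: cvgN; apply: cvgM; [exact: cvg_cst|exact: norm_continuous].
Qed.

Lemma measurable_expabs : measurable_fun [set: measurableTypeR R] expabs.
Proof. by apply: continuous_measurable_fun; exact: continuous_expabs. Qed.

Lemma expabs_ge0 w : 0 <= expabs w. Proof. exact: expR_ge0. Qed.

Lemma expabs_le1 w : expabs w <= 1.
Proof. by rewrite -expR0 ler_expR oppr_le0 mulr_ge0// ltW. Qed.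

(** An antiderivative of exp (- e w) (1 + cos (b w)). The summand 1 makes the integrand nonnegative,
    as the fundamental theorem on a half line requires; its contribution is subtracted
    afterwards. *)
Let F0 (b w : R) := - expR (- (e * w)) / e +
  expR (- (e * w)) * (b * sin (b * w) - e * cos (b * w)) / (e ^+ 2 + b ^+ 2).

Let dF0 b w : is_derive (w : R) (1 : R) (F0 b) (expR (- (e * w)) * (1 + cos (b * w))).
Proof.
have dl (k : R) : is_derive (w : R) (1 : R) (fun y : R => k * y) k.
  have : is_derive (w : R) (1 : R) (k \*: (id : R -> R)) (k *: 1).
    exact: is_deriveZ.
  by rewrite [_ *: _]mulr1.
have dE : is_derive (w : R) (1 : R) (fun w => expR (- (e * w))) (- e * expR (- (e * w))).
  have dN : is_derive (w : R) (1 : R) (fun y : R => - (e * y)) (- e) by exact: is_deriveN.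
  have := @is_derive1_comp R expR (fun y : R => - (e * y)) w _ _
    (is_derive_expR (- (e * w))) dN.
  by rewrite mulrC.
have dS : is_derive (w : R) (1 : R) (fun w => sin (b * w)) (b * cos (b * w)).
  by have := @is_derive1_comp R sin (fun y : R => b * y) w _ _ (is_derive_sin (b * w)) (dl b); rewrite mulrC.
have dC : is_derive (w : R) (1 : R) (fun w => cos (b * w)) (- b * sin (b * w)).
  have := @is_derive1_comp R cos (fun y : R => b * y) w _ _ (is_derive_cos (b * w)) (dl b).
  by rewrite mulNr mulrC mulNr.
have dB := is_deriveB (is_deriveZ b dS) (is_deriveZ e dC).
have dP := is_deriveZ (e ^+ 2 + b ^+ 2)^-1 (is_deriveM dE dB).
have dQ := is_deriveD (is_deriveZ (- e^-1) dE) dP.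
have -> : F0 b = (- e^-1 \*: (fun w => expR (- (e * w)))) +
  ((e ^+ 2 + b ^+ 2)^-1 \*: ((fun w => expR (- (e * w))) *
     ((b \*: (fun w => sin (b * w))) - (e \*: (fun w => cos (b * w)))))).
  apply/funext => y; rewrite /F0 /= !fctE /=.
  by rewrite /GRing.scale /=; ring.
apply: (is_derive_eq dQ); rewrite !fctE /GRing.scale /=.
have E (X S Z : R) : - e^-1 * (- e * X) + (e ^+ 2 + b ^+ 2)^-1 *
    (X * (b * (b * Z) - e * (- b * S)) + (b * S - e * Z) * (- e * X)) = X * (1 + Z).
  by field; rewrite !gt_eqF.
exact: E.
Qed.

Lemma integral_expabs_cos (b : R) :
  (\int[mu]_w (expabs w * (1 + cos (b * w)))%:E =
     (2 / e + 2 * e / (e ^+ 2 + b ^+ 2))%:E)%E.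
Proof.
have cc : continuous (fun w : R => 1 + cos (b * w)).
  move=> w; apply: cvgD; first exact: cvg_cst.
  apply: (@continuous_comp _ _ _ (fun w => b * w) cos); last exact: continuous_cos.
  by apply: cvgM => //; exact: cvg_cst.
have c0 w : 0 <= 1 + cos (b * w) by rewrite -lerBlDl sub0r cos_geN1.
rewrite ge0_symfun_integralT; first last.
- by move=> w /=; rewrite /expabs normrN mulrN cosN.
- by move=> w; apply: cvgM; [exact: continuous_expabs|exact: cc].
- by move=> w; rewrite mulr_ge0 ?expabs_ge0.
rewrite (_ : [set x | _] = `[0, +oo[%classic); last first.
  by apply/seteqP; split => x/=; rewrite in_itv/= andbT.
rewrite (@eq_integral _ _ _ mu _ (fun w : measurableTypeR R =>
    (expR (- (e * w)) * (1 + cos (b * w)))%:E)); last first.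
  move=> w; rewrite inE /= in_itv /= andbT => w0.
  by rewrite /expabs ger0_norm.
rewrite (FTC2y_total _ _ _ (dF0 b) (l := 0)).
- rewrite -EFinM; congr EFin; rewrite /F0 !mulr0 oppr0 expR0 sin0 cos0.
  by field; rewrite !gt_eqF.
- move=> w; apply: cvgM; last exact: cc.
  apply: (@continuous_comp _ _ _ (fun w => - (e * w)) expR); last exact: continuous_expR.
  by apply: cvgN; apply: cvgM => //; exact: cvg_cst.
- by move=> w _; rewrite mulr_ge0 ?expR_ge0.
- have -> : F0 b = (fun w => expR (- (e * w)) *
      (- e^-1 + (b * sin (b * w) - e * cos (b * w)) / (e ^+ 2 + b ^+ 2))).
    by apply/funext => w; rewrite /F0; ring.
  apply: (@cvg_expR_bounded _ e (e^-1 + (`|b| + e) / (e ^+ 2 + b ^+ 2))) => // w.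
  apply: le_trans (ler_normD _ _) _; rewrite normrN ger0_norm ?invr_ge0 ?(ltW e0)//.
  rewrite lerD2l normrM normfV (ger0_norm (ltW (den_gt0 b))).
  rewrite ler_wpM2r ?invr_ge0 ?(ltW (den_gt0 b))//.
  apply: le_trans (ler_normB _ _) _; rewrite !normrM lerD//.
  + by rewrite ler_piMr// ler_norml sin_geN1 sin_le1.
  + by rewrite (ger0_norm (ltW e0)) ler_piMr ?(ltW e0)// ler_norml cos_geN1 cos_le1.
Qed.

Lemma integrable_expabs : mu.-integrable setT (EFin \o expabs).
Proof.
apply/integrableP; split.
  by apply/measurable_EFinP; exact: measurable_expabs.
have := integral_expabs_cos 0.
under eq_integral do rewrite mul0r cos0 EFinM.
rewrite ge0_integralZr//=.
- move=> H; apply: (@le_lt_trans _ _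
    (\int[mu]_x (expabs x)%:E * (1 + 1)%:E)%E); last by rewrite H ltry.
  under eq_integral do rewrite ger0_norm ?expabs_ge0//.
  apply: lee_pemulr; last by rewrite lee_fin; lra.
  by apply: integral_ge0 => x _; rewrite lee_fin expabs_ge0.
- by apply/measurable_EFinP; exact: measurable_expabs.
- by move=> x _; rewrite lee_fin expabs_ge0.
Qed.

Lemma fourier_expabs (z : R) :
  cintegral mu setT (fun w => (expabs w)%:C%C * cis (2 * pi * (z * w))) =
  (poisson z)%:C%C.
Proof.
set b := 2 * pi * z.
have bE w : 2 * pi * (z * w) = b * w by rewrite mulrA.
have mE : measurable_fun [set: measurableTypeR R] expabs.
  by apply: continuous_measurable_fun; exact: continuous_expabs.
have mb : measurable_fun [set: measurableTypeR R] (fun w => b * w).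
  by apply: measurable_funM.
have iE : cintegrable mu setT (fun w => (expabs w)%:C%C).
  apply: (@cint_dom _ _ _ mu _ measurableT _ expabs); last exact: integrable_expabs.
    exact: cmeasR.
  by move=> w _; rewrite cabsR ger0_norm// expabs_ge0.
have iEc : cintegrable mu setT (fun w => (expabs w)%:C%C * cis (b * w)).
  apply: (cintMb measurableT (B := 1) _ _ iE); first exact: cmeas_cis.
  by move=> w _; rewrite cabs_cis.
have [irc iic] := iEc.
apply: complex_eqP => /=.
  have EH (k : R) : mu.-integrable setT (fun w => (expabs w * cos (k * w))%:E) ->
      Rintegral mu setT expabs + Rintegral mu setT (fun w => expabs w * cos (k * w)) =
      2 / e + 2 * e / (e ^+ 2 + k ^+ 2).
    move=> I2; transitivity (fine (\int[mu]_w (expabs w * (1 + cos (k * w)))%:E)%E); last first.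
      by rewrite integral_expabs_cos.
    rewrite -RintegralD//; last exact: integrable_expabs.
    by apply: eq_Rintegral => w _; rewrite mulrDr mulr1.
  (* At frequency 0 the formula returns twice the mass of [expabs]. The mass is thus 2 / e, to be
     subtracted from the formula at b. *)
  have H1 : Rintegral mu setT expabs + Rintegral mu setT expabs =
      2 / e + 2 * e / (e ^+ 2 + 0 ^+ 2).
    rewrite -EH.
      by congr (_ + _); apply: eq_Rintegral => w _; rewrite mul0r cos0 mulr1.
    apply: eq_integrable (integrable_expabs) => // w _ /=.
    by rewrite mul0r cos0 mulr1.
  have I2 : mu.-integrable setT (fun w => (expabs w * cos (b * w))%:E).
    by apply: eq_integrable irc => // w _ /=; rewrite mul0r subr0.
  have H2 := EH b I2.
  transitivity (Rintegral mu setT (fun w => expabs w * cos (b * w))).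
    by apply: eq_Rintegral => w _; rewrite bE mul0r subr0.
  rewrite /poisson -/b -[LHS](addKr (Rintegral mu setT expabs)) H2.
  have -> : Rintegral mu setT expabs = 2 / e.
    have E : 2 * e / (e ^+ 2 + 0 ^+ 2) = 2 / e by field; rewrite gt_eqF.
    by rewrite E in H1; lra.
  by rewrite addKr.
set J := Rintegral _ _ _.
pose g w := expabs w * sin (b * w).
have mg : measurable_fun [set: measurableTypeR R] g.
  apply: measurable_funM => //; apply: measurableT_comp => //.
  by apply: continuous_measurable_fun; exact: continuous_sin.
have JE : J = Rintegral mu setT g.
  by apply: eq_Rintegral => w _; rewrite /g bE mul0r addr0.
have ig : mu.-integrable setT (EFin \o g).
  by apply: eq_integrable iic => // w _ /=; rewrite mul0r addr0.
have Jf : (\int[mu]_x (EFin \o g)^\- x \is a fin_num)%E.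
  exact: integrable_neg_fin_num ig.
(* The sine part is odd: the reflection of the line exchanges its positive and negative parts, whose
   integrals are finite and therefore cancel. *)
rewrite JE /Rintegral integralE.
rewrite -(_ : (\int[mu]_x (EFin \o g)^\- x = \int[mu]_x (EFin \o g)^\+ x)%E); last first.
  have := @ge0_integral_affine R (-1) 0 ((EFin \o g)^\+)%E.
  rewrite normrN normr1 invr1 mul1e => <- //.
  - apply: eq_integral => x _; rewrite funeposE funenegE /= mulN1r addr0 /g.
    by rewrite /expabs normrN mulrN sinN mulrN EFinN.
  - by apply: measurable_funepos; exact/measurable_EFinP.
by rewrite subee.
Qed.

End Poisson.

Section ComplexDominatedConvergence.
Context {R : realType} d (T : measurableType d) (m : {measure set T -> \bar R}).
Local Notation C := R[i].

Lemma cdominated (f_ : nat -> T -> C) (f : T -> C) (g : T -> R) :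
  (forall n, cmeasurable setT (f_ n)) -> cmeasurable setT f ->
  {ae m, forall x, ccvg (f_ ^~ x) (f x)} ->
  (forall n x, cabs (f_ n x) <= g x) -> m.-integrable setT (EFin \o g) ->
  ccvg (fun n => cintegral m setT (f_ n)) (cintegral m setT f).
Proof.
move=> mf_ mf ff fg ig.
have fi n : cintegrable m setT (f_ n).
  by apply: (cint_dom measurableT (g := g)).
have rcvg (p : C -> R) : (forall z w, p (z - w) = p z - p w) ->
    (forall z, `|p z| <= cabs z) ->
    (forall n, measurable_fun setT (fun x => p (f_ n x))) ->
    measurable_fun setT (fun x => p (f x)) ->
  m.-integrable setT (fun x => (p (f x))%:E) /\
  (fun n => Rintegral m setT (fun x => p (f_ n x))) @ \oo -->
    Rintegral m setT (fun x => p (f x)).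
  move=> pB pc mp mpf.
  have [] := @dominated_convergence _ _ _ m setT measurableT
    (fun n x => (p (f_ n x))%:E) (fun x => (p (f x))%:E) (EFin \o g).
  - by move=> n; exact/measurable_EFinP.
  - exact/measurable_EFinP.
  - apply: filterS ff => x cx _; apply: cvg_to_EFin.
    apply/cvgrPdist_le => e e0; have [N NP] := cx e e0; exists N => // i /= Ni.
    by rewrite distrC -pB (le_trans (pc _))// NP.
  - exact: ig.
  - by apply/aeW => x n _ /=; rewrite lee_fin (le_trans (pc _)).
  move=> ip _ cv; split => //.
  have /fine_cvgP[_ H] : (fun n => \int[m]_x (p (f_ n x))%:E)%E @ \oo -->
      (fine (\int[m]_x (p (f x))%:E)%E)%:E.
    by rewrite fineK//; exact: integrable_fin_num.
  exact: H.
have mRe n : measurable_fun setT (fun x => complex.Re (f_ n x)) by case: (mf_ n).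
have mIm n : measurable_fun setT (fun x => complex.Im (f_ n x)) by case: (mf_ n).
have [mfr mfi] := mf.
have [||ir /cvgrPdist_le cr] := rcvg (@complex.Re R) _ _ mRe mfr.
- by move=> z w; rewrite !ReImE.
- exact: Re_le_cabs.
have [||ii /cvgrPdist_le ci] := rcvg (@complex.Im R) _ _ mIm mfi.
- by move=> z w; rewrite !ReImE.
- exact: Im_le_cabs.
move=> e e0; have e20 : 0 < e / 2 by rewrite divr_gt0.
have [N1 _ N1P] := cr _ e20; have [N2 _ N2P] := ci _ e20.
exists (maxn N1 N2) => i; rewrite geq_max => /andP[i1 i2].
apply: le_trans (cabs_le_ReIm _) _; rewrite !ReImE /= [e]splitr.
by rewrite lerD// distrC; [exact: N1P|exact: N2P].
Qed.

End ComplexDominatedConvergence.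

(** * The Fourier integral on the plane and its Poisson regularization *)

Section Plane.
Context {R : realType}.
Local Notation C := R[i].
Local Notation R2 := (R * R)%type.
Local Notation plane := (measurableTypeR R * measurableTypeR R)%type.
Local Notation mu := (@lebesgue_measure R).
Local Notation mu2 := (@mu2 R).
Implicit Types f g h : R2 -> C.

Lemma integral_mu2 (h : R2 -> \bar R) : measurable_fun [set: plane] h ->
  (forall x, 0 <= h x)%E ->
  (\int[mu2]_x h x = \int[mu]_x1 \int[mu]_x2 h (x1, x2))%E.
Proof. by move=> mh h0; exact: (@fubini_tonelli1 _ _ _ _ _ mu mu). Qed.

Lemma integral_mu2_tensor (p q : R -> R) :
  measurable_fun [set: measurableTypeR R] p ->
  measurable_fun [set: measurableTypeR R] q ->
  (forall x, 0 <= p x) -> (forall x, 0 <= q x) ->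
  (\int[mu2]_x (p x.1 * q x.2)%:E = \int[mu]_x (p x)%:E * \int[mu]_x (q x)%:E)%E.
Proof.
move=> mp mq p0 q0.
have mpq : measurable_fun [set: plane] (fun x => (p x.1 * q x.2)%:E).
  apply/measurable_EFinP; apply: measurable_funM.
    exact: (measurableT_comp mp).
  exact: (measurableT_comp mq).
rewrite integral_mu2//; last by move=> x; rewrite lee_fin mulr_ge0.
rewrite -ge0_integralZr//=; first last.
- by apply: integral_ge0 => x _; rewrite lee_fin.
- by move=> x _; rewrite lee_fin.
- exact/measurable_EFinP.
apply: eq_integral => x _; under eq_integral do rewrite EFinM.
rewrite ge0_integralZl_EFin//.
- by move=> y _; rewrite lee_fin.
- exact/measurable_EFinP.
Qed.

Lemma measurable_dot2 : measurable_fun [set: (plane * plane)%type]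
  (fun z => dot2 z.1 z.2 : R).
Proof.
apply: measurable_funD; apply: measurable_funM.
- by apply: (measurableT_comp measurable_fst); exact: measurable_fst.
- by apply: (measurableT_comp measurable_fst); exact: measurable_snd.
- by apply: (measurableT_comp measurable_snd); exact: measurable_fst.
- by apply: (measurableT_comp measurable_snd); exact: measurable_snd.
Qed.

Lemma measurable_dot2r x : measurable_fun [set: plane] (dot2 x : R2 -> R).
Proof.
by apply: measurable_funD; apply: measurable_funM.
Qed.

Lemma dot2C (x y : R2) : dot2 x y = dot2 y x.
Proof. by rewrite /dot2 mulrC (mulrC x.2). Qed.

Definition ifourier_int g (x : R2) : C :=
  cintegral mu2 setT (fun w => g w * cis (2 * pi * dot2 x w)).

Lemma ifourier_intE g x : ifourier_int g x = fourier_int g (- x.1, - x.2).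
Proof.
apply: eq_cintegral => w _; congr (_ * cis _).
by rewrite /dot2 /=; ring.
Qed.

Definition fker (z : R2 * R2) : C := cis (- (2 * pi * dot2 z.1 z.2)).

Lemma cmeas_fker : cmeasurable [set: (plane * plane)%type] fker.
Proof.
apply: cmeas_cis; apply: measurableT_comp => //; apply: measurable_funM => //.
exact: measurable_dot2.
Qed.

Lemma cmeas_fourier_int f : cmeasurable [set: plane] f ->
  cmeasurable [set: plane] (fourier_int f).
Proof.
move=> mf; apply: (@cmeas_cintegral _ _ _ plane plane mu2
  (fun z => f z.2 * cis (- (2 * pi * dot2 z.2 z.1)))).
apply: cmeasM; first exact: cmeas_comp.
under eq_fun do rewrite dot2C.
exact: cmeas_fker.
Qed.

Lemma cis_bound g (h : R2 -> R) : measurable_fun [set: plane] h ->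
  cintegrable mu2 setT g -> cintegrable mu2 setT (fun w => g w * cis (h w)).
Proof.
move=> mh ig; apply: (cintMb measurableT (B := 1) _ _ ig); first exact: cmeas_cis.
by move=> w _; rewrite cabs_cis.
Qed.

Lemma fourier_int_int f w : cintegrable mu2 setT f ->
  cintegrable mu2 setT (fun x => f x * cis (- (2 * pi * dot2 x w))).
Proof.
move=> fi; apply: cis_bound => //.
apply: measurableT_comp => //; apply: measurable_funM => //.
under eq_fun do rewrite dot2C.
exact: measurable_dot2r.
Qed.

Lemma ifourier_int_int f w : cintegrable mu2 setT f ->
  cintegrable mu2 setT (fun x => f x * cis (2 * pi * dot2 w x)).
Proof.
move=> fi; apply: cis_bound => //.
by apply: measurable_funM => //; exact: measurable_dot2r.
Qed.

Lemma fourier_int_le f w : cintegrable mu2 setT f ->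
  cabs (fourier_int f w) <= Rintegral mu2 setT (fun x => cabs (f x)).
Proof.
move=> fi; apply: le_trans (cabs_cintegral _ _) _ => //; first exact: fourier_int_int.
by under eq_Rintegral do rewrite cabsM cabs_cis mulr1.
Qed.

Lemma fourier_intB f g w : cintegrable mu2 setT f -> cintegrable mu2 setT g ->
  fourier_int (fun x => f x - g x) w = fourier_int f w - fourier_int g w.
Proof.
move=> fi gi; rewrite -cintegralB//; try exact: fourier_int_int.
by apply: eq_cintegral => x _; rewrite mulrBl.
Qed.

(** Fubini with a character as kernel. Both functions are integrable here; [fourier_adj] carries the
    identity over to L^2. *)
Lemma fourier_int_adj f g : cintegrable mu2 setT f -> cintegrable mu2 setT g ->
  ip mu2 (fourier_int f) g = ip mu2 f (ifourier_int g).
Proof.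
move=> fi gi.
pose K (z : R2 * R2) : C := cis (- (2 * pi * dot2 z.2 z.1)).
have mK : cmeasurable [set: (plane * plane)%type] K.
  rewrite (_ : K = fker); first exact: cmeas_fker.
  by apply/funext => z; rewrite /K dot2C.
have K1 z : cabs (K z) <= 1 by rewrite cabs_cis.
have := cFubini_kernel (m1 := mu2) (m2 := mu2) (cintJ measurableT gi) fi mK K1.
move=> H; transitivity (cintegral mu2 setT (fun x => (g x)^*%C *
    cintegral mu2 setT (fun y => K (x, y) * f y))).
  apply: eq_cintegral => w _; rewrite mulrC; congr (_ * _).
  by apply: eq_cintegral => x _; rewrite mulrC.
rewrite H; apply: eq_cintegral => x _; rewrite mulrC; congr (_ * _).
rewrite /ifourier_int -cintegralJ//; last exact: ifourier_int_int.
apply: eq_cintegral => w _; rewrite /K /=.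
by apply: complex_eqP; rewrite !ReImE /= ?cosN ?sinN; ring.
Qed.

Section Regularization.
Context (e : R) (e0 : 0 < e).

Definition exp2 (w : R2) : R := expabs e w.1 * expabs e w.2.
Definition poisson2 (z : R2) : R := poisson e z.1 * poisson e z.2.

Lemma exp2_ge0 w : 0 <= exp2 w.
Proof. by rewrite mulr_ge0 ?expabs_ge0. Qed.

Lemma exp2_le1 w : exp2 w <= 1.
Proof. by rewrite mulr_ile1 ?expabs_ge0 ?expabs_le1. Qed.

Lemma measurable_exp2 : measurable_fun [set: plane] exp2.
Proof.
apply: measurable_funM.
  by apply: (measurableT_comp (measurable_expabs e)).
by apply: (measurableT_comp (measurable_expabs e)).
Qed.

Lemma cint_expabs : cintegrable mu setT (fun w => (expabs e w)%:C%C).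
Proof.
apply: (@cint_dom _ _ _ mu _ measurableT _ (expabs e)).
- by apply: cmeasR; exact: measurable_expabs.
- by move=> w _; rewrite cabsR ger0_norm// expabs_ge0.
- exact: integrable_expabs.
Qed.

Lemma cint_exp2 : cintegrable mu2 setT (fun w => (exp2 w)%:C%C).
Proof.
have mK : cmeasurable [set: plane] (fun=> 1 : C) by exact: cmeas_cst.
have K1 : forall z : plane, cabs (1 : C) <= 1 by move=> _; rewrite cabsR normr1.
have := cint_tensor cint_expabs cint_expabs mK K1.
congr (cintegrable _ _ _); apply/funext => w.
by rewrite mulr1 /exp2 RtoCM.
Qed.

Lemma ifourier_exp2 z : ifourier_int (fun w => (exp2 w)%:C%C) z = (poisson2 z)%:C%C.
Proof.
have c1 (y : R) : cintegrable mu setT (fun w => (expabs e w)%:C%C * cis (2 * pi * (y * w))).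
  apply: (cintMb measurableT (B := 1) _ _ cint_expabs).
    by apply: cmeas_cis; apply: measurable_funM => //; exact: measurable_funM.
  by move=> w _; rewrite cabs_cis.
rewrite /poisson2 RtoCM -!fourier_expabs//.
rewrite -(@cintegral_tensor _ _ _ _ _ mu mu)//.
apply: eq_cintegral => w _; rewrite /exp2 /dot2 mulrDr cisD RtoCM; ring.
Qed.

Lemma measurable_poisson : measurable_fun [set: measurableTypeR R] (poisson e).
Proof. by apply: continuous_measurable_fun; exact: continuous_poisson. Qed.

Lemma measurable_poisson2 d (T : measurableType d)
   (h k : T -> plane) : measurable_fun setT h -> measurable_fun setT k ->
  measurable_fun setT (fun z => poisson2 ((h z).1 - (k z).1, (h z).2 - (k z).2)).
Proof.
move=> mh mk; apply: measurable_funM;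
  apply: (measurableT_comp measurable_poisson); apply: measurable_funB.
- exact: (measurableT_comp measurable_fst).
- exact: (measurableT_comp measurable_fst).
- exact: (measurableT_comp measurable_snd).
- exact: (measurableT_comp measurable_snd).
Qed.

Lemma poisson2_ge0 z : 0 <= poisson2 z.
Proof. by rewrite mulr_ge0 ?poisson_ge0. Qed.

Lemma poisson2_le z : poisson2 z <= (2 / e) ^+ 2.
Proof. by rewrite expr2 ler_pM ?poisson_ge0 ?poisson_le. Qed.

Lemma poisson2N (x y : R2) : poisson2 (x.1 - y.1, x.2 - y.2) = poisson2 (y.1 - x.1, y.2 - x.2).
Proof. by rewrite /poisson2 /= -(poissonN e (y.1 - x.1)) -(poissonN e (y.2 - x.2)) !opprB. Qed.

Lemma integral_poisson2_le1 (x : R2) :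
  (\int[mu2]_y (poisson2 (x.1 - y.1, x.2 - y.2))%:E <= 1)%E.
Proof.
have mp (y : R) : measurable_fun [set: measurableTypeR R] (fun z => poisson e (y - z)).
  by apply: (measurableT_comp measurable_poisson); exact: measurable_funB.
rewrite (integral_mu2_tensor (mp x.1) (mp x.2)); last 2 first.
- by move=> ?; exact: poisson_ge0.
- by move=> ?; exact: poisson_ge0.
rewrite -[leRHS]mule1; apply: lee_pmul => //; try exact: integral_poisson_le1.
- by apply: integral_ge0 => y _; rewrite lee_fin poisson_ge0.
- by apply: integral_ge0 => y _; rewrite lee_fin poisson_ge0.
Qed.

(** The convolution of g with the product Poisson kernel. *)
Definition smooth2 g (x : R2) : C :=
  cintegral mu2 setT (fun y => (poisson2 (x.1 - y.1, x.2 - y.2))%:C%C * g y).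

Lemma cmeas_poisson2 : cmeasurable [set: (plane * plane)%type]
  (fun z => (poisson2 (z.1.1 - z.2.1, z.1.2 - z.2.2))%:C%C : C).
Proof. by apply: cmeasR; exact: measurable_poisson2. Qed.

Lemma cabs_poisson2 z : cabs ((poisson2 z)%:C%C : C) <= (2 / e) ^+ 2.
Proof. by rewrite cabsR ger0_norm ?poisson2_ge0 ?poisson2_le. Qed.

Lemma cint_fourier_exp2 g : cintegrable mu2 setT g ->
  cintegrable mu2 setT (fun w => fourier_int g w * (exp2 w)%:C%C).
Proof.
move=> gi; under eq_fun do rewrite mulrC.
apply: (cintMb measurableT (B := Rintegral mu2 setT (fun x => cabs (g x)))).
- by apply: cmeas_fourier_int; exact: cintegrable_meas gi.
- by move=> w _; exact: fourier_int_le.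
- exact: cint_exp2.
Qed.

(** The regularized inversion formula. The damping makes the double integral absolutely convergent;
    once exchanged, its inner integral is the inverse transform of [exp2] at x - y, that is, the
    Poisson kernel. *)
Lemma ifourier_fourier_exp2 g x : cintegrable mu2 setT g ->
  ifourier_int (fun w => fourier_int g w * (exp2 w)%:C%C) x = smooth2 g x.
Proof.
move=> gi.
pose K (z : R2 * R2) : C := cis (- (2 * pi * dot2 z.2 z.1)).
have mK : cmeasurable [set: (plane * plane)%type] K.
  rewrite (_ : K = fker); first exact: cmeas_fker.
  by apply/funext => z; rewrite /K dot2C.
have K1 z : cabs (K z) <= 1 by rewrite cabs_cis.
have H := cFubini_kernel (m1 := mu2) (m2 := mu2) (ifourier_int_int x cint_exp2) gi mK K1.
transitivity (cintegral mu2 setT (fun w => (exp2 w)%:C%C * cis (2 * pi * dot2 x w) *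
    cintegral mu2 setT (fun y => K (w, y) * g y))).
  apply: eq_cintegral => w _; rewrite -mulrA mulrC; congr (_ * _).
  by apply: eq_cintegral => y _; rewrite mulrC.
rewrite H; apply: eq_cintegral => y _; congr (_ * _).
rewrite -ifourier_exp2; apply: eq_cintegral => w _.
by rewrite -mulrA -cisD; congr (_ * cis _); rewrite /dot2 /=; ring.
Qed.

Lemma fourier_int_exp2 f g : cintegrable mu2 setT f -> cintegrable mu2 setT g ->
  ip mu2 (fourier_int f) (fun w => fourier_int g w * (exp2 w)%:C%C) =
  ip mu2 f (smooth2 g).
Proof.
move=> fi gi; rewrite (fourier_int_adj fi (cint_fourier_exp2 gi)).
by apply: eq_cintegral => x _; congr (_ * _^*%C); exact: ifourier_fourier_exp2.
Qed.

Lemma smooth2_int g x : cintegrable mu2 setT g ->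
  cintegrable mu2 setT (fun y => (poisson2 (x.1 - y.1, x.2 - y.2))%:C%C * g y).
Proof.
move=> gi; under eq_fun do rewrite mulrC.
apply: (cintMb measurableT (B := (2 / e) ^+ 2) _ _ gi).
- by apply: cmeasR; apply: measurable_poisson2 => //; exact: measurable_cst.
- by move=> y _; exact: cabs_poisson2.
Qed.

Lemma cmeas_smooth2 g : cmeasurable [set: plane] g -> cmeasurable [set: plane] (smooth2 g).
Proof.
move=> mg; apply: (@cmeas_cintegral _ _ _ plane plane mu2
  (fun z => (poisson2 (z.1.1 - z.2.1, z.1.2 - z.2.2))%:C%C * g z.2)).
apply: cmeasM; first exact: cmeas_poisson2.
exact: cmeas_comp.
Qed.

Lemma smooth2_le g x : cintegrable mu2 setT g ->
  ((cabs (smooth2 g x))%:E <=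
   \int[mu2]_y (poisson2 (x.1 - y.1, x.2 - y.2) * cabs (g y))%:E)%E.
Proof.
move=> gi; have H := smooth2_int x gi.
have := cabs_cintegral measurableT H; rewrite -lee_fin => /le_trans; apply.
rewrite /Rintegral fineK; last exact: integrable_fin_num (cint_abs measurableT H).
by under eq_integral do rewrite cabsM cabsR ger0_norm ?poisson2_ge0//.
Qed.

(* AM-GM under the double integral, since the kernel has mass at most 1 in each
   variable. *)
Lemma ip_smooth2_le f : cintegrable mu2 setT f -> isL2 mu2 f ->
  cintegrable mu2 setT (fun x => f x * (smooth2 f x)^*%C) /\
  cabs (ip mu2 f (smooth2 f)) <= n2 mu2 f.
Proof.
move=> fi Lf; have [mf _] := Lf.
have mP : measurable_fun [set: (plane * plane)%type]
    (fun z => poisson2 (z.1.1 - z.2.1, z.1.2 - z.2.2)).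
  exact: measurable_poisson2.
have mPx (x : R2) : measurable_fun [set: plane]
    (fun y => poisson2 (x.1 - y.1, x.2 - y.2)).
  by apply: measurable_poisson2 => //; exact: measurable_cst.
have ma : measurable_fun [set: plane] (fun x => cabs (f x)) by exact: cmeas_cabs.
have ma1 : measurable_fun [set: (plane * plane)%type] (fun z => cabs (f z.1)).
  exact: (measurableT_comp ma).
have ma2 : measurable_fun [set: (plane * plane)%type] (fun z => cabs (f z.2)).
  exact: (measurableT_comp ma).
pose Q (z : R2 * R2) := poisson2 (z.1.1 - z.2.1, z.1.2 - z.2.2).
have Q0 z : 0 <= Q z by exact: poisson2_ge0.
have amgm (q a b : R) : 0 <= q -> a * (q * b) <= 2^-1 * (q * a ^+ 2) + 2^-1 * (q * b ^+ 2).
  move=> q0; rewrite -subr_ge0.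
  rewrite (_ : _ - _ = 2^-1 * (q * (a - b) ^+ 2)); last by field.
  by apply: mulr_ge0 => //; apply: mulr_ge0 => //; exact: sqr_ge0.
have mQx x : measurable_fun [set: plane] (fun y => Q (x, y)) by exact: mPx.
have Qc0 z (c : R) : 0 <= Q z * c ^+ 2 by apply: mulr_ge0 => //; exact: sqr_ge0.
have mfs : cmeasurable [set: plane] (fun x => f x * (smooth2 f x)^*%C).
  by apply: cmeasM => //; apply: cmeasJ; exact: cmeas_smooth2.
have key : (\int[mu2]_x (cabs (f x * (smooth2 f x)^*%C))%:E <= sqn mu2 f)%E.
  apply: (@le_trans _ _ (\int[mu2]_x \int[mu2]_y
      (2^-1 * (Q (x, y) * cabs (f x) ^+ 2) + 2^-1 * (Q (x, y) * cabs (f y) ^+ 2))%:E)%E).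
    apply: ge0_le_integral => //.
    - by move=> x _; rewrite lee_fin cabs_ge0.
    - by apply/measurable_EFinP; exact: cmeas_cabs.
    - apply: (@measurable_fun_fubini_tonelli_F _ _ plane plane R mu2 (fun z =>
       (2^-1 * (Q (z.1, z.2) * cabs (f z.1) ^+ 2) + 2^-1 * (Q (z.1, z.2) * cabs (f z.2) ^+ 2))%:E)).
      + apply/measurable_EFinP; apply: measurable_funD;
          apply: measurable_funM => //; apply: measurable_funM => //;
          exact: measurable_funX.
      + by move=> z; rewrite lee_fin; apply: addr_ge0; apply: mulr_ge0 => //; exact: Qc0.
    move=> x _; rewrite cabsM cabsJ EFinM.
    apply: (@le_trans _ _ ((cabs (f x))%:E * \int[mu2]_y (Q (x, y) * cabs (f y))%:E)%E).
      by apply: lee_wpmul2l; [rewrite lee_fin cabs_ge0|exact: smooth2_le].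
    rewrite -ge0_integralZl_EFin ?cabs_ge0//; last 2 first.
    - by move=> y _; rewrite lee_fin; apply: mulr_ge0 => //; exact: cabs_ge0.
    - by apply/measurable_EFinP; exact: (measurable_funM (mQx x) ma).
    apply: ge0_le_integral => //.
    - by move=> y _; rewrite lee_fin; apply: mulr_ge0; [|apply: mulr_ge0 => //]; exact: cabs_ge0.
    - apply/measurable_EFinP; apply: measurable_funM => //.
      exact: (measurable_funM (mQx x) ma).
    - apply/measurable_EFinP; apply: measurable_funD;
        apply: measurable_funM => //; apply: measurable_funM => //;
        exact: measurable_funX.
    by move=> y _; rewrite -EFinM lee_fin; exact: amgm.
  have half0 : 0 <= 2^-1 :> R by [].
  have E1 : (\int[mu2]_x \int[mu2]_y (Q (x, y) * cabs (f x) ^+ 2)%:E <= sqn mu2 f)%E.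
    apply: ge0_le_integral => //.
    - by move=> x _; apply: integral_ge0 => y _; exact: Qc0.
    - apply: (@measurable_fun_fubini_tonelli_F _ _ plane plane R mu2 (fun z =>
       (Q (z.1, z.2) * cabs (f z.1) ^+ 2)%:E)).
      + apply/measurable_EFinP; apply: measurable_funM => //; exact: measurable_funX.
      + by move=> z; exact: Qc0.
    - exact: mcabs2.
    move=> x _; under eq_integral do rewrite EFinM.
    rewrite ge0_integralZr//.
    - by rewrite -[leRHS]mul1e; apply: lee_wpmul2r; rewrite ?lee_fin ?sqr_ge0//; exact: integral_poisson2_le1.
    - exact/measurable_EFinP.
    - by move=> y _; rewrite lee_fin.
    - by rewrite lee_fin sqr_ge0.
  (* The kernel depends on x - y and is even, so exchanging the two variables reduces this to
     [E1]. *)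
  have E2 : (\int[mu2]_x \int[mu2]_y (Q (x, y) * cabs (f y) ^+ 2)%:E <= sqn mu2 f)%E.
    rewrite (@fubini_tonelli _ _ plane plane R mu2 mu2 (fun z =>
       (Q (z.1, z.2) * cabs (f z.2) ^+ 2)%:E)).
    - apply: le_trans E1; rewrite le_eqVlt; apply/orP; left; apply/eqP.
      apply: eq_integral => x _; apply: eq_integral => y _ /=.
      by rewrite /Q /= poisson2N.
    - apply/measurable_EFinP; apply: measurable_funM => //; exact: measurable_funX.
    - by move=> z; exact: Qc0.
  rewrite (_ : (\int[mu2]_x _)%E = ((2^-1)%:E * (\int[mu2]_x \int[mu2]_y (Q (x, y) * cabs (f x) ^+ 2)%:E) +
     (2^-1)%:E * (\int[mu2]_x \int[mu2]_y (Q (x, y) * cabs (f y) ^+ 2)%:E))%E).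
    rewrite (sqnE Lf) in E1 E2 *.
    apply: (@le_trans _ _ ((2^-1)%:E * (n2 mu2 f)%:E + (2^-1)%:E * (n2 mu2 f)%:E)%E).
      by apply: leeD; apply: lee_wpmul2l.
    by rewrite -!EFinM -EFinD lee_fin; lra.
  have mq1 : measurable_fun [set: (plane * plane)%type] (fun z => (Q (z.1, z.2) * cabs (f z.1) ^+ 2)%:E).
    apply/measurable_EFinP; apply: measurable_funM => //; exact: measurable_funX.
  have mq2 : measurable_fun [set: (plane * plane)%type] (fun z => (Q (z.1, z.2) * cabs (f z.2) ^+ 2)%:E).
    apply/measurable_EFinP; apply: measurable_funM => //; exact: measurable_funX.
  have mi1 : measurable_fun [set: plane] (fun x => \int[mu2]_y (Q (x, y) * cabs (f x) ^+ 2)%:E)%E.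
    apply: (@measurable_fun_fubini_tonelli_F _ _ plane plane R mu2 _ mq1) => z.
    by exact: Qc0.
  have mi2 : measurable_fun [set: plane] (fun x => \int[mu2]_y (Q (x, y) * cabs (f y) ^+ 2)%:E)%E.
    apply: (@measurable_fun_fubini_tonelli_F _ _ plane plane R mu2 _ mq2) => z.
    by exact: Qc0.
  rewrite -!ge0_integralZl_EFin//; first last.
  - by move=> x _; apply: integral_ge0 => y _; exact: Qc0.
  - by move=> x _; apply: integral_ge0 => y _; exact: Qc0.
  rewrite -ge0_integralD//; first last.
  - exact: emeasurable_funM.
  - by move=> x _; rewrite mule_ge0//; apply: integral_ge0 => y _; exact: Qc0.
  - exact: emeasurable_funM.
  - by move=> x _; rewrite mule_ge0//; apply: integral_ge0 => y _; exact: Qc0.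
  apply: eq_integral => x _.
  have m1 : measurable_fun [set: plane] (fun y => (Q (x, y) * cabs (f x) ^+ 2)%:E).
    apply/measurable_EFinP; apply: measurable_funM => //.
  have m2 : measurable_fun [set: plane] (fun y => (Q (x, y) * cabs (f y) ^+ 2)%:E).
    apply/measurable_EFinP; apply: measurable_funM => //; exact: measurable_funX.
  rewrite -!ge0_integralZl_EFin//; first last.
  - by move=> y _; exact: Qc0.
  - by move=> y _; exact: Qc0.
  rewrite -ge0_integralD//.
  - by move=> y _; rewrite mule_ge0// lee_fin mulr_ge0 ?sqr_ge0.
  - exact: emeasurable_funM.
  - by move=> y _; rewrite mule_ge0// lee_fin mulr_ge0 ?sqr_ge0.
  - exact: emeasurable_funM.
have Is : cintegrable mu2 setT (fun x => f x * (smooth2 f x)^*%C).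
  by apply: cint_absP => //; apply: le_lt_trans key _; case: Lf.
split => //; apply: cabs_cintegral_le => //.
by rewrite (sqnE Lf) in key.
Qed.

(** The left side is the inner product of the transform with its damped copy, which the regularized
    inversion turns into the pairing of f with its Poisson average, bounded by [ip_smooth2_le]. *)
Lemma fourier_exp2_le f : cintegrable mu2 setT f -> isL2 mu2 f ->
  (\int[mu2]_w (cabs (fourier_int f w) ^+ 2 * exp2 w)%:E <= sqn mu2 f)%E.
Proof.
move=> fi Lf; have [mf _] := Lf; have mF := cmeas_fourier_int mf.
have [_ H] := ip_smooth2_le fi Lf.
rewrite -fourier_int_exp2// in H.
have E : ip mu2 (fourier_int f) (fun w => fourier_int f w * (exp2 w)%:C%C) =
   (Rintegral mu2 setT (fun w => cabs (fourier_int f w) ^+ 2 * exp2 w))%:C%C.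
  rewrite -cintegral_real; apply: eq_cintegral => w _.
  by rewrite RtoCM -mulcJ; apply: complex_eqP; rewrite !ReImE /=; ring.
rewrite E cabsR ger0_norm in H; last first.
  by apply: Rintegral_ge0 => w _; rewrite mulr_ge0 ?sqr_ge0 ?exp2_ge0.
rewrite (sqnE Lf) -[leLHS]fineK ?lee_fin//.
have B0 := fourier_int_le _ fi.
(* The bound obtained concerns the real integral, so finiteness has to be shown apart: the transform
   is bounded by the L^1 norm of f, and [exp2] is integrable. *)
apply: integrable_fin_num => //.
have I1 := cint_abs measurableT cint_exp2.
pose B := Rintegral mu2 setT (fun x => cabs (f x)).
have B_ge0 : 0 <= B by rewrite Rintegral_ge0// => x _; exact: cabs_ge0.
have I2 : mu2.-integrable setT (fun w => (exp2 w)%:E).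
  apply: eq_integrable I1 => // w _.
  by rewrite cabsR ger0_norm ?exp2_ge0.
apply: (@le_integrable _ plane R mu2 _ measurableT _ (fun w => (B ^+ 2)%:E * (exp2 w)%:E)%E).
- apply/measurable_EFinP; apply: measurable_funM; first exact: cmeas_cabs2.
  exact: measurable_exp2.
- move=> w _; rewrite -EFinM !abse_EFin lee_fin.
  rewrite !(ger0_norm (mulr_ge0 (sqr_ge0 _) (exp2_ge0 w))).
  apply: ler_wpM2r; first exact: exp2_ge0.
  by rewrite ler_pXn2r ?nnegrE ?cabs_ge0.
- exact: integrableZl.
Qed.

End Regularization.
End Plane.

(** * Contraction in L^2 and Parseval against rectangles *)

Section Contraction.
Context {R : realType}.
Local Notation C := R[i].
Local Notation R2 := (R * R)%type.
Local Notation plane := (measurableTypeR R * measurableTypeR R)%type.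
Local Notation mu := (@lebesgue_measure R).
Local Notation mu2 := (@mu2 R).
Implicit Types f g h : R2 -> C.

Let eps (n : nat) : R := n.+1%:R^-1.

Let eps_gt0 n : 0 < eps n. Proof. by rewrite invr_gt0. Qed.

Lemma cvg_eps : eps @ \oo --> (0 : R).
Proof. exact: cvg_harmonic. Qed.

Lemma cvg_exp2 (w : R2) : (fun n => exp2 (eps n) w) @ \oo --> (1 : R).
Proof.
have ce (x : R) : (fun n => expabs (eps n) x) @ \oo --> (1 : R).
  rewrite -(@expR0 R); apply: continuous_cvg; first exact: continuous_expR.
  rewrite -oppr0; apply: cvgN; rewrite -(mul0r `|x|); apply: cvgM; last exact: cvg_cst.
  exact: cvg_eps.
by rewrite -[1 in X in _ --> X]mulr1; apply: cvgM; exact: ce.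
Qed.

(** Fatou as the damping disappears. Only the inequality comes out here; the isometry follows once
    inversion is known. *)
Lemma fourier_int_contraction f : cintegrable mu2 setT f -> isL2 mu2 f ->
  isL2 mu2 (fourier_int f) /\ (sqn mu2 (fourier_int f) <= sqn mu2 f)%E.
Proof.
move=> fi Lf; have [mf lf] := Lf; have mF := cmeas_fourier_int mf.
suff H : (sqn mu2 (fourier_int f) <= sqn mu2 f)%E.
  by split => //; split => //; exact: le_lt_trans H lf.
apply: (@fatou_bound _ _ _ mu2 (fun n w => (cabs (fourier_int f w) ^+ 2 * exp2 (eps n) w)%:E)).
- move=> n; apply/measurable_EFinP; apply: measurable_funM; first exact: cmeas_cabs2.
  exact: measurable_exp2.
- by move=> n w; rewrite lee_fin; apply: mulr_ge0; [exact: sqr_ge0|exact: exp2_ge0].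
- move=> w; apply: cvg_to_EFin.
  rewrite -[_ ^+ 2 in X in _ --> X]mulr1; apply: cvgM; first exact: cvg_cst.
  exact: cvg_exp2.
- by move=> n; exact: fourier_exp2_le.
Qed.

Definition rect (a b c d : R) (x : R2) : R :=
  \1_(`[a, b]%classic) x.1 * \1_(`[c, d]%classic) x.2.

Lemma rect_ge0 a b c d x : 0 <= rect a b c d x.
Proof. by rewrite mulr_ge0. Qed.

Lemma rect_le1 a b c d x : rect a b c d x <= 1.
Proof. by rewrite mulr_ile1// indicE; case: (_ \in _). Qed.

Lemma measurable_rect a b c d : measurable_fun [set: plane] (rect a b c d).
Proof.
have mI (x y : R) : measurable_fun [set: measurableTypeR R] (\1_(`[x, y]%classic) : _ -> R).
  exact: measurable_indic.
by apply: measurable_funM;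
  [exact: (measurableT_comp (mI a b))|exact: (measurableT_comp (mI c d))].
Qed.

Lemma integral_indic_itv (a b : R) (p : R -> R) :
  measurable_fun [set: measurableTypeR R] p ->
  (\int[mu]_y (p y * \1_(`[a, b]%classic) y)%:E = \int[mu]_(y in `[a, b]) (p y)%:E)%E.
Proof.
move=> mp; rewrite [RHS]integral_mkcond; apply: eq_integral => y _.
rewrite patchE indicE; case: (_ \in _); by rewrite ?mulr1 ?mulr0.
Qed.

Lemma integrable_rect a b c d : mu2.-integrable setT (fun x => (rect a b c d x)%:E).
Proof.
apply/integrableP; split; first by apply/measurable_EFinP; exact: measurable_rect.
under eq_integral do rewrite /= ger0_norm ?rect_ge0//.
rewrite integral_mu2_tensor//.
have fin (x y : R) : (\int[mu]_z (\1_(`[x, y]%classic) z)%:E < +oo)%E.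
  exact: (integrable_lty measurableT (integrable_indic_itv x y true false)).
by apply: lte_mul_pinfty; rewrite ?fin// ?ge0_fin_numE ?fin// integral_ge0.
Qed.

Definition crect (a b c d : R) (x : R2) : C := (rect a b c d x)%:C%C.

Lemma cmeas_crect a b c d : cmeasurable [set: plane] (crect a b c d).
Proof. by apply: cmeasR; exact: measurable_rect. Qed.

Lemma cint_crect a b c d : cintegrable mu2 setT (crect a b c d).
Proof.
apply: (@cint_dom _ _ _ mu2 _ measurableT _ (rect a b c d)).
- exact: cmeas_crect.
- by move=> x _; rewrite cabsR ger0_norm// rect_ge0.
- exact: integrable_rect.
Qed.

Lemma L2_crect a b c d : isL2 mu2 (crect a b c d).
Proof.
split; first exact: cmeas_crect.
have := integrable_lty measurableT (integrable_rect a b c d).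
apply: le_lt_trans; apply: ge0_le_integral => //.
- by move=> x _; rewrite lee_fin sqr_ge0.
- by apply: mcabs2; exact: cmeas_crect.
- by apply/measurable_EFinP; exact: measurable_rect.
- move=> x _; rewrite lee_fin cabsR ger0_norm ?rect_ge0// expr2.
  by rewrite -[leRHS]mulr1; apply: ler_wpM2l; [exact: rect_ge0|exact: rect_le1].
Qed.

(** The Poisson average at x of the indicator of [a, b], through the arctangent antiderivative. *)
Definition avg (e a b x : R) : R :=
  pi^-1 * (atan (2 * pi / e * (b - x)) - atan (2 * pi / e * (a - x))).

(** Each arctangent tends to pi / 2 or - pi / 2 according to the side of the endpoint on which x
    lies. At an endpoint itself the limit would be 1 / 2. *)
Lemma cvg_avg (a b x : R) : a < b -> x != a -> x != b ->
  (fun n => avg (eps n) a b x) @ \oo --> (\1_(`[a, b]%classic) x : R).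
Proof.
move=> ab xa xb.
have p0 := @pi_gt0 R.
have ky n y : 2 * pi / eps n * y = n.+1%:R * (2 * pi * y).
  by rewrite /eps invrK; ring.
have cpos y : 0 < y -> (fun n => atan (2 * pi / eps n * y)) @ \oo --> (pi / 2 : R).
  move=> y0; apply: (cvg_comp _ _ _ (@cvgy_atan R)).
  apply/cvgryPge => A; apply: filterS (nbhs_infty_ger (A / (2 * pi * y))) => n An.
  by rewrite ky -ler_pdivrMr ?mulr_gt0// (le_trans An)// ler_nat.
have cneg y : y < 0 -> (fun n => atan (2 * pi / eps n * y)) @ \oo --> (- (pi / 2) : R).
  move=> y0.
  rewrite (_ : (fun n => _) = (fun n => - atan (2 * pi / eps n * (- y)))); last first.
    by apply/funext => n; rewrite -atanN mulrN opprK.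
  by apply: cvgN; apply: cpos; rewrite oppr_gt0.
have [xlta|] := ltP x a.
  rewrite indicE memNset; last by rewrite /= in_itv /= leNgt xlta.
  rewrite -[0%:R](mulr0 pi^-1) -[X in _ * X](subrr (pi / 2)).
  apply: cvgM; first exact: cvg_cst.
  by apply: cvgB; apply: cpos; rewrite subr_gt0// (lt_trans xlta).
rewrite le_eqVlt eq_sym (negbTE xa) /= => ax.
have [xgtb|] := ltP b x.
  rewrite indicE memNset; last by rewrite /= in_itv /= (leNgt x b) xgtb andbF.
  rewrite -[0%:R](mulr0 pi^-1) -[X in _ * X](subrr (- (pi / 2))).
  apply: cvgM; first exact: cvg_cst.
  by apply: cvgB; apply: cneg; rewrite subr_lt0// (lt_trans ab).
rewrite le_eqVlt (negbTE xb) /= => bx.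
rewrite indicE mem_set; last by rewrite /= in_itv /= !ltW.
rewrite (_ : 1%:R = pi^-1 * (pi / 2 - - (pi / 2))); last first.
  by move: (pi : R) p0 => P p0; field; rewrite gt_eqF.
apply: cvgM; first exact: cvg_cst.
apply: cvgB; first by apply: cpos; rewrite subr_gt0.
by apply: cneg; rewrite subr_lt0.
Unshelve. all: by end_near. Qed.

Lemma avg_bound (e a b x : R) : 0 < e -> a < b -> 0 <= avg e a b x <= 1.
Proof.
move=> e0 ab; have p0 := @pi_gt0 R; apply/andP; split.
  rewrite mulr_ge0 ?invr_ge0 ?(ltW p0)// subr_ge0 le_atan// ler_wpM2l//.
    by rewrite divr_ge0 ?(ltW e0)// mulr_ge0// ltW.
  by rewrite lerD2r ltW.
rewrite /avg ler_pdivrMl// mulr1.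
have := atan_ltpi2 (2 * pi / e * (b - x)); have := atan_gtNpi2 (2 * pi / e * (a - x)); lra.
Qed.

Lemma smooth2_crect (e a b c d : R) x : 0 < e -> a < b -> c < d ->
  smooth2 e (crect a b c d) x = (avg e a b x.1 * avg e c d x.2)%:C%C.
Proof.
move=> e0 ab cd.
rewrite /smooth2; under eq_cintegral do rewrite -RtoCM.
rewrite cintegral_real; congr (_%:C)%C.
have mP (y : R) : measurable_fun [set: measurableTypeR R] (fun z => poisson e (y - z)).
  by apply: (measurableT_comp (measurable_poisson e0)); exact: measurable_funB.
rewrite /Rintegral.
rewrite (eq_integral (fun y : plane => (((poisson e (x.1 - y.1) * \1_(`[a, b]%classic) y.1) *
   (poisson e (x.2 - y.2) * \1_(`[c, d]%classic) y.2)))%:E)); last first.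
  by move=> y _; congr EFin; rewrite /poisson2 /rect /=; ring.
rewrite (@integral_mu2_tensor _ (fun y => poisson e (x.1 - y) * \1_(`[a, b]%classic) y)
   (fun y => poisson e (x.2 - y) * \1_(`[c, d]%classic) y)).
- by rewrite !integral_indic_itv// !integral_poisson_itv.
- by apply: measurable_funM.
- by apply: measurable_funM.
- by move=> y; rewrite mulr_ge0 ?poisson_ge0.
- by move=> y; rewrite mulr_ge0 ?poisson_ge0.
Qed.

Lemma ae_coord1 (a : R) : {ae mu2, forall x, x.1 != a}.
Proof.
exists ([set a] `*` setT); split.
- exact: measurableX.
- transitivity ((mu [set a] * mu setT)%E); first exact: product_measure1E.
  by rewrite lebesgue_measure_set1 mul0e.
- by move=> x /=; rewrite /= => /negP; rewrite negbK => /eqP.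
Qed.

Lemma ae_coord2 (a : R) : {ae mu2, forall x, x.2 != a}.
Proof.
exists (setT `*` [set a]); split.
- exact: measurableX.
- transitivity ((mu setT * mu [set a])%E); first exact: product_measure1E.
  by rewrite lebesgue_measure_set1 mule0.
- by move=> x /=; rewrite /= => /negP; rewrite negbK => /eqP.
Qed.

Lemma ccvgR (u : nat -> R) (l : R) : u @ \oo --> l ->
  ccvg (fun n => (u n)%:C%C) l%:C%C.
Proof.
move=> /cvgrPdist_le ul e /ul[N _ NP]; exists N => i /NP.
by rewrite -rmorphB cabsR distrC.
Qed.

Lemma ccvgMl (z_ : nat -> C) (z c : C) : ccvg z_ z -> ccvg (fun n => c * z_ n) (c * z).
Proof.
move=> H e e0; have k0 : 0 < e / (cabs c + 1) by rewrite divr_gt0// ltr_wpDl ?cabs_ge0.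
have [N NP] := H _ k0; exists N => i /NP; rewrite ler_pdivlMr ?ltr_wpDl ?cabs_ge0// => h.
rewrite -mulrBr cabsM mulrC; apply: le_trans h.
by rewrite ler_wpM2l ?cabs_ge0// lerDl.
Qed.

Lemma fourier_int_crect f (a b c d : R) : a < b -> c < d ->
  cintegrable mu2 setT f -> isL2 mu2 f ->
  ip mu2 (fourier_int f) (fourier_int (crect a b c d)) = ip mu2 f (crect a b c d).
Proof.
move=> ab cd fi Lf.
have [mf _] := Lf; have mF := cmeas_fourier_int mf.
have [LF _] := fourier_int_contraction fi Lf.
have ri := cint_crect a b c d; have Lr := L2_crect a b c d.
have [LG _] := fourier_int_contraction ri Lr; have [mG _] := LG.
apply: (@ccvg_uniq _ (fun n => ip mu2 (fourier_int f)
   (fun w => fourier_int (crect a b c d) w * (exp2 (eps n) w)%:C%C))).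
  apply: (@cdominated _ _ plane mu2 _ _ (fun w => cabs (fourier_int f w * (fourier_int (crect a b c d) w)^*%C))).
  - move=> n; apply: (cmeasM mF); apply: cmeasJ; apply: (cmeasM mG).
    exact: (cmeasR (measurable_exp2 (eps n))).
  - exact: (cmeasM mF (cmeasJ mG)).
  - apply/aeW => w; apply: ccvgMl; apply: ccvgJ.
    have := ccvgMl (fourier_int (crect a b c d) w) (ccvgR (cvg_exp2 w)).
    by rewrite mulr1.
  - move=> n w; rewrite !cabsM !cabsJ cabsM cabsR (ger0_norm (exp2_ge0 _ _)).
    apply: ler_wpM2l; first exact: cabs_ge0.
    by rewrite -[leRHS]mulr1; apply: ler_wpM2l; [exact: cabs_ge0|exact: exp2_le1].
  - exact: (cint_abs measurableT (ip_int LF LG)).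
rewrite (_ : (fun n => _) = (fun n => ip mu2 f (smooth2 (eps n) (crect a b c d)))); last first.
  by apply/funext => n; exact: fourier_int_exp2.
have cab := fun x n => smooth2_crect x (eps_gt0 n) ab cd.
apply: (@cdominated _ _ plane mu2 _ _ (fun w => cabs (f w))).
- move=> n; apply: (cmeasM mf); apply: cmeasJ.
  exact: (cmeas_smooth2 (eps_gt0 n) (cmeas_crect a b c d)).
- exact: (cmeasM mf (cmeasJ (cmeas_crect a b c d))).
- have H1 : {ae mu2, forall x, x.1 != a /\ x.1 != b}.
    by apply: aeS2 (ae_coord1 a) (ae_coord1 b) => x.
  have H2 : {ae mu2, forall x, x.2 != c /\ x.2 != d}.
    by apply: aeS2 (ae_coord2 c) (ae_coord2 d) => x.
  apply: aeS2 H1 H2 => x [xa xb] [xc xd].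
  apply: ccvgMl; apply: ccvgJ; under eq_fun do rewrite cab.
  by apply: ccvgR; apply: cvgM; exact: cvg_avg.
- move=> n x; rewrite cabsM cabsJ cab cabsR -[leRHS]mulr1.
  have /andP[A0 A1] := avg_bound x.1 (eps_gt0 n) ab.
  have /andP[B0 B1] := avg_bound x.2 (eps_gt0 n) cd.
  apply: ler_wpM2l; first exact: cabs_ge0.
  rewrite (ger0_norm (mulr_ge0 A0 B0)); exact: mulr_ile1.
- exact: (cint_abs measurableT fi).
Qed.

End Contraction.

(** * Changes of variables with a constant Jacobian *)

Section ScalingMaps.
Context {R : realType}.
Local Notation C := R[i].
Local Notation R2 := (R * R)%type.
Local Notation plane := (measurableTypeR R * measurableTypeR R)%type.
Local Notation mu := (@lebesgue_measure R).
Local Notation mu2 := (@mu2 R).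

(** For the affine maps below, j is the inverse of the modulus of the determinant. Quantifying over
    all nonnegative measurable functions yields the transport of null sets, of complex integrals and
    of norms without returning to the map. *)
Definition scales (A : R2 -> R2) (j : R) : Prop :=
  [/\ measurable_fun [set: plane] (A : plane -> plane), 0 < j &
      forall g : R2 -> \bar R, measurable_fun [set: plane] g -> (forall x, 0 <= g x)%E ->
        (\int[mu2]_x g (A x) = j%:E * \int[mu2]_x g x)%E].

Section Scales.
Context (A : R2 -> R2) (j : R) (scA : scales A j).

Lemma scales_ae (P : R2 -> Prop) :
  {ae mu2, forall x, P x} -> {ae mu2, forall x, P (A x)}.
Proof.
have [mA j0 gA] := scA.
move=> [N [mN N0 PN]]; exists (A @^-1` N); split.
- by rewrite -[X in measurable X]setTI; exact: mA.
- transitivity (\int[mu2]_x (\1_N (A x))%:E)%E.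
    transitivity (\int[mu2]_x (\1_(A @^-1` N) x)%:E)%E.
      rewrite integral_indic ?setIT//.
      by rewrite -[X in measurable X]setTI; exact: mA.
    by apply: eq_integral => x _.
  rewrite (gA (fun x => (\1_N x)%:E))//.
  + have -> : (\int[mu2]_x (\1_N x)%:E)%E = mu2 N by rewrite integral_indic ?setIT.
    by rewrite N0 mule0.
  + by apply/measurable_EFinP; exact: measurable_indic.
- by move=> x /= NP; apply: PN.
Qed.

Lemma scales_Rintegral (g : R2 -> R) : mu2.-integrable setT (EFin \o g) ->
  mu2.-integrable setT (EFin \o (g \o A)) /\
  Rintegral mu2 setT (g \o A) = j * Rintegral mu2 setT g.
Proof.
have [mA j0 gA] := scA.
move=> ig; have mg : measurable_fun [set: plane] (EFin \o g) := measurable_int _ ig.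
split.
  apply/integrableP; split; first exact: (measurableT_comp mg mA).
  have /integrableP[_ ig'] := ig.
  rewrite (gA (fun x => `|(g x)%:E|%E))//.
    by apply: lte_mul_pinfty => //; rewrite lee_fin ltW.
  exact: measurableT_comp.
rewrite /Rintegral integralE (integralE mu2 setT (fun x => (g x)%:E)).
have Ip : (\int[mu2]_x (EFin \o g)^\+ x \is a fin_num)%E by exact: integrable_pos_fin_num ig.
have In : (\int[mu2]_x (EFin \o g)^\- x \is a fin_num)%E by exact: integrable_neg_fin_num ig.
have -> : (\int[mu2]_x (fun x => (g (A x))%:E)^\+ x =
   j%:E * \int[mu2]_x (EFin \o g)^\+ x)%E.
  rewrite -gA//; last exact: measurable_funepos.
  by apply: eq_integral => x _; rewrite !funeposE.
have -> : (\int[mu2]_x (fun x => (g (A x))%:E)^\- x =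
   j%:E * \int[mu2]_x (EFin \o g)^\- x)%E.
  rewrite -gA//; last exact: measurable_funeneg.
  by apply: eq_integral => x _; rewrite !funenegE.
rewrite -(fineK Ip) -(fineK In) -!EFinM -!EFinB /=.
by rewrite mulrBr.
Qed.

Lemma scales_cint (g : R2 -> C) : cintegrable mu2 setT g ->
  cintegrable mu2 setT (g \o A) /\
  cintegral mu2 setT (g \o A) = j%:C%C * cintegral mu2 setT g.
Proof.
move=> [ir ii].
have [ir' Er] := scales_Rintegral ir; have [ii' Ei] := scales_Rintegral ii.
split => //; apply: complex_eqP; rewrite ReImE /= mul0r ?subr0 ?addr0.
  exact: Er.
exact: Ei.
Qed.

Lemma scales_cmeas (g : R2 -> C) : cmeasurable [set: plane] g ->
  cmeasurable [set: plane] (fun x => g (A x)).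
Proof. by have [mA _ _] := scA; move=> mg; exact: (cmeas_comp mg mA). Qed.

Lemma scales_sqn (g : R2 -> C) : cmeasurable [set: plane] g ->
  sqn mu2 (fun x => g (A x)) = (j%:E * sqn mu2 g)%E.
Proof.
have [_ _ gA] := scA; move=> mg; rewrite -gA//; first exact: mcabs2.
by move=> x; rewrite lee_fin sqr_ge0.
Qed.

Lemma scales_L2 (g : R2 -> C) : isL2 mu2 g -> isL2 mu2 (fun x => g (A x)).
Proof.
have [_ j0 _] := scA; move=> [mg lg]; split; first exact: scales_cmeas.
by rewrite scales_sqn// lte_mul_pinfty// lee_fin ltW.
Qed.

End Scales.

Definition affine (k1 k2 k3 c1 c2 : R) (x : R2) : R2 :=
  (k1 * x.1 + k2 * x.2 + c1, k3 * x.2 + c2).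

(** The first coordinate is integrated first: at fixed x_2 the term k2 x_2 + c1 is a mere
    translation. *)
Lemma scales_affine (k1 k2 k3 c1 c2 : R) : k1 != 0 -> k3 != 0 ->
  scales (affine k1 k2 k3 c1 c2) `|k1 * k3|^-1.
Proof.
move=> k10 k30; set A := affine _ _ _ _ _.
have mA : measurable_fun [set: plane] (A : plane -> plane).
  apply: measurable_fun_pair; apply: measurable_funD => //.
    by apply: measurable_funD; apply: measurable_funM.
  by apply: measurable_funM.
split => //; first by rewrite invr_gt0 normr_gt0 mulf_neq0.
move=> g mg g0.
have mgA : measurable_fun [set: plane] (g \o A) by exact: (measurableT_comp mg mA).
transitivity (\int[mu]_x2 \int[mu]_x1 g (A (x1, x2)))%E.
  exact: (@fubini_tonelli2 _ _ _ _ _ mu mu).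
have -> : (\int[mu2]_x g x = \int[mu]_x2 \int[mu]_x1 g (x1, x2))%E.
  exact: (@fubini_tonelli2 _ _ _ _ _ mu mu).
pose G (y : R) := (\int[mu]_x1 g (x1, y))%E.
have mG : measurable_fun [set: measurableTypeR R] G.
  exact: (@measurable_fun_fubini_tonelli_G _ _ _ _ _ mu g).
have G0 y : (0 <= G y)%E by apply: integral_ge0.
transitivity (\int[mu]_x2 ((`|k1|^-1)%:E * G (k3 * x2 + c2)%R))%E.
  apply: eq_integral => y _; rewrite /A /affine /=.
  rewrite -(@ge0_integral_affine _ k1 (k2 * y + c1) (fun x => g (x, k3 * y + c2)))//.
    by apply: eq_integral => x _; rewrite addrA.
  apply: (measurableT_comp mg); exact: measurable_fun_pair.
rewrite ge0_integralZl_EFin//; last first.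
  apply: (measurableT_comp mG); exact: measurable_affine.
by rewrite ge0_integral_affine// muleA -EFinM normrM invfM.
Qed.

Definition shear (k1 k2 k3 : R) (x : R2) : R2 := (k1 * x.1, k3 * x.2 + k2 * x.1).

(** The matrix is lower triangular, so the order of integration is opposite to that of
    [scales_affine]. This is the shape of the maps on the frequency side. *)
Lemma scales_shear (k1 k2 k3 : R) : k1 != 0 -> k3 != 0 ->
  scales (shear k1 k2 k3) `|k1 * k3|^-1.
Proof.
move=> k10 k30; set A := shear _ _ _.
have mA : measurable_fun [set: plane] (A : plane -> plane).
  apply: measurable_fun_pair; first by apply: measurable_funM.
  by apply: measurable_funD; apply: measurable_funM.
split => //; first by rewrite invr_gt0 normr_gt0 mulf_neq0.
move=> g mg g0.
have mgA : measurable_fun [set: plane] (g \o A) by exact: (measurableT_comp mg mA).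
transitivity (\int[mu]_x1 \int[mu]_x2 g (A (x1, x2)))%E.
  exact: integral_mu2.
rewrite (integral_mu2 mg g0).
pose G (y : R) := (\int[mu]_x2 g (y, x2))%E.
have mG : measurable_fun [set: measurableTypeR R] G.
  exact: (@measurable_fun_fubini_tonelli_F _ _ _ _ _ mu g).
have G0 y : (0 <= G y)%E by apply: integral_ge0.
transitivity (\int[mu]_x1 ((`|k3|^-1)%:E * G (k1 * x1 + 0)%R))%E.
  apply: eq_integral => y _; rewrite /A /shear /=.
  rewrite -(@ge0_integral_affine _ k3 (k2 * y) (fun x => g (k1 * y + 0, x)))//.
    by apply: eq_integral => x _; rewrite addr0.
  apply: (measurableT_comp mg); exact: measurable_fun_pair.
rewrite ge0_integralZl_EFin//; last first.
  apply: (measurableT_comp mG); exact: measurable_affine.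
by rewrite ge0_integral_affine// muleA -EFinM normrM invfM mulrC.
Qed.

End ScalingMaps.

(** * Functions orthogonal to all rectangles *)

Section RectangleUniqueness.
Context {R : realType}.
Local Notation C := R[i].
Local Notation R2 := (R * R)%type.
Local Notation plane := (measurableTypeR R * measurableTypeR R)%type.
Local Notation mu := (@lebesgue_measure R).
Local Notation mu2 := (@mu2 R).

(** Turns the positive and negative parts of a function into measures, to which uniqueness on an
    intersection-stable generator applies. *)
Lemma density_measure d (T : measurableType d) (m : {measure set T -> \bar R})
    (h : T -> \bar R) : measurable_fun setT h -> (forall x, 0 <= h x)%E ->
  exists nu : {measure set T -> \bar R}, forall A, nu A = (\int[m]_(x in A) h x)%E.
Proof.
move=> mh h0; pose f (A : set T) := (\int[m]_(x in A) h x)%E.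
have f0 : f set0 = 0%E by exact: integral_set0.
have fge0 A : (0 <= f A)%E by exact: integral_ge0.
have fs : semi_sigma_additive f.
  move=> F mF tF mUF; rewrite /f ge0_integral_bigcup//; last exact: measurable_funTS.
  by apply: is_cvg_nneseries => n _ _; exact: integral_ge0.
have mfm := isMeasure.Build d T R f f0 fge0 fs.
pose nu : {measure set T -> \bar R} := HB.pack f mfm.
by exists nu.
Qed.

Definition crects : set (set plane) :=
  [set S | exists a b c d : R, S = (`[a, b] `*` `[c, d])%classic].

Lemma itvI_cc (a b c d : R) :
  (`[a, b] `&` `[c, d] = `[Num.max a c, Num.min b d])%classic.
Proof.
apply/seteqP; split => x /=; rewrite !in_itv /= ge_max le_min.
  by move=> [/andP[-> ->] /andP[-> ->]].
by move=> /andP[/andP[-> ->] /andP[-> ->]].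
Qed.

Lemma setI_closed_crects : setI_closed crects.
Proof.
move=> _ _ [a [b [c [d ->]]]] [a' [b' [c' [d' ->]]]].
exists (Num.max a a'), (Num.min b b'), (Num.max c c'), (Num.min d d').
by rewrite -!itvI_cc setXI.
Qed.

Definition box (n : nat) : set plane := (`[- n%:R, n%:R] `*` `[- n%:R, n%:R])%classic.

Lemma bigcup_box : \bigcup_n box n = setT.
Proof.
apply/seteqP; split => // -[x y] _.
exists (maxn (Num.truncn `|x|).+1 (Num.truncn `|y|).+1) => //.
split; rewrite /= in_itv /= -ler_norml.
  by rewrite (le_trans (ltW (truncnS_gt _)))// ler_nat leq_maxl.
by rewrite (le_trans (ltW (truncnS_gt _)))// ler_nat leq_maxr.
Qed.

(** The two projections are measurable for the generated sigma-algebra, because the preimage of a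
    closed ray is a countable union of compact rectangles. *)
Lemma measurable_crects : @measurable _ plane = <<s crects >>.
Proof.
apply/seteqP; split; last first.
  apply: smallest_sub; first exact: sigma_algebra_measurable.
  by move=> _ [a [b [c [d ->]]]]; exact: measurableX.
pose T' : measurableType _ := g_sigma_algebraType crects.
have mU (F : nat -> set plane) : (forall n, crects (F n)) ->
    @measurable _ T' (\bigcup_n F n).
  by move=> GF; apply: bigcupT_measurable => n; exact: sub_sigma_algebra.
have covn (r : R) : exists n, r <= n%:R /\ - n%:R <= r.
  exists (Num.truncn `|r|).+1; have := ltW (truncnS_gt `|r|).
  by rewrite ler_norml => /andP[].
have m1 : measurable_fun [set: T'] (fst : T' -> measurableTypeR R).
  apply: (measurability _ (RGenCInfty.measurableE R)) => _ [_ [r ->] <-].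
  rewrite setTI (_ : _ @^-1` _ =
    \bigcup_n (`[r, r + n%:R] `*` `[- n%:R, n%:R])%classic); last first.
    apply/seteqP; split => [[x y] /=|[x y] [n _ [/=]]]; rewrite ?in_itv/= andbT.
      move=> rx; have [n1 [xn _]] := covn (x - r); have [n2 [yn1 yn2]] := covn y.
      exists (maxn n1 n2) => //; split; rewrite /= in_itv /= ?rx /=.
        by rewrite -lerBlDl (le_trans xn)// ler_nat leq_maxl.
      have n2m : (n2%:R : R) <= (maxn n1 n2)%:R by rewrite ler_nat leq_maxr.
      by rewrite (le_trans yn1)// andbT (le_trans _ yn2)// lerN2.
    by move=> /andP[].
  by apply: mU => n; do 4 eexists.
have m2 : measurable_fun [set: T'] (snd : T' -> measurableTypeR R).
  apply: (measurability _ (RGenCInfty.measurableE R)) => _ [_ [r ->] <-].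
  rewrite setTI (_ : _ @^-1` _ =
    \bigcup_n (`[- n%:R, n%:R] `*` `[r, r + n%:R])%classic); last first.
    apply/seteqP; split => [[x y] /=|[x y] [n _ [/=]]]; rewrite ?in_itv/= ?andbT.
      move=> rx; have [n1 [xn _]] := covn (y - r); have [n2 [yn1 yn2]] := covn x.
      exists (maxn n1 n2) => //; split; rewrite /= in_itv /= ?rx /=; last first.
        by rewrite -lerBlDl (le_trans xn)// ler_nat leq_maxl.
      have n2m : (n2%:R : R) <= (maxn n1 n2)%:R by rewrite ler_nat leq_maxr.
      by rewrite (le_trans yn1)// andbT (le_trans _ yn2)// lerN2.
    by move=> _ /andP[].
  by apply: mU => n; do 4 eexists.
have mid : measurable_fun [set: T'] (fun z : T' => (z.1, z.2) : plane).
  exact: measurable_fun_pair.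
move=> S mS; have := mid measurableT S mS; rewrite setTI.
by rewrite (_ : _ @^-1` _ = S)//; apply/seteqP; split => -[x y].
Qed.

(** The positive and negative parts are the densities of two measures that agree on closed
    rectangles, hence on all measurable sets; a function whose integral over every measurable set is
    0 vanishes almost everywhere. *)
Lemma integrable_rects_eq0 (h : R2 -> R) : mu2.-integrable setT (EFin \o h) ->
  (forall a b c d : R, (\int[mu2]_(x in `[a, b] `*` `[c, d]) (h x)%:E = 0)%E) ->
  {ae mu2, forall x, h x = 0}.
Proof.
move=> ih hr; have mh : measurable_fun [set: plane] (EFin \o h) := measurable_int _ ih.
have mp : measurable_fun [set: plane] (EFin \o h)^\+%E by exact: measurable_funepos.
have mn : measurable_fun [set: plane] (EFin \o h)^\-%E by exact: measurable_funeneg.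
have [nup nupE] := @density_measure _ plane mu2 (EFin \o h)^\+%E mp (funepos_ge0 _).
have [nun nunE] := @density_measure _ plane mu2 (EFin \o h)^\-%E mn (funeneg_ge0 _).
have fp (A : set plane) : measurable A -> (\int[mu2]_(x in A) (EFin \o h)^\+ x \is a fin_num)%E.
  move=> mA; apply: (integrable_pos_fin_num (mu := mu2)) => //.
  exact: (integrableS measurableT).
have fn (A : set plane) : measurable A -> (\int[mu2]_(x in A) (EFin \o h)^\- x \is a fin_num)%E.
  move=> mA; apply: (integrable_neg_fin_num (mu := mu2)) => //.
  exact: (integrableS measurableT).
have nuE (A : set plane) : measurable A -> nup A = nun A.
  apply: (measure_unique crects box) => //.
  - exact: measurable_crects.
  - exact: setI_closed_crects.
  - by move=> n; do 4 eexists.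
  - exact: bigcup_box.
  - move=> _ [a [b [c [d ->]]]]; rewrite nupE nunE.
    have mr : measurable ((`[a, b] `*` `[c, d])%classic : set plane) by exact: measurableX.
    have E := integralE mu2 (`[a, b] `*` `[c, d])%classic (EFin \o h).
    have := hr a b c d; rewrite E -(fineK (fp _ mr)) -(fineK (fn _ mr)) -EFinB.
    by move=> [/eqP]; rewrite subr_eq0 => /eqP ->.
  - move=> n; rewrite nupE ltey_eq fp//; exact: measurableX.
have : ae_eq mu2 setT (EFin \o h) (cst 0%E).
  apply: (integral_ae_eq (mu := mu2)) => // A _ mA.
  rewrite integral0 integralE; have := nuE A mA; rewrite nupE nunE => ->.
  by rewrite subee// fn.
by apply: aeS => x /(_ I) [].
Qed.

Lemma rect_null (a b c d : R) : ~~ ((a < b) && (c < d)) ->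
  mu2 (`[a, b] `*` `[c, d])%classic = 0%E.
Proof.
move=> H; transitivity ((mu `[a, b] * mu `[c, d])%E); first exact: product_measure1E.
move: H; rewrite !lebesgue_measure_itv /= !lte_fin negb_and => /orP[]/negbTE ->.
  by rewrite mul0e.
by rewrite mule0.
Qed.

(** Meant for L^2 functions, which are integrable on boxes only. Intersecting a rectangle with a box
    gives a rectangle again; if it is degenerate, it is a null set by [rect_null]. *)
Lemma locally_integrable_rects_eq0 (h : R2 -> R) :
  (forall n, mu2.-integrable (box n) (EFin \o h)) ->
  (forall a b c d : R, a < b -> c < d ->
     (\int[mu2]_(x in `[a, b] `*` `[c, d]) (h x)%:E = 0)%E) ->
  {ae mu2, forall x, h x = 0}.
Proof.
move=> ih hr.
have mbox n : measurable (box n) by exact: measurableX.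
have hn n : {ae mu2, forall x, (h \_ (box n)) x = 0}.
  apply: integrable_rects_eq0.
    have /(integrable_mkcond _ (mbox n)) := ih n.
    by rewrite restrict_EFin.
  move=> a b c d.
  rewrite -(_ : (\int[mu2]_(x in (`[a, b] `*` `[c, d]) `&` box n) (h x)%:E =
     \int[mu2]_(x in `[a, b] `*` `[c, d]) ((h \_ (box n)) x)%:E)%E); last first.
    by rewrite integral_mkcondr; apply: eq_integral => x _; rewrite restrict_EFin.
  rewrite /box -setXI !itvI_cc.
  set a' := Num.max a _; set b' := Num.min b _; set c' := Num.max c _; set d' := Num.min d _.
  have [/andP[ab cd]|H] := boolP ((a' < b') && (c' < d')); first exact: hr.
  have sub : (`[a', b'] `*` `[c', d'])%classic `<=` box n.
    rewrite /a' /b' /c' /d' -!itvI_cc setXI; exact: subIsetr.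
  apply: null_set_integral; last exact: rect_null.
    exact: measurableX.
  exact: measurable_funS (measurable_int _ (ih n)).
have := @ae_foralln _ _ _ mu2 (fun n x => (h \_ (box n)) x = 0) hn.
apply: aeS => x H; have : (\bigcup_n box n) x by rewrite bigcup_box.
by move=> [n _ bx]; have := H n; rewrite patchE mem_set.
Qed.

Lemma L2_rects_eq0 (g : R2 -> C) : isL2 mu2 g ->
  (forall a b c d : R, a < b -> c < d -> ip mu2 g (crect a b c d) = 0) ->
  {ae mu2, forall x, g x = 0}.
Proof.
move=> Lg gr.
have key (p : C -> R) : (forall z (r : R), p (z * (r%:C%C)^*%C) = p z * r) ->
    (forall a b c d, mu2.-integrable setT (fun x => (p (g x * (crect a b c d x)^*%C))%:E)) ->
    (forall a b c d, a < b -> c < d ->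
      Rintegral mu2 setT (fun x => p (g x * (crect a b c d x)^*%C)) = 0) ->
    {ae mu2, forall x, p (g x) = 0}.
  move=> pM ip pr.
  have pE (a b c d : R) x : (p (g x * (crect a b c d x)^*%C))%:E =
      ((fun x => (p (g x))%:E) \_ (`[a, b] `*` `[c, d])%classic) x.
    rewrite pM /rect !indicE patchE in_setX.
    by case: (_ \in _); case: (_ \in _); rewrite ?mulr1 ?mulr0 ?mul0r.
  apply: locally_integrable_rects_eq0.
    move=> n; apply/integrable_mkcond; first exact: measurableX.
    have := ip (- n%:R) n%:R (- n%:R) n%:R.
    by under eq_fun do rewrite pE.
  move=> a b c d ab cd.
  have := pr a b c d ab cd; rewrite /Rintegral => H.
  rewrite integral_mkcond -(_ : (\int[mu2]_x (p (g x * (crect a b c d x)^*%C))%:E =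
     \int[mu2]_x ((fun x => (p (g x))%:E) \_ (`[a, b] `*` `[c, d])%classic) x)%E); last first.
    by apply: eq_integral => x _; rewrite pE.
  by rewrite -[LHS]fineK ?H// integrable_fin_num.
have ir (a b c d : R) := ip_int Lg (L2_crect a b c d).
have Hr : {ae mu2, forall x, complex.Re (g x) = 0}.
  apply: key.
  - by move=> [x y] r /=; rewrite oppr0 mulr0 subr0.
  - by move=> a b c d; have [] := ir a b c d.
  - by move=> a b c d ab cd; have := gr a b c d ab cd => -[].
have Hi : {ae mu2, forall x, complex.Im (g x) = 0}.
  apply: key.
  - by move=> [x y] r /=; rewrite oppr0 mulr0 add0r.
  - by move=> a b c d; have [] := ir a b c d.
  - by move=> a b c d ab cd; have := gr a b c d ab cd => -[].
by apply: aeS2 Hr Hi => x hr hi; exact: complex_eqP.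
Qed.
End RectangleUniqueness.

(** * The Fourier-Plancherel transform on L^2 *)

Section Plancherel.
Context {R : realType}.
Local Notation C := R[i].
Local Notation R2 := (R * R)%type.
Local Notation plane := (measurableTypeR R * measurableTypeR R)%type.
Local Notation mu := (@lebesgue_measure R).
Local Notation mu2 := (@mu2 R).
Local Notation L2 := (isL2 mu2).
Implicit Types f g h : R2 -> C.

Definition refl2 f (x : R2) : C := f (- x.1, - x.2).

Lemma refl2E f : refl2 f = (fun x => f (affine (-1) 0 (-1) 0 0 x)).
Proof.
by apply/funext => x; rewrite /refl2 /affine !mulN1r mul0r !addr0.
Qed.

Let m1_neq0 : (-1 : R) != 0. Proof. by rewrite oppr_eq0 oner_eq0. Qed.

Let scr : scales (affine (-1) 0 (-1) 0 (0 : R)) `|(-1) * (-1)|^-1.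
Proof. exact: scales_affine. Qed.

Let jac1 : `|(-1) * (-1) : R|^-1 = 1.
Proof. by rewrite mulrNN mulr1 normr1 invr1. Qed.

Lemma sqn_refl2 f : cmeasurable [set: plane] f -> sqn mu2 (refl2 f) = sqn mu2 f.
Proof. by move=> mf; rewrite refl2E (scales_sqn scr mf) jac1 mul1e. Qed.

Lemma L2_refl2 f : L2 f -> L2 (refl2 f).
Proof. by move=> Lf; rewrite refl2E; exact: (scales_L2 scr). Qed.

Lemma cint_refl2 f : cintegrable mu2 setT f ->
  cintegrable mu2 setT (refl2 f) /\ cintegral mu2 setT (refl2 f) = cintegral mu2 setT f.
Proof.
move=> fi; rewrite refl2E; have [i1 E] := scales_cint scr fi.
by split; [exact: i1|rewrite E jac1 mul1r].
Qed.

Lemma ae_refl2 (P : R2 -> Prop) :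
  {ae mu2, forall x, P x} -> {ae mu2, forall x, P (- x.1, - x.2)}.
Proof.
move=> H; have := scales_ae scr H; apply: aeS => x.
by rewrite /affine !mulN1r mul0r !addr0.
Qed.

Lemma fourier_int_refl2 f w : cintegrable mu2 setT f ->
  fourier_int (refl2 f) w = refl2 (fourier_int f) w.
Proof.
move=> fi; have H := fourier_int_int (- w.1, - w.2) fi.
have [_ E] := cint_refl2 H; rewrite [RHS]/refl2 /fourier_int -E.
apply: eq_cintegral => x _; rewrite /refl2; congr (_ * cis _).
by rewrite /dot2 /=; ring.
Qed.

Lemma truncateE n f x :
  truncate n f x = f x * crect (- n%:R) n%:R (- n%:R) n%:R x.
Proof.
rewrite /truncate /crect /rect !indicE !mem_setE !in_itv /= -!ler_norml.
by case: (`|x.1| <= _); case: (`|x.2| <= _); rewrite /= ?mulr1 ?mulr0.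
Qed.

Lemma truncateFE n f : truncate n f = (fun x => f x * crect (- n%:R) n%:R (- n%:R) n%:R x).
Proof. by apply/funext => x; exact: truncateE. Qed.

Lemma crect_le1 (a b c d : R) x : cabs (crect a b c d x) <= 1.
Proof. by rewrite cabsR ger0_norm ?rect_ge0 ?rect_le1. Qed.

Lemma L2_truncate n f : L2 f -> L2 (truncate n f).
Proof.
move=> Lf; rewrite truncateFE; apply: (L2Mb Lf (cmeas_crect _ _ _ _)) => x.
exact: crect_le1.
Qed.

Lemma cint_truncate n f : L2 f -> cintegrable mu2 setT (truncate n f).
Proof. by move=> Lf; rewrite truncateFE; exact: (L2_prod_int Lf (L2_crect _ _ _ _)). Qed.

Lemma truncate_near f x : exists N, forall n, (N <= n)%N -> truncate n f x = f x.
Proof.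
exists (maxn (Num.truncn `|x.1|).+1 (Num.truncn `|x.2|).+1) => n.
rewrite geq_max => /andP[n1 n2]; rewrite /truncate.
have H (r : R) : ((Num.truncn `|r|).+1 <= n)%N -> `|r| <= n%:R.
  by move=> rn; rewrite (le_trans (ltW (truncnS_gt _)))// ler_nat.
by rewrite !H.
Qed.

Lemma cvgL2_truncate f : L2 f -> cvgL2 mu2 (fun n => truncate n f) f.
Proof.
move=> Lf; have [mf _] := Lf.
have mt n : cmeasurable [set: plane] (truncate n f) by case: (L2_truncate n Lf).
have [] := @dominated_convergence _ plane R mu2 setT measurableT
  (fun n x => (cabs (truncate n f x - f x) ^+ 2)%:E) (cst 0%E)
  (fun x => (cabs (f x) ^+ 2)%:E).
- by move=> n; apply: mcabs2; exact: (cmeasB (mt n) mf).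
- exact: measurable_cst.
- apply/aeW => x _; apply: cvg_near_cst; have [N NP] := truncate_near f x.
  by exists N => // n /NP ->; rewrite subrr cabs0 expr0n.
- exact: (isL2_int Lf).
- apply/aeW => x n _; rewrite abse_EFin lee_fin ger0_norm ?sqr_ge0//.
  rewrite ler_pXn2r ?nnegrE ?cabs_ge0//.
  rewrite /truncate; case: ifP => _; first by rewrite subrr cabs0 cabs_ge0.
  by rewrite sub0r cabsN.
by rewrite integral0.
Qed.

Lemma fourier_int_sqnB f g : cintegrable mu2 setT f -> L2 f ->
  cintegrable mu2 setT g -> L2 g ->
  (sqn mu2 (fun w => (fourier_int f w - fourier_int g w)%R) <=
   sqn mu2 (fun x => (f x - g x)%R))%E.
Proof.
move=> fi Lf gi Lg.
have [_ H] := fourier_int_contraction (cintB measurableT fi gi) (L2B Lf Lg).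
apply: le_trans H; rewrite le_eqVlt; apply/orP; left; apply/eqP.
by apply: eq_sqn => w; rewrite (fourier_intB w fi gi).
Qed.

(** The truncations form a Cauchy sequence in L^2 and the Fourier integral contracts distances, so
    completeness supplies the limit. *)
Lemma is_fourier_exists f : L2 f -> exists fhat, is_fourier f fhat.
Proof.
move=> Lf.
have [||fh [Lfh cfh]] := @L2_complete _ _ plane mu2 (fun n => fourier_int (truncate n f)).
- by move=> n; have [] := fourier_int_contraction (cint_truncate n Lf) (L2_truncate n Lf).
- move=> e e0.
  have [N NP] := cvgL2_cauchy (fun n => L2_truncate n Lf) Lf (cvgL2_truncate Lf) e0.
  exists N => i j Ni Nj; apply: le_trans (NP i j Ni Nj).
  by apply: fourier_int_sqnB; first [exact: cint_truncate|exact: L2_truncate].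
by exists fh.
Qed.

Lemma fourier_spec f : L2 f -> is_fourier f (fourier f).
Proof. by move=> /is_fourier_exists [fh Hfh]; apply: xgetPex; exists fh; exact: Hfh. Qed.

Lemma L2_fourier f : L2 f -> L2 (fourier f).
Proof. by move=> /fourier_spec[]. Qed.

(** Frees the transform from the truncations of its definition: any integrable approximations in L^2
    compute it. Reflected and dilated truncations are used in this way. *)
Lemma cvgL2_fourier (f_ : nat -> R2 -> C) f : (forall n, L2 (f_ n)) ->
  (forall n, cintegrable mu2 setT (f_ n)) -> L2 f -> cvgL2 mu2 f_ f ->
  cvgL2 mu2 (fun n => fourier_int (f_ n)) (fourier f).
Proof.
move=> Lf_ fi Lf cf; have [LF cF] := fourier_spec Lf.
have LFf n : L2 (fourier_int (f_ n)) by have [] := fourier_int_contraction (fi n) (Lf_ n).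
have LFt n : L2 (fourier_int (truncate n f)).
  by have [] := fourier_int_contraction (cint_truncate n Lf) (L2_truncate n Lf).
apply: (cvgL2_trans LFf LFt LF cF).
have /cvgL2P ct := cvgL2_truncate Lf; move/cvgL2P: cf => cf.
apply/cvgL2P => e e0; have e40 : 0 < e / 4 by rewrite divr_gt0.
have [N1 N1P] := cf _ e40; have [N2 N2P] := ct _ e40.
exists (maxn N1 N2) => i; rewrite geq_max => /andP[i1 i2].
under [X in (sqn _ X <= _)%E]eq_fun do rewrite subr0.
apply: le_trans (fourier_int_sqnB (fi i) (Lf_ i) (cint_truncate i Lf) (L2_truncate i Lf)) _.
have tr := sqn_triangle (Lf_ i) Lf (L2_truncate i Lf) (N1P _ i1).
by apply: tr; rewrite sqnBC; exact: N2P.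
Qed.

Lemma fourier_uniq (f_ : nat -> R2 -> C) f h : (forall n, L2 (f_ n)) ->
  (forall n, cintegrable mu2 setT (f_ n)) -> L2 f -> cvgL2 mu2 f_ f -> L2 h ->
  cvgL2 mu2 (fun n => fourier_int (f_ n)) h -> {ae mu2, forall w, fourier f w = h w}.
Proof.
move=> Lf_ fi Lf cf Lh ch.
have LFf n : L2 (fourier_int (f_ n)) by have [] := fourier_int_contraction (fi n) (Lf_ n).
apply: (cvgL2_uniq LFf (L2_fourier Lf) Lh _ ch).
exact: (cvgL2_fourier Lf_ fi Lf cf).
Qed.

Lemma fourier_fourier_int f : L2 f -> cintegrable mu2 setT f ->
  {ae mu2, forall w, fourier f w = fourier_int f w}.
Proof.
move=> Lf fi; have [LF _] := fourier_int_contraction fi Lf.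
exact: (fourier_uniq (fun=> Lf) (fun=> fi) Lf (cvgL2_cst mu2 f) LF (cvgL2_cst mu2 _)).
Qed.

(** The conclusion is a genuine equality: the set in which [xget] chooses depends only on the
    Fourier integrals of the truncations, and these ignore null sets. *)
Lemma eq_fourier f g : cmeasurable [set: plane] f -> cmeasurable [set: plane] g ->
  {ae mu2, forall x, f x = g x} -> fourier f = fourier g.
Proof.
move=> mf mg fg.
have E n : fourier_int (truncate n f) = fourier_int (truncate n g).
  apply/funext => w; rewrite !truncateFE; apply: ae_eq_cintegral => //.
  - apply: cmeasM; first exact: (cmeasM mf (cmeas_crect _ _ _ _)).
    apply: cmeas_cis; apply: measurableT_comp => //; apply: measurable_funM => //.
    under eq_fun do rewrite dot2C.
    exact: measurable_dot2r.
  - apply: cmeasM; first exact: (cmeasM mg (cmeas_crect _ _ _ _)).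
    apply: cmeas_cis; apply: measurableT_comp => //; apply: measurable_funM => //.
    under eq_fun do rewrite dot2C.
    exact: measurable_dot2r.
  - by apply: aeS fg => x fgx _; rewrite fgx.
have E' k : (fun n => sqnorm2 (fun w => fourier_int (truncate n f) w - k w)) =
    (fun n => sqnorm2 (fun w => fourier_int (truncate n g) w - k w)).
  by apply/funext => n; rewrite E.
suff S : [set k | is_fourier f k] = [set k | is_fourier g k].
  exact: (congr1 (xget (fun=> 0)) S).
apply/seteqP; split => k [Lk ck]; (split; first exact: Lk).
  by rewrite -E'; exact: ck.
by rewrite E'; exact: ck.
Qed.

Lemma ifourierE f : ifourier f = refl2 (fourier f).
Proof. by []. Qed.

Lemma L2_ifourier f : L2 f -> L2 (ifourier f).
Proof. by move=> Lf; exact: (L2_refl2 (L2_fourier Lf)). Qed.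

Lemma cvgL2_refl2 (f_ : nat -> R2 -> C) f : (forall n, L2 (f_ n)) -> L2 f ->
  cvgL2 mu2 f_ f -> cvgL2 mu2 (fun n => refl2 (f_ n)) (refl2 f).
Proof.
move=> Lf_ Lf cf; rewrite /cvgL2.
rewrite (_ : (fun n => _) = (fun n => sqn mu2 (fun x => f_ n x - f x))); first exact: cf.
apply/funext => n; have [mi _] := Lf_ n; have [mf _] := Lf.
by rewrite -(sqn_refl2 (cmeasB mi mf)).
Qed.

Lemma fourier_refl2 f : L2 f -> {ae mu2, forall w, fourier (refl2 f) w = refl2 (fourier f) w}.
Proof.
move=> Lf.
have ti n := cint_truncate n Lf; have Lt n := L2_truncate n Lf.
have LFt n : L2 (fourier_int (truncate n f)).
  by have [] := fourier_int_contraction (ti n) (Lt n).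
apply: (@fourier_uniq (fun n => refl2 (truncate n f))).
- by move=> n; exact: L2_refl2.
- by move=> n; have [] := cint_refl2 (ti n).
- exact: L2_refl2.
- exact: (cvgL2_refl2 Lt Lf (cvgL2_truncate Lf)).
- exact: (L2_refl2 (L2_fourier Lf)).
- rewrite (_ : (fun n => _) = (fun n => refl2 (fourier_int (truncate n f)))).
    exact: (cvgL2_refl2 LFt (L2_fourier Lf) (cvgL2_fourier Lt ti Lf (cvgL2_truncate Lf))).
  by apply/funext => n; apply/funext => w; rewrite (fourier_int_refl2 w (ti n)).
Qed.

Lemma fourier_adj f g : L2 f -> L2 g -> ip mu2 (fourier f) g = ip mu2 f (ifourier g).
Proof.
move=> Lf Lg.
have ti n := cint_truncate n Lf; have Lt n := L2_truncate n Lf.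
have si n := cint_truncate n Lg; have Ls n := L2_truncate n Lg.
have LFt n : L2 (fourier_int (truncate n f)).
  by have [] := fourier_int_contraction (ti n) (Lt n).
have LFs n : L2 (fourier_int (truncate n g)).
  by have [] := fourier_int_contraction (si n) (Ls n).
have iE m : ifourier_int (truncate m g) = refl2 (fourier_int (truncate m g)).
  by apply/funext => x; rewrite ifourier_intE.
have Lis m : L2 (ifourier_int (truncate m g)) by rewrite iE; exact: L2_refl2.
have cF := cvgL2_fourier Lt ti Lf (cvgL2_truncate Lf).
(* While g is truncated its inverse transform is a genuine integral, so the limit in f can be taken
   first, and the limit in g afterwards. *)
have step m : ip mu2 (fourier f) (truncate m g) = ip mu2 f (ifourier_int (truncate m g)).
  apply: (@ccvg_uniq _ (fun n => ip mu2 (fourier_int (truncate n f)) (truncate m g))).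
    exact: (cvgL2_ip LFt (L2_fourier Lf) (Ls m) cF).
  rewrite (_ : (fun n => _) =
      (fun n => ip mu2 (truncate n f) (ifourier_int (truncate m g)))); last first.
    by apply/funext => n; exact: (fourier_int_adj (ti n) (si m)).
  exact: (cvgL2_ip Lt Lf (Lis m) (cvgL2_truncate Lf)).
apply: (@ccvg_uniq _ (fun m => ip mu2 (fourier f) (truncate m g))).
  exact: (cvgL2_ipr Ls Lg (L2_fourier Lf) (cvgL2_truncate Lg)).
rewrite (funext step).
apply: (cvgL2_ipr Lis (L2_ifourier Lg) Lf).
rewrite (funext iE).
exact: (cvgL2_refl2 LFs (L2_fourier Lg) (cvgL2_fourier Ls si Lg (cvgL2_truncate Lg))).
Qed.

Lemma ip_fourier_crect f (a b c d : R) : a < b -> c < d -> L2 f ->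
  ip mu2 (fourier f) (fourier_int (crect a b c d)) = ip mu2 f (crect a b c d).
Proof.
move=> ab cd Lf.
have ti n := cint_truncate n Lf; have Lt n := L2_truncate n Lf.
have LFt n : L2 (fourier_int (truncate n f)).
  by have [] := fourier_int_contraction (ti n) (Lt n).
have [LFr _] := fourier_int_contraction (cint_crect a b c d) (L2_crect a b c d).
apply: (@ccvg_uniq _ (fun n => ip mu2 (fourier_int (truncate n f)) (fourier_int (crect a b c d)))).
  exact: (cvgL2_ip LFt (L2_fourier Lf) LFr (cvgL2_fourier Lt ti Lf (cvgL2_truncate Lf))).
rewrite (_ : (fun n => _) = (fun n => ip mu2 (truncate n f) (crect a b c d))); last first.
  by apply/funext => n; exact: (fourier_int_crect ab cd (ti n) (Lt n)).
exact: (cvgL2_ip Lt Lf (L2_crect a b c d) (cvgL2_truncate Lf)).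
Qed.

(** By adjointness the pairing of the left side with a rectangle is the pairing of the two
    transforms, which [ip_fourier_crect] identifies with that of f and the rectangle; rectangles
    separate L^2. *)
Lemma fourierK f : L2 f -> {ae mu2, forall x, ifourier (fourier f) x = f x}.
Proof.
move=> Lf; have LF := L2_fourier Lf; have LI := L2_ifourier LF.
suff : {ae mu2, forall x, ifourier (fourier f) x - f x = 0}.
  by apply: aeS => x /eqP; rewrite subr_eq0 => /eqP.
apply: (L2_rects_eq0 (L2B LI Lf)) => a b c d ab cd.
have Lr := L2_crect a b c d.
rewrite (ipBl LI Lf Lr); apply/eqP; rewrite subr_eq0; apply/eqP.
rewrite (ipC Lr LI) -(fourier_adj Lr LF) -(ipC (L2_fourier Lr) LF).
rewrite -(ip_fourier_crect ab cd Lf).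
have [mF _] := LF; have [mr _] := L2_fourier Lr.
have [[mr' _] _] := fourier_int_contraction (cint_crect a b c d) Lr.
apply: (ae_eq_ip mF mr mF mr'); first exact: aeW.
exact: (fourier_fourier_int Lr (cint_crect a b c d)).
Qed.

Lemma ifourierK f : L2 f -> {ae mu2, forall w, fourier (ifourier f) w = f w}.
Proof.
move=> Lf; have LF := L2_fourier Lf.
by apply: aeS2 (fourier_refl2 LF) (fourierK Lf) => w; rewrite ifourierE => -> <-.
Qed.

Lemma Plancherel f g : L2 f -> L2 g -> ip mu2 (fourier f) (fourier g) = ip mu2 f g.
Proof.
move=> Lf Lg; rewrite (fourier_adj Lf (L2_fourier Lg)).
have [mf _] := Lf; have [mg _] := Lg; have [mi _] := L2_ifourier (L2_fourier Lg).
by apply: (ae_eq_ip mf mi mf mg); [exact: aeW|exact: fourierK].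
Qed.

Lemma sqn_fourier f : L2 f -> sqn mu2 (fourier f) = sqn mu2 f.
Proof.
move=> Lf; rewrite (sqnE Lf) (sqnE (L2_fourier Lf)); congr EFin.
have := Plancherel Lf Lf; rewrite !ipxx => H; by case: H.
Qed.

Lemma sqn_ifourier f : L2 f -> sqn mu2 (ifourier f) = sqn mu2 f.
Proof.
move=> Lf; rewrite ifourierE sqn_refl2 ?sqn_fourier//.
by case: (L2_fourier Lf).
Qed.

(** Adjointness moves the transform onto a test rectangle, where the claim is the linearity of the
    inner product. Equality holds almost everywhere only, each transform being a chosen
    representative. *)
Lemma fourierD f g (c : C) : L2 f -> L2 g ->
  {ae mu2, forall w, fourier (fun x => f x + c * g x) w = fourier f w + c * fourier g w}.
Proof.
move=> Lf Lg; have LF := L2_fourier Lf; have LG := L2_fourier Lg.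
have Lfg := L2D Lf (L2Z c Lg); have LFG := L2D LF (L2Z c LG).
have H := L2B (L2_fourier Lfg) LFG.
suff : {ae mu2, forall w, fourier (fun x => f x + c * g x) w - (fourier f w + c * fourier g w) = 0}.
  by apply: aeS => w /eqP; rewrite subr_eq0 => /eqP.
apply: (L2_rects_eq0 H) => a b a' b' _ _.
have Lr := L2_crect a b a' b'.
rewrite (ipBl (L2_fourier Lfg) LFG Lr) (ipDl LF (L2Z c LG) Lr) (ipZl c LG Lr).
have Li := L2_ifourier Lr.
have E : ip mu2 (fun x => f x + c * g x) (ifourier (crect a b a' b')) =
    ip mu2 f (ifourier (crect a b a' b')) + c * ip mu2 g (ifourier (crect a b a' b')).
  by rewrite (ipDl Lf (L2Z c Lg) Li) (ipZl c Lg Li).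
apply/eqP; rewrite subr_eq0; apply/eqP.
apply: (etrans (fourier_adj Lfg Lr)); apply: (etrans E).
exact: esym (f_equal2 (fun y z => y + c * z) (fourier_adj Lf Lr) (fourier_adj Lg Lr)).
Qed.

End Plancherel.

(** * Shearlets and the tight frame *)

Section Shearlets.
Context {R : realType}.
Local Notation C := R[i].
Local Notation R2 := (R * R)%type.
Local Notation plane := (measurableTypeR R * measurableTypeR R)%type.
Local Notation mu := (@lebesgue_measure R).
Local Notation mu2 := (@mu2 R).
Local Notation L2 := (isL2 mu2).
Local Opaque fourier fourier_int.
Implicit Types f g h psi : R2 -> C.

(** [powR] with exponent -1 is the inverse on nonnegative reals; writing 1 / x as x / x^2 reduces to
    them, and at 0 both sides are 0. *)
Lemma measurable_inv : measurable_fun [set: R] (fun x : R => x^-1).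
Proof.
have -> : (fun x : R => x^-1) = (fun x => x * (x ^+ 2) `^ (-1)).
  apply/funext => x; rewrite powR_inv1 ?sqr_ge0//.
  have [->|x0] := eqVneq x 0; first by rewrite invr0 mul0r.
  by field.
apply: measurable_funM => //.
by apply: (@measurableT_comp _ _ _ _ _ _ (fun y : R => y `^ (-1)) _ (fun x : R => x ^+ 2));
  [exact: measurable_powR|exact: measurable_funX].
Qed.

Section Dilation.
Context (a s : R) (t : R2) (a0 : 0 < a).

Let r := a `^ (1 / 2).
Let r0 : 0 < r. Proof. exact: powR_gt0. Qed.
Let rr : r * r = a.
Proof. by rewrite /r -powRD ?gt_eqF ?implybT// -splitr powRr1// ltW. Qed.

Lemma sqrt_powR : Num.sqrt a = a `^ (1 / 2).
Proof. by rewrite mul1r powR12_sqrt// ltW. Qed.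

Definition dilmap : R2 -> R2 :=
  affine a^-1 (s / a) r^-1 (- (t.1 + s * t.2) / a) (- t.2 / r).

Let jd : `|a^-1 * r^-1|^-1 = a * r.
Proof. by rewrite gtr0_norm ?mulr_gt0 ?invr_gt0// invfM !invrK. Qed.

Lemma scales_dilmap : scales dilmap (a * r).
Proof. by rewrite -jd; apply: scales_affine; rewrite invr_eq0 gt_eqF. Qed.

Lemma dilateE psi : dilate psi a s t = (fun x => (a `^ (- (3 / 4)))%:C%C * psi (dilmap x)).
Proof.
apply/funext => x; rewrite /dilate /dilmap /affine; congr (_ * psi (_, _)).
  by field; rewrite gt_eqF.
by rewrite -/r; field; rewrite gt_eqF.
Qed.

Let pD p q : a `^ p * a `^ q = a `^ (p + q).
Proof. by rewrite powRD// (gt_eqF a0) implybT. Qed.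

Let arE : a * r = a `^ (3 / 2).
Proof. by rewrite -{1}(powRr1 (ltW a0)) pD; congr powR; field. Qed.

(** The reason for the exponent -3/4 of the dilation: [dilmap] scales integrals by a^(3/2), so the
    dilation is an isometry. *)
Lemma powR34 : (a `^ (- (3 / 4))) ^+ 2 * (a * r) = 1.
Proof. by rewrite arE expr2 !pD (_ : _ + _ = 0) ?powRr0//; field. Qed.

Lemma sqn_dilate psi : cmeasurable [set: plane] psi -> sqn mu2 (dilate psi a s t) = sqn mu2 psi.
Proof.
move=> mp; rewrite dilateE sqnZ; last exact: (scales_cmeas scales_dilmap mp).
rewrite (scales_sqn scales_dilmap mp) muleA -EFinM cabsR.
by rewrite real_normK ?num_real// powR34 mul1e.
Qed.

Lemma L2_dilate psi : L2 psi -> L2 (dilate psi a s t).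
Proof.
by move=> Lp; rewrite dilateE; apply: L2Z; exact: (scales_L2 scales_dilmap Lp).
Qed.

(** The transpose of the inverse of the linear part of [dilmap], written with [Num.sqrt] to match
    [shear_int]. *)
Definition freqmap (xi : R2) : R2 := (a * xi.1, Num.sqrt a * (xi.2 - s * xi.1)).

Lemma freqmapE : freqmap = shear a (- (r * s)) r.
Proof.
by apply/funext => xi; rewrite /freqmap /shear sqrt_powR; congr (_, _); rewrite -/r; ring.
Qed.

Lemma scales_freqmap : scales freqmap (a * r)^-1.
Proof.
rewrite freqmapE -[(a * r)^-1](_ : `|a * r|^-1 = _).
  by apply: scales_shear; rewrite gt_eqF.
by rewrite gtr0_norm ?mulr_gt0.
Qed.

Definition freqdil h (xi : R2) : C :=
  (a `^ (3 / 4))%:C%C * cis (- (2 * pi * dot2 t xi)) * h (freqmap xi).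

Lemma cmeas_cis_dot : cmeasurable [set: plane] (fun xi => cis (- (2 * pi * dot2 t xi)) : C).
Proof.
apply: cmeas_cis; apply: measurableT_comp => //; apply: measurable_funM => //.
exact: measurable_dot2r.
Qed.

Lemma cmeas_freqdil h : cmeasurable [set: plane] h -> cmeasurable [set: plane] (freqdil h).
Proof.
move=> mh; apply: cmeasM; last exact: (scales_cmeas scales_freqmap mh).
by apply: cmeasM; [exact: cmeas_cst|exact: cmeas_cis_dot].
Qed.

Lemma powR34' : (a `^ (3 / 4)) ^+ 2 = a * r.
Proof. by rewrite arE expr2 pD; congr powR; field. Qed.

Lemma sqn_freqdil h : cmeasurable [set: plane] h -> sqn mu2 (freqdil h) = sqn mu2 h.
Proof.
move=> mh; have -> : sqn mu2 (freqdil h) =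
    sqn mu2 (fun xi => (a `^ (3 / 4))%:C%C * h (freqmap xi)).
  by apply: eq_sqn => xi; rewrite /freqdil !cabsM cabs_cis mulr1.
rewrite sqnZ; last exact: (scales_cmeas scales_freqmap mh).
rewrite (scales_sqn scales_freqmap mh) muleA -EFinM cabsR.
rewrite real_normK ?num_real// powR34' divff ?mul1e// gt_eqF// mulr_gt0//.
Qed.

Lemma L2_freqdil h : L2 h -> L2 (freqdil h).
Proof. by move=> [mh lh]; split; [exact: cmeas_freqdil|rewrite sqn_freqdil]. Qed.

Lemma cint_dilate psi : cintegrable mu2 setT psi -> cintegrable mu2 setT (dilate psi a s t).
Proof.
move=> ip; rewrite dilateE; apply: (cintZ measurableT).
by have [] := scales_cint scales_dilmap ip.
Qed.

Lemma fourier_int_dilate psi xi : cintegrable mu2 setT psi ->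
  fourier_int (dilate psi a s t) xi = freqdil (fourier_int psi) xi.
Proof.
move=> ip; have H := fourier_int_int (freqmap xi) ip.
have [iH E] := scales_cint scales_dilmap H.
pose c : C := (a `^ (- (3 / 4)))%:C%C * cis (- (2 * pi * dot2 t xi)).
have -> : fourier_int (dilate psi a s t) xi = c * cintegral mu2 setT
    ((fun x => psi x * cis (- (2 * pi * dot2 x (freqmap xi)))) \o dilmap).
  rewrite -(cintegralZ measurableT c iH); apply: eq_cintegral => x _.
  rewrite dilateE /c /= mulrACA -cisD; congr (_ * cis _).
  rewrite /dilmap /affine /freqmap /dot2 /= sqrt_powR -/r.
  by field; rewrite !gt_eqF.
rewrite E /freqdil mulrA; congr (_ * _).
rewrite /c mulrAC -RtoCM; congr (_%:C%C * _).
by rewrite arE pD; congr powR; field.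
Qed.

(** The formula is exact for integrable functions. It passes to L^2 along the dilates of the
    truncations, since the dilation and its counterpart [freqdil] both preserve the norm. *)
Lemma fourier_dilate psi : L2 psi ->
  {ae mu2, forall xi, fourier (dilate psi a s t) xi = freqdil (fourier psi) xi}.
Proof.
move=> Lp.
have ti n := cint_truncate n Lp; have Lt n := L2_truncate n Lp.
have LFt n : L2 (fourier_int (truncate n psi)).
  by have [] := fourier_int_contraction (ti n) (Lt n).
have [mp _] := Lp; have [mF _] := L2_fourier Lp.
apply: (@fourier_uniq _ (fun n => dilate (truncate n psi) a s t)).
- by move=> n; exact: (L2_dilate (Lt n)).
- by move=> n; exact: (cint_dilate (ti n)).
- exact: (L2_dilate Lp).
- have H := cvgL2_truncate Lp; rewrite /cvgL2.
  rewrite (_ : (fun n => _) = (fun n => sqn mu2 (fun x => truncate n psi x - psi x))); first exact: H.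
  apply/funext => n; have [mt _] := Lt n.
  rewrite -(sqn_dilate (cmeasB mt mp)); apply: eq_sqn => x.
  by rewrite /dilate -mulrBr.
- exact: (L2_freqdil (L2_fourier Lp)).
- have H := cvgL2_fourier Lt ti Lp (cvgL2_truncate Lp); rewrite /cvgL2.
  rewrite (_ : (fun n => _) =
    (fun n => sqn mu2 (fun x => fourier_int (truncate n psi) x - fourier psi x))); first exact: H.
  apply/funext => n; have [mt _] := LFt n.
  rewrite -(sqn_freqdil (cmeasB mt mF)); apply: eq_sqn => x.
  by rewrite (fourier_int_dilate x (ti n)) /freqdil -mulrBr.
Qed.

(* The integrand whose inverse Fourier integral is t |-> SH psi f a s t. *)
Definition shear_freq psi f (xi : R2) : C :=
  (a `^ (3 / 4))%:C%C * (fourier f xi * (fourier psi (freqmap xi))^*%C).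

Lemma cint_shear_freq psi f : L2 psi -> L2 f -> cintegrable mu2 setT (shear_freq psi f).
Proof.
move=> Lp Lf; apply: (cintZ measurableT).
exact: (ip_int (L2_fourier Lf) (scales_L2 scales_freqmap (L2_fourier Lp))).
Qed.

(** Plancherel. The product of two L^2 functions is integrable, so this is an honest integral and
    the identity holds at every t, although the transform of the dilate is known almost everywhere
    only. *)
Lemma SHE psi f : L2 psi -> L2 f -> SH psi f a s t = ifourier_int (shear_freq psi f) t.
Proof.
move=> Lp Lf; have LD := L2_dilate Lp.
have [mF _] := L2_fourier Lf; have [mG _] := L2_fourier LD.
have [mH _] := L2_fourier Lp.
transitivity (ip mu2 (fourier f) (fourier (dilate psi a s t))).
  exact: (esym (Plancherel Lf LD)).
have -> : ip mu2 (fourier f) (fourier (dilate psi a s t)) =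
    ip mu2 (fourier f) (freqdil (fourier psi)).
  apply: (ae_eq_ip mF mG mF (cmeas_freqdil mH)); first exact: aeW.
  exact: (fourier_dilate Lp).
apply: eq_cintegral => xi _; rewrite /freqdil /shear_freq.
by apply: complex_eqP; rewrite !ReImE /= cosN sinN; ring.
Qed.

End Dilation.

End Shearlets.

(** * The orthogonal projection onto the cone space *)

Section ConeProjection.
Context {R : realType}.
Local Notation C := R[i].
Local Notation R2 := (R * R)%type.
Local Notation plane := (measurableTypeR R * measurableTypeR R)%type.
Local Notation mu2 := (@mu2 R).
Local Notation L2 := (isL2 mu2).
Local Opaque fourier fourier_int.
Implicit Types f g h k : R2 -> C.
Context (u v : R).
Local Notation cone := (cone u v).

Lemma measurable_cone : measurable (cone : set plane).
Proof.
have -> : (cone : set plane) = [set x | u <= `|x.1|] `&` [set x | `|x.2| <= v * `|x.1|] by [].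
have m1 : measurable_fun [set: plane] (fun x => `|x.1|).
  exact: (measurableT_comp (@normr_measurable _ setT) measurable_fst).
have m2 : measurable_fun [set: plane] (fun x => `|x.2|).
  exact: (measurableT_comp (@normr_measurable _ setT) measurable_snd).
apply: measurableI.
  rewrite (_ : [set _ | _] = (fun x : plane => `|x.1|) @^-1` `[u, +oo[); last first.
    by apply/seteqP; split => x /=; rewrite in_itv /= andbT.
  by rewrite -[X in measurable X]setTI; exact: m1.
rewrite (_ : [set _ | _] = (fun x : plane => v * `|x.1| - `|x.2|) @^-1` `[0, +oo[); last first.
  by apply/seteqP; split => x /=; rewrite in_itv /= andbT subr_ge0.
rewrite -[X in measurable X]setTI; apply: measurable_funB => //.
exact: measurable_funM.
Qed.

Definition cind (xi : R2) : C := (\1_cone xi)%:C%C.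

Lemma cindT xi : cone xi -> cind xi = 1.
Proof. by move=> H; rewrite /cind indicE mem_set. Qed.

Lemma cindF xi : ~ cone xi -> cind xi = 0.
Proof. by move=> H; rewrite /cind indicE memNset. Qed.

Lemma cind_idem xi : cind xi * cind xi = cind xi.
Proof.
have [cx|cx] := pselect (cone xi); first by rewrite (cindT cx) mulr1.
by rewrite (cindF cx) mulr0.
Qed.

Lemma cmeas_cind : cmeasurable [set: plane] cind.
Proof. by apply: cmeasR; apply: measurable_indic; exact: measurable_cone. Qed.

Lemma cind_le1 xi : cabs (cind xi) <= 1.
Proof.
rewrite /cind cabsR indicE; case: (_ \in _) => /=; by rewrite ?normr1 ?normr0.
Qed.

Lemma L2_cind g : L2 g -> L2 (fun xi => g xi * cind xi).
Proof. by move=> Lg; exact: (L2Mb Lg cmeas_cind cind_le1). Qed.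

Lemma L2coneP f : L2cone u v f <-> L2 f /\ {ae mu2, forall xi, fourier f xi = fourier f xi * cind xi}.
Proof.
split=> -[Lf H]; (split; first exact: Lf).
  apply: aeS H => xi H; have [cx|cx] := pselect (cone xi).
    by rewrite (cindT cx) mulr1.
  by rewrite (H cx) mul0r.
apply: aeS H => xi H cx.
by rewrite H (cindF cx) mulr0.
Qed.

Lemma L2cone_lin f g (c : C) : L2cone u v f -> L2cone u v g ->
  L2cone u v (fun x => f x + c * g x).
Proof.
have alg (X y z b l : C) : X = y + b * z -> y = y * l -> z = z * l -> X = X * l.
  by move=> -> Hy Hz; rewrite mulrDl -mulrA -Hy -Hz.
move=> /L2coneP[Lf Hf] /L2coneP[Lg Hg]; apply/L2coneP.
split; first exact: (L2D Lf (L2Z c Lg)).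
have H := aeS2 (fun x p q => conj p q) Hf Hg.
apply: aeS2 (fourierD c Lf Lg) H => xi E [E1 E2].
exact: (alg _ _ _ _ _ E E1 E2).
Qed.

(** The witness that the choice made by [orthproj] ranges over a nonempty set. *)
Definition coneproj g : R2 -> C := ifourier (fun xi => fourier g xi * cind xi).

Lemma L2_coneproj g : L2 g -> L2 (coneproj g).
Proof. by move=> Lg; exact: (L2_ifourier (L2_cind (L2_fourier Lg))). Qed.

Lemma fourier_coneproj g : L2 g ->
  {ae mu2, forall xi, fourier (coneproj g) xi = fourier g xi * cind xi}.
Proof. by move=> Lg; exact: (ifourierK (L2_cind (L2_fourier Lg))). Qed.

Lemma coneproj_cone g : L2 g -> L2cone u v (coneproj g).
Proof.
move=> Lg; apply/L2coneP; split; first exact: L2_coneproj.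
apply: aeS (fourier_coneproj Lg) => xi ->.
by rewrite -mulrA cind_idem.
Qed.

(** On the Fourier side the indicator is real, so it passes to the other factor, where the transform
    of k absorbs it. *)
Lemma coneproj_orth g k : L2 g -> L2cone u v k -> ip mu2 (fun x => g x - coneproj g x) k = 0.
Proof.
have alg (A B : C) (c : R) : A * (B * c%:C%C)^*%C = A * c%:C%C * B^*%C.
  by apply: complex_eqP; rewrite !ReImE /=; ring.
move=> Lg /L2coneP[Lk Hk]; have Lp := L2_coneproj Lg.
rewrite (ipBl Lg Lp Lk).
have LF := L2_fourier Lg; have LP := L2_fourier Lp; have LK := L2_fourier Lk.
have E1 : ip mu2 (fourier g) (fourier k) = ip mu2 (fourier (coneproj g)) (fourier k).
  have [mF _] := LF; have [mP _] := LP; have [mK _] := LK.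
  have Hc := fourier_coneproj Lg.
  transitivity (ip mu2 (fun xi => fourier g xi * cind xi) (fourier k)); last first.
    apply: (ae_eq_ip (cmeasM mF cmeas_cind) mK mP mK); last exact: aeW.
    by apply: aeS Hc => xi ->.
  transitivity (ip mu2 (fourier g) (fun xi => fourier k xi * cind xi)).
    by apply: (ae_eq_ip mF mK mF (cmeasM mK cmeas_cind)); [exact: aeW|exact: Hk].
  apply: eq_cintegral => xi _; exact: alg.
have E2 := Plancherel Lg Lk; have E3 := Plancherel Lp Lk.
apply/eqP; rewrite subr_eq0; apply/eqP.
exact: (etrans (esym E2) (etrans E1 E3)).
Qed.

Lemma PconeP g : L2 g -> L2cone u v (Pcone u v g) /\
  forall k, L2cone u v k -> dot (fun x => g x - Pcone u v g x) k = 0.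
Proof.
move=> Lg.
have : exists h, L2cone u v h /\ forall k, L2cone u v k -> dot (fun x => g x - h x) k = 0.
  exists (coneproj g); split; first exact: coneproj_cone.
  by move=> k Hk; exact: (coneproj_orth Lg Hk).
by move=> /(xgetPex (fun=> 0)).
Qed.

Lemma Pcone_cone g : L2 g -> L2cone u v (Pcone u v g).
Proof. by move=> /PconeP[]. Qed.

Lemma L2_Pcone g : L2 g -> L2 (Pcone u v g).
Proof. by move=> /Pcone_cone[]. Qed.

Lemma ip_Pcone g k : L2 g -> L2cone u v k -> ip mu2 (Pcone u v g) k = ip mu2 g k.
Proof.
move=> Lg Hk; have [_ /(_ k Hk) H] := PconeP Lg.
have /L2coneP[Lk _] := Hk.
have := ipBl Lg (L2_Pcone Lg) Lk; rewrite (_ : ip mu2 _ k = 0); last exact: H.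
by move/eqP; rewrite eq_sym subr_eq0 => /eqP.
Qed.

(** The difference of the two projections lies in the cone space and is orthogonal to it, hence has
    norm 0. *)
Lemma Pcone_coneproj g : L2 g -> {ae mu2, forall x, Pcone u v g x = coneproj g x}.
Proof.
move=> Lg; have LP := L2_Pcone Lg; have Lc := L2_coneproj Lg.
have HP := Pcone_cone Lg; have Hc := coneproj_cone Lg.
pose d (x : R2) : C := Pcone u v g x + (-1) * coneproj g x.
have Hd : L2cone u v d := L2cone_lin (-1) HP Hc.
have /L2coneP[Ld _] := Hd.
have E : ip mu2 d d = 0.
  rewrite {1}/d (ipDl LP (L2Z (-1) Lc) Ld) (ipZl (-1) Lc Ld).
  rewrite (ip_Pcone Lg Hd).
  have := coneproj_orth Lg Hd; rewrite (ipBl Lg Lc Ld) => /eqP.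
  by rewrite subr_eq0 => /eqP ->; ring.
have {}E : sqn mu2 d = 0%E.
  by rewrite (sqnE Ld); move: E; rewrite ipxx => -[->].
have [md _] := Ld.
apply: aeS (sqn0_ae md E) => x /eqP; rewrite /d mulN1r subr_eq0 => /eqP; exact.
Qed.

Lemma fourier_Pcone g : L2 g ->
  {ae mu2, forall xi, fourier (Pcone u v g) xi = fourier g xi * cind xi}.
Proof.
move=> Lg; have [mP _] := L2_Pcone Lg; have [mc _] := L2_coneproj Lg.
rewrite (eq_fourier mP mc (Pcone_coneproj Lg)); exact: fourier_coneproj.
Qed.

End ConeProjection.

Lemma integral_indicl {R : realType} d (T : measurableType d) (m : {measure set T -> \bar R})
    (D : set T) (h : T -> R) :
  (\int[m]_(x in D) (h x)%:E = \int[m]_x (\1_D x * h x)%:E)%E.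
Proof.
rewrite integral_mkcond; apply: eq_integral => x _.
by rewrite patchE indicE; case: ifPn => xD; rewrite ?mul1r ?mul0r.
Qed.

(** * The norm of the shearlet coefficients *)

Section FrameIdentity.
Context {R : realType}.
Local Notation C := R[i].
Local Notation R2 := (R * R)%type.
Local Notation plane := (measurableTypeR R * measurableTypeR R)%type.
Local Notation mu := (@lebesgue_measure R).
Local Notation mu2 := (@mu2 R).
Local Notation L2 := (isL2 mu2).
Local Opaque fourier fourier_int.
Context (Gamma Xi : R).
Implicit Types f g h psi : R2 -> C.

Lemma sqn_ifourier_int g : cintegrable mu2 setT g -> L2 g ->
  sqn mu2 (ifourier_int g) = sqn mu2 g.
Proof.
move=> ig Lg; have [LF _] := fourier_int_contraction ig Lg.
have [mF _] := LF; have [mf _] := L2_fourier Lg.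
rewrite -(sqn_fourier Lg).
rewrite (ae_eq_sqn mf mF (fourier_fourier_int Lg ig)) -(sqn_refl2 mF).
by apply: eq_sqn => x; rewrite ifourier_intE.
Qed.

(** [Delta] integrates over this open region while [params] is built on the closed one, [cregion];
    by [ae_region] they differ by a null set. *)
Definition region : set R2 := [set q | (0 < q.1 < Gamma)%R /\ (`|q.2| < Xi)%R].
Definition cregion : set R2 := [set q | (0 < q.1 <= Gamma)%R /\ (`|q.2| <= Xi)%R].

Lemma measurable_region : measurable (region : set plane).
Proof.
rewrite (_ : region = `]0, Gamma[%classic `*` `]- Xi, Xi[%classic).
  exact: measurableX.
by apply/seteqP; split => q /=; rewrite /region /= !in_itv /= ltr_norml.
Qed.

Lemma measurable_cregion : measurable (cregion : set plane).
Proof.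
rewrite (_ : cregion = `]0, Gamma]%classic `*` `[- Xi, Xi]%classic).
  exact: measurableX.
by apply/seteqP; split => q /=; rewrite /cregion /= !in_itv /= ler_norml.
Qed.

Lemma paramsE : (params Gamma Xi : set (plane * plane)) = (cregion : set plane) `*` setT.
Proof. by apply/seteqP; split => p /=; rewrite /params /cregion /=; tauto. Qed.

Lemma measurable_params : measurable (params Gamma Xi : set (plane * plane)).
Proof. by rewrite paramsE; apply: measurableX => //; exact: measurable_cregion. Qed.

Lemma ae_region : {ae mu2, forall q : R2, cregion q -> region q}.
Proof.
apply: aeS2 (aeS2 (fun x p q => conj p q) (ae_coord1 Gamma) (ae_coord2 Xi)) (ae_coord2 (- Xi)) => q.
move=> [q1 q2] q3 [/andP[a0 aG] sX]; split; rewrite ?a0 lt_neqAle ?q1//= sX andbT.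
by rewrite eqr_norml negb_and negb_or q2 q3.
Qed.

Lemma measurable_freqmap2 :
  measurable_fun [set: (plane * plane)%type] (fun z => freqmap z.1.1 z.1.2 z.2 : plane).
Proof.
have m11 : measurable_fun [set: (plane * plane)%type] (fun z => z.1.1 : R).
  exact: (measurableT_comp measurable_fst measurable_fst).
have m12 : measurable_fun [set: (plane * plane)%type] (fun z => z.1.2 : R).
  exact: (measurableT_comp measurable_snd measurable_fst).
have m21 : measurable_fun [set: (plane * plane)%type] (fun z => z.2.1 : R).
  exact: (measurableT_comp measurable_fst measurable_snd).
have m22 : measurable_fun [set: (plane * plane)%type] (fun z => z.2.2 : R).
  exact: (measurableT_comp measurable_snd measurable_snd).
have ms : measurable_fun [set: R] (@Num.sqrt R).
  by apply: continuous_measurable_fun; exact: sqrt_continuous.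
apply: measurable_fun_pair; first exact: measurable_funM.
apply: measurable_funM; first exact: (measurableT_comp ms m11).
by apply: measurable_funB => //; exact: measurable_funM.
Qed.

Section Coefficients.
Context (psi f : R2 -> C) (Lpsi : L2 psi) (Lf : L2 f).

(** The shearlet transform as a partial integral of a function jointly measurable on the whole
    space, which makes it measurable in (a, s, t); it agrees with [SH] where a > 0. *)
Definition SHf (p : R2 * R2) : C := ifourier_int (shear_freq p.1.1 p.1.2 psi f) p.2.

Let m11 : measurable_fun [set: (plane * plane)%type] (fun z => z.1.1 : R).
Proof. exact: (measurableT_comp measurable_fst measurable_fst). Qed.

Lemma cmeas_shear_freq :
  cmeasurable [set: (plane * plane)%type] (fun z => shear_freq z.1.1 z.1.2 psi f z.2).
Proof.
have [mp _] := L2_fourier Lpsi; have [mf _] := L2_fourier Lf.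
apply: cmeasM.
  by apply: cmeasR; exact: (measurableT_comp (@measurable_powR _ _) m11).
apply: cmeasM; first exact: (cmeas_comp mf measurable_snd).
by apply: cmeasJ; exact: (cmeas_comp mp measurable_freqmap2).
Qed.

Lemma cmeas_SHf : cmeasurable [set: (plane * plane)%type] SHf.
Proof.
have H : cmeasurable [set: ((plane * plane) * plane)%type] (fun z =>
   shear_freq z.1.1.1 z.1.1.2 psi f z.2 * cis (2 * pi * dot2 z.1.2 z.2)).
  apply: cmeasM.
    apply: (cmeas_comp cmeas_shear_freq (h := fun z : (plane * plane) * plane => (z.1.1, z.2))).
    apply: measurable_fun_pair => //.
    exact: (measurableT_comp measurable_fst measurable_fst).
  apply: cmeas_cis; apply: measurable_funM => //.
  apply: (measurableT_comp measurable_dot2 (g := fun z : (plane * plane) * plane => (z.1.2, z.2))).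
  apply: measurable_fun_pair => //.
  exact: (measurableT_comp measurable_snd measurable_fst).
exact: (@cmeas_cintegral _ _ _ (plane * plane)%type plane mu2 _ H).
Qed.

Lemma SH_SHf p : params Gamma Xi p -> SH psi f p.1.1 p.1.2 p.2 = SHf p.
Proof. by move=> [/andP[a0 _] _]; exact: SHE. Qed.

Definition dens (z : R2 * R2) : R :=
  cabs (fourier psi (freqmap z.1.1 z.1.2 z.2)) ^+ 2 * z.1.1 `^ (- (3 / 2)).

Lemma dens_ge0 z : 0 <= dens z.
Proof. by rewrite /dens mulr_ge0 ?sqr_ge0 ?powR_ge0. Qed.

Lemma measurable_dens : measurable_fun [set: (plane * plane)%type] dens.
Proof.
have [mp _] := L2_fourier Lpsi; apply: measurable_funM.
  exact: (cmeas_cabs2 (cmeas_comp mp measurable_freqmap2)).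
exact: (measurableT_comp (@measurable_powR _ _) m11).
Qed.

(** The integrand over ((a, s), xi); [H] below is its counterpart over ((a, s), t). Plancherel in
    the second variable identifies their partial integrals at almost every (a, s). *)
Let K (z : R2 * R2) : R := \1_region z.1 * (cabs (fourier f z.2) ^+ 2 * dens z).

Let K_ge0 z : 0 <= K z.
Proof.
apply: mulr_ge0; first by rewrite indicE.
by apply: mulr_ge0; [exact: sqr_ge0|exact: dens_ge0].
Qed.

Let mK : measurable_fun [set: (plane * plane)%type] (EFin \o K).
Proof.
have [mf _] := L2_fourier Lf; apply/measurable_EFinP; apply: measurable_funM.
  apply: (measurableT_comp _ measurable_fst); apply: measurable_indic.
  exact: measurable_region.
apply: measurable_funM; last exact: measurable_dens.
exact: (cmeas_cabs2 (cmeas_comp mf measurable_snd)).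
Qed.

Let H (p : R2 * R2) : R := \1_(params Gamma Xi) p * (cabs (SHf p) ^+ 2 * p.1.1 ^- 3).

Let H_ge0 p : 0 <= H p.
Proof.
rewrite /H indicE; have [/set_mem|_] := boolP (p \in _); last by rewrite mul0r.
by move=> [/andP[a0 _] _]; rewrite mul1r mulr_ge0 ?sqr_ge0// invr_ge0 exprn_ge0// ltW.
Qed.

Let mH : measurable_fun [set: (plane * plane)%type] (EFin \o H).
Proof.
apply/measurable_EFinP; apply: measurable_funM.
  by apply: measurable_indic; exact: measurable_params.
apply: measurable_funM; first exact: (cmeas_cabs2 cmeas_SHf).
by apply: (measurableT_comp measurable_inv); exact: measurable_funX.
Qed.

Lemma integral_K1 (xi : R2) : (\int[mu2]_q (K (q, xi))%:E =
  (cabs (fourier f xi) ^+ 2)%:E * shear_int psi region xi)%E.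
Proof.
have m1 : measurable_fun [set: plane] (fun q => \1_region q * dens (q, xi)).
  apply: measurable_funM; first by apply: measurable_indic; exact: measurable_region.
  by apply: (measurableT_comp measurable_dens); exact: measurable_fun_pair.
have -> : shear_int psi region xi = (\int[mu2]_q (\1_region q * dens (q, xi))%:E)%E.
  exact: (integral_indicl mu2 region (fun q => dens (q, xi))).
rewrite -ge0_integralZl//.
- by apply: eq_integral => q _; rewrite -EFinM; congr EFin; rewrite /K /= mulrCA.
- exact/measurable_EFinP.
- by move=> q _; rewrite lee_fin mulr_ge0// dens_ge0.
- by rewrite lee_fin sqr_ge0.
Qed.

Lemma measurable_shear_int : measurable_fun [set: plane]
  (fun xi => (cabs (fourier f xi) ^+ 2)%:E * shear_int psi region xi)%E.
Proof.
under eq_fun do rewrite -integral_K1.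
apply: (@measurable_fun_fubini_tonelli_G _ _ plane plane R mu2 _ mK) => z.
by rewrite lee_fin K_ge0.
Qed.

Lemma integral_K2 (q : R2) : region q -> (\int[mu2]_xi (K (q, xi))%:E =
  (q.1 ^- 3)%:E * sqn mu2 (shear_freq q.1 q.2 psi f))%E.
Proof.
move=> rq; have [/andP[a0 _] _] := rq.
have ms : cmeasurable [set: plane] (shear_freq q.1 q.2 psi f).
  exact: (cintegrable_meas (cint_shear_freq q.2 a0 Lpsi Lf)).
have pD r s : q.1 `^ r * q.1 `^ s = q.1 `^ (r + s).
  by rewrite powRD// (gt_eqF a0) implybT.
rewrite -ge0_integralZl//; last 3 first.
- exact: mcabs2.
- by move=> x _; rewrite lee_fin sqr_ge0.
- by rewrite lee_fin invr_ge0 exprn_ge0// ltW.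
apply: eq_integral => xi _; rewrite -EFinM; congr EFin.
rewrite /K /= indicE mem_set// mul1r /dens /= /shear_freq !cabsM cabsJ cabsR.
rewrite !exprMn real_normK ?num_real// (powR34' a0).
(* The squared normalization a^(3/2) of the dilated transform, against the density a^-3, gives the
   density a^(-3/2) of [Delta]. *)
have -> : q.1 `^ (- (3 / 2)) = (q.1 * q.1 `^ (1 / 2)) * q.1 ^- 3.
  rewrite -{2}[q.1]powRr1 ?ltW// -powR_mulrn ?ltW// -powRN.
  by rewrite !pD; apply: (congr1 (powR q.1)); field.
ring.
Qed.

Lemma integral_H2 (q : R2) : cregion q -> (\int[mu2]_t (H (q, t))%:E =
  (q.1 ^- 3)%:E * sqn mu2 (ifourier_int (shear_freq q.1 q.2 psi f)))%E.
Proof.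
move=> cq; have [/andP[a0 _] _] := cq.
have mS : cmeasurable [set: plane] (ifourier_int (shear_freq q.1 q.2 psi f)).
  apply: (cmeas_comp cmeas_SHf (h := fun t : plane => (q, t))); exact: measurable_fun_pair.
rewrite -ge0_integralZl//; last 3 first.
- exact: mcabs2.
- by move=> x _; rewrite lee_fin sqr_ge0.
- by rewrite lee_fin invr_ge0 exprn_ge0// ltW.
apply: eq_integral => t _; rewrite -EFinM; congr EFin.
by rewrite /H indicE mem_set//= mul1r mulrC.
Qed.

(** Tonelli on both sides of Plancherel in t. Plancherel asks for [shear_freq] in L^2, which
    integrability does not give; the bound c makes the total integral of [K] finite, hence its
    partial integrals finite for almost every (a, s). *)
Lemma SH_sqn (c : R) : (forall xi : R2, xi.1 != 0 -> (shear_int psi region xi <= c%:E)%E) ->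
  (\int[mu4]_(p in params Gamma Xi)
     (cabs (SH psi f p.1.1 p.1.2 p.2) ^+ 2 * p.1.1 ^- 3)%:E =
   \int[mu2]_xi ((cabs (fourier f xi) ^+ 2)%:E * shear_int psi region xi))%E.
Proof.
move=> Hc.
have swapK : (\int[mu2]_q \int[mu2]_xi (K (q, xi))%:E =
    \int[mu2]_xi ((cabs (fourier f xi) ^+ 2)%:E * shear_int psi region xi))%E.
  under [RHS]eq_integral do rewrite -integral_K1.
  apply: (@fubini_tonelli _ _ plane plane R mu2 mu2 _ mK) => z.
  by rewrite lee_fin K_ge0.
have mG : measurable_fun [set: plane] (fun q => \int[mu2]_xi (K (q, xi))%:E)%E.
  apply: (@measurable_fun_fubini_tonelli_F _ _ plane plane R mu2 _ mK) => z.
  by rewrite lee_fin K_ge0.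
have mG1 : measurable_fun [set: plane] (fun q => \int[mu2]_t (H (q, t))%:E)%E.
  apply: (@measurable_fun_fubini_tonelli_F _ _ plane plane R mu2 _ mH) => z.
  by rewrite lee_fin H_ge0.
have finK : {ae mu2, forall q : R2, ((\int[mu2]_xi (K (q, xi))%:E)%E \is a fin_num)}.
  have iK : mu2.-integrable setT (fun q => \int[mu2]_xi (K (q, xi))%:E)%E.
    apply/integrableP; split; first exact: mG.
    have -> : (\int[mu2]_q `|\int[mu2]_xi (K (q, xi))%:E| =
               \int[mu2]_q \int[mu2]_xi (K (q, xi))%:E)%E.
      apply: eq_integral => q _; rewrite gee0_abs//.
      by apply: integral_ge0 => xi _; rewrite lee_fin K_ge0.
    rewrite swapK.
    have c0 : 0 <= c.
      rewrite -lee_fin; apply: le_trans (Hc (1, 0) _); last exact: oner_neq0.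
      by apply: integral_ge0 => q _; rewrite lee_fin (dens_ge0 (q, (1, 0))).
    have LFf := L2_fourier Lf.
    apply: (@le_lt_trans _ _ (\int[mu2]_xi (c%:E * (cabs (fourier f xi) ^+ 2)%:E))%E).
      apply: ae_ge0_le_integral => //.
      - move=> xi _; apply: mule_ge0; first by rewrite lee_fin sqr_ge0.
        by apply: integral_ge0 => q _; rewrite lee_fin (dens_ge0 (q, xi)).
      - exact: measurable_shear_int.
      - by move=> xi _; rewrite -EFinM lee_fin mulr_ge0 ?sqr_ge0.
      - apply/measurable_EFinP; apply: measurable_funM => //.
        by apply: cmeas_cabs2; have [] := LFf.
      - apply: aeS (ae_coord1 0) => xi x0 _; rewrite [leRHS]muleC.
        by apply: lee_wpmul2l; [rewrite lee_fin sqr_ge0|exact: Hc].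
    rewrite ge0_integralZl//.
    - by have [_ lF] := LFf; rewrite lte_mul_pinfty.
    - by apply: mcabs2; have [] := LFf.
    - by move=> xi _; rewrite lee_fin sqr_ge0.
  have := integrable_ae measurableT iK; apply: aeS => q; exact.
transitivity (\int[mu2]_q \int[mu2]_xi (K (q, xi))%:E)%E; last exact: swapK.
transitivity (\int[mu4]_p (H p)%:E)%E.
  rewrite integral_indicl; apply: eq_integral => p _; congr EFin; rewrite /H indicE.
  have [/set_mem/SH_SHf ->//|_] := boolP (p \in _); by rewrite !mul0r.
transitivity (\int[mu2]_q \int[mu2]_t (H (q, t))%:E)%E.
  apply: (@fubini_tonelli1 _ _ plane plane R mu2 mu2 _ mH) => z.
  by rewrite lee_fin H_ge0.
apply: ge0_ae_eq_integral => //.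
- by move=> q _; apply: integral_ge0 => t _; rewrite lee_fin H_ge0.
- by move=> q _; apply: integral_ge0 => t _; rewrite lee_fin K_ge0.
apply: aeS2 finK ae_region => q fq cr _.
have [cq|cq] := pselect (cregion q); last first.
  rewrite !integral0_eq// => x _; rewrite /K /H /= indicE memNset ?mul0r//.
    by move=> [/andP[a0 /ltW aG] /ltW s0]; apply: cq; split; rewrite ?a0.
have rq := cr cq; have [/andP[a0 _] _] := cq.
rewrite (integral_H2 cq) (integral_K2 rq); f_equal.
apply: sqn_ifourier_int; first exact: (cint_shear_freq q.2 a0 Lpsi Lf).
split; first exact: (cintegrable_meas (cint_shear_freq q.2 a0 Lpsi Lf)).
(* The partial integral is a^-3 times the squared norm with a^-3 > 0, so its finiteness excludes an
   infinite norm. *)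
move: fq; rewrite (integral_K2 rq).
have := sqn_ge0 mu2 (shear_freq q.1 q.2 psi f).
case: (sqn _ _) => [r _ _|_|]//; first exact: ltry.
by rewrite gt0_muley// lte_fin invr_gt0 exprn_gt0.
Qed.

End Coefficients.

End FrameIdentity.

Section Polarization.
Context {R : realType} d (T : measurableType d) (m : {measure set T -> \bar R}).
Local Notation C := R[i].
Implicit Types f g : T -> C.

Lemma n2DZ f g (z : C) : isL2 m f -> isL2 m g ->
  n2 m (fun x => f x + z * g x) =
  n2 m f + cabs z ^+ 2 * n2 m g + 2 * complex.Re (z^*%C * ip m f g).
Proof.
move=> Lf Lg; have Lz := L2Z z Lg; rewrite (n2D Lf Lz).
have -> : n2 m (fun x => z * g x) = cabs z ^+ 2 * n2 m g.
  by have [mg _] := Lg; rewrite /n2 (sqnZ m z mg) (sqnE Lg).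
rewrite (ipC Lz Lf) (ipZl z Lg Lf) (ipC Lf Lg).
by rewrite !ReImE /=; ring.
Qed.

(** z = 1 gives the real parts and z = i the imaginary parts. *)
Lemma eq_complex_Re (a b : C) :
  (forall z, complex.Re (z^*%C * a) = complex.Re (z^*%C * b)) -> a = b.
Proof.
move=> H; apply: complex_eqP; first by have := H 1; rewrite !ReImE /=; lra.
by have := H 'i%C; rewrite !ReImE /=; lra.
Qed.

Lemma eq_cmeasurable (D : set T) f g : (forall x, D x -> f x = g x) ->
  cmeasurable D f -> cmeasurable D g.
Proof.
move=> fg [mR mI]; split.
  by apply: (eq_measurable_fun _ _ mR) => x /set_mem Dx; rewrite /= (fg _ Dx).
by apply: (eq_measurable_fun _ _ mI) => x /set_mem Dx; rewrite /= (fg _ Dx).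
Qed.

Lemma cintegral_mkcond (D : set T) f g : measurable D ->
  (forall x, D x -> f x = g x) -> (forall x, ~ D x -> g x = 0) ->
  cintegrable m setT g ->
  cintegrable m D f /\ cintegral m D f = cintegral m setT g.
Proof.
move=> mD fg g0 [iR iI]; split.
  split; [have iS := iR | have iS := iI];
    have := integrableS measurableT mD (@subsetT _ _) iS;
    by apply: eq_integrable => // x /set_mem Dx; rewrite (fg _ Dx).
congr (_ +i* _)%C; rewrite Rintegral_mkcond; apply: eq_Rintegral => x _; rewrite patchE;
  by case: ifPn => [/set_mem/fg ->//|/negP xD]; rewrite g0// => Dx; apply: xD; exact: mem_set.
Qed.

End Polarization.

(** * The frame identity and the weak representation *)

Section TightFrame.
Context {R : realType}.
Local Notation C := R[i].
Local Notation R2 := (R * R)%type.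
Local Notation plane := (measurableTypeR R * measurableTypeR R)%type.
Local Notation mu2 := (@mu2 R).
Local Notation mu4 := (@mu4 R).
Local Notation L2 := (isL2 mu2).
Local Opaque fourier fourier_int.
Context (u v Gamma Xi c B : R) (psi What : R2 -> C).
Hypothesis (u0 : 0 < u) (c0 : 0 < c) (Lpsi : L2 psi).
Hypothesis Hc : forall xi : R2, xi.1 != 0 -> (shear_int psi (region Gamma Xi) xi <= c%:E)%E.
Hypothesis mW : cmeasurable [set: plane] What.
Hypothesis WB : forall xi, cabs (What xi) <= B.
Hypothesis HW : forall xi : R2,
  (Delta u v Gamma Xi psi xi + (cabs (What xi) ^+ 2)%:E = (c * \1_(cone u v) xi)%:E)%E.
Implicit Types f g h k : R2 -> C.

Lemma What_off_cone xi : ~ cone u v xi -> What xi = 0.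
Proof.
move=> nc; have := HW xi; rewrite /Delta indicE memNset// mul0e add0e mulr0 => -[/eqP].
by rewrite sqrf_eq0 => /eqP/cabs0_eq0.
Qed.

(** The equation defining W forces [What] to vanish off the cone, so the projected and the
    unprojected window coincide. *)
Lemma PWhatE : PWhat u v What = What.
Proof.
apply/funext => xi; rewrite /PWhat -/(cind u v xi).
have [cx|cx] := pselect (cone u v xi); first by rewrite (cindT cx) mul1r.
by rewrite (What_off_cone cx) mulr0.
Qed.

Let coef := translate_coef What.

Lemma L2_coef_freq f : L2 f -> L2 (fun xi => fourier f xi * (What xi)^*%C).
Proof.
move=> Lf; apply: (L2Mb (L2_fourier Lf) (cmeasJ mW) (B := B)) => xi.
by rewrite cabsJ.
Qed.

Lemma L2_coef f : L2 f -> L2 (coef f).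
Proof. by move=> Lf; exact: (L2_ifourier (L2_coef_freq Lf)). Qed.

Lemma coef_lin f g (z : C) : L2 f -> L2 g ->
  {ae mu2, forall t, coef (fun x => f x + z * g x) t = coef f t + z * coef g t}.
Proof.
have alg (p q r w : C) : p = q + z * r -> p * w = q * w + z * (r * w).
  by move=> ->; rewrite mulrDl mulrA.
move=> Lf Lg; have LF := L2_coef_freq Lf; have LG := L2_coef_freq Lg.
have [mD _] := L2_coef_freq (L2D Lf (L2Z z Lg)).
have [mS _] := L2D LF (L2Z z LG).
have E : fourier (fun xi => fourier (fun x => f x + z * g x) xi * (What xi)^*%C) =
    fourier (fun xi => fourier f xi * (What xi)^*%C + z * (fourier g xi * (What xi)^*%C)).
  apply: (eq_fourier mD mS); apply: aeS (fourierD z Lf Lg) => xi; exact: alg.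
have H := ae_refl2 (fourierD z LF LG).
apply: aeS H => t H.
exact: (etrans (congr1 (fun F : R2 -> C => F (- t.1, - t.2)) E) H).
Qed.

Definition weight (p : R2 * R2) : R := \1_(params Gamma Xi) p * p.1.1 `^ (- (3 / 2)).

Lemma weight2 p : params Gamma Xi p -> weight p ^+ 2 = p.1.1 ^- 3.
Proof.
move=> pp; have [/andP[a0 _] _] := pp.
rewrite /weight indicE mem_set// mul1r expr2 -powRD; last by rewrite (gt_eqF a0) implybT.
by rewrite -powR_mulrn ?ltW// -powRN; apply: (congr1 (powR _)); field.
Qed.

Lemma weight_off p : ~ params Gamma Xi p -> weight p = 0.
Proof. by move=> np; rewrite /weight indicE memNset// mul0r. Qed.

Lemma measurable_weight : measurable_fun [set: (plane * plane)%type] weight.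
Proof.
apply: measurable_funM; first by apply: measurable_indic; exact: measurable_params.
apply: (measurableT_comp (@measurable_powR _ _)).
exact: (measurableT_comp measurable_fst measurable_fst).
Qed.

Local Opaque SHf SH.

(* The coefficients with the square root of the density a^-3 absorbed, so that the
   frame identity becomes one between norms in L^2(mu4) and L^2(mu2). *)
Definition wSH f (p : R2 * R2) : C := (weight p)%:C%C * SHf psi f p.

Lemma wSH_off f p : ~ params Gamma Xi p -> wSH f p = 0.
Proof. by move=> np; rewrite /wSH weight_off// mul0r. Qed.

Lemma cmeas_wSH f : L2 f -> cmeasurable [set: (plane * plane)%type] (wSH f).
Proof.
move=> Lf; apply: cmeasM; first exact: (cmeasR measurable_weight).
exact: cmeas_SHf.
Qed.

(** Linearity holds at every p because it comes from the inner product [SH]; through the formula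
    with [fourier] it would hold almost everywhere only. *)
Lemma wSH_lin f g (z : C) p : L2 f -> L2 g ->
  wSH (fun x => f x + z * g x) p = wSH f p + z * wSH g p.
Proof.
move=> Lf Lg; have [pp|np] := pselect (params Gamma Xi p); last first.
  have alg (x y w : C) : x = 0 -> y = 0 -> w = 0 -> x = y + z * w.
    by move=> -> -> ->; rewrite mulr0 addr0.
  exact: (alg _ _ _ (wSH_off _ np) (wSH_off _ np) (wSH_off _ np)).
have [/andP[a0 _] _] := pp.
have Ld := L2_dilate p.1.2 p.2 a0 Lpsi; have Lz := L2Z z Lg.
have alg (w x y : C) : w * (x + z * y) = w * x + z * (w * y) by ring.
have E : SH psi (fun x => f x + z * g x) p.1.1 p.1.2 p.2 =
    SH psi f p.1.1 p.1.2 p.2 + z * SH psi g p.1.1 p.1.2 p.2.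
  have E1 := ipDl Lf Lz Ld; have E2 := ipZl z Lg Ld.
  exact: (etrans E1 (congr1 (+%R (SH psi f p.1.1 p.1.2 p.2)) E2)).
have Ef := SH_SHf Lpsi Lf pp; have Eg := SH_SHf Lpsi Lg pp.
have Es := SH_SHf Lpsi (L2D Lf Lz) pp.
have H := etrans (esym Es) (etrans E (f_equal2 (fun a b : C => a + z * b) Ef Eg)).
exact: (etrans (congr1 ( *%R (weight p)%:C%C) H) (alg _ _ _)).
Qed.

Lemma sqn_wSH f : L2 f -> sqn mu4 (wSH f) =
  (\int[mu4]_(p in params Gamma Xi) (cabs (SH psi f p.1.1 p.1.2 p.2) ^+ 2 * p.1.1 ^- 3)%:E)%E.
Proof.
move=> Lf; rewrite [RHS]integral_indicl; apply: eq_integral => p _; apply: (congr1 EFin).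
have [pp|np] := pselect (params Gamma Xi p); last first.
  by rewrite /wSH weight_off// mul0r cabs0 expr0n/= indicE memNset// mul0r.
rewrite /wSH cabsM cabsR exprMn real_normK ?num_real// weight2//.
have <- := SH_SHf Lpsi Lf pp.
by rewrite indicE mem_set// mul1r mulrC.
Qed.

Lemma frame_sum f : L2cone u v f ->
  (sqn mu4 (wSH f) + sqn mu2 (coef f) = c%:E * sqn mu2 f)%E.
Proof.
move=> Hf; have /L2coneP[Lf ff] := Hf; have LF := L2_fourier Lf; have [mF _] := LF.
rewrite (sqn_wSH Lf) (SH_sqn Lpsi Lf Hc).
have -> : sqn mu2 (coef f) = sqn mu2 (fun xi => fourier f xi * (What xi)^*%C).
  exact: (sqn_ifourier (L2_coef_freq Lf)).
have mS : measurable_fun [set: plane]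
    (fun xi => (cabs (fourier f xi) ^+ 2)%:E * shear_int psi (region Gamma Xi) xi)%E.
  exact: measurable_shear_int.
have S0 xi : (0 <= shear_int psi (region Gamma Xi) xi)%E.
  by apply: integral_ge0 => q _; rewrite lee_fin (dens_ge0 psi (q, xi)).
have mE := mcabs2 (L2_coef_freq Lf).1.
rewrite -ge0_integralD//; last 2 first.
- by move=> xi _; rewrite mule_ge0// lee_fin sqr_ge0.
- by move=> xi _; rewrite lee_fin sqr_ge0.
rewrite -(sqn_fourier Lf) -ge0_integralZl//; last 3 first.
- exact: mcabs2.
- by move=> xi _; rewrite lee_fin sqr_ge0.
- by rewrite lee_fin ltW.
apply: ge0_ae_eq_integral => //.
- exact: emeasurable_funD.
- by apply: measurable_funeM; exact: mcabs2.
- by move=> xi _; rewrite adde_ge0 ?mule_ge0// lee_fin sqr_ge0.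
- by move=> xi _; rewrite -EFinM lee_fin mulr_ge0 ?sqr_ge0// ltW.
(* Off the cone fhat vanishes, so the two sides are 0; on the cone the equation for W multiplied by
   |fhat|^2 is the claim. *)
apply: aeS ff => xi fx _.
have [cx|cx] := pselect (cone u v xi); last first.
  by rewrite fx (cindF cx) mulr0 mul0r cabs0 expr0n/= mul0e mule0 adde0.
have := HW xi; rewrite /Delta indicE mem_set// mul1e mulr1 => <-.
rewrite -/(region Gamma Xi) cabsM cabsJ exprMn [RHS]muleC.
by rewrite [in LHS](EFinM (cabs (fourier f xi) ^+ 2)) -ge0_muleDr ?lee_fin ?sqr_ge0.
Qed.

Lemma L2_wSH f : L2cone u v f -> isL2 mu4 (wSH f).
Proof.
move=> Hf; have [Lf _] := Hf; split; first exact: cmeas_wSH.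
apply: (@le_lt_trans _ _ (c%:E * sqn mu2 f)%E).
  by rewrite -(frame_sum Hf); apply: leeDl; exact: sqn_ge0.
by have [_ lf] := Lf; rewrite lte_mul_pinfty// lee_fin ltW.
Qed.

Lemma frame_n2 f : L2cone u v f -> n2 mu4 (wSH f) + n2 mu2 (coef f) = c * n2 mu2 f.
Proof.
move=> Hf; have [Lf _] := Hf; have := frame_sum Hf.
by rewrite (sqnE (L2_wSH Hf)) (sqnE (L2_coef Lf)) (sqnE Lf) => -[].
Qed.

(** The norm identity at f + z k, once those at f and k are removed, leaves an identity between the
    real parts of the cross terms, valid for every complex z. [coef] is linear almost everywhere
    only, which its norm does not see. *)
Lemma frame_ip f k : L2cone u v f -> L2cone u v k ->
  ip mu4 (wSH f) (wSH k) + ip mu2 (coef f) (coef k) = c%:C%C * ip mu2 f k.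
Proof.
move=> Hf Hk; have [Lf _] := Hf; have [Lk _] := Hk.
have alg (a1 b1 d1 a2 b2 d2 r1 r2 r3 m : R) : a1 + b1 = c * d1 -> a2 + b2 = c * d2 ->
    (a1 + m * a2 + 2 * r1) + (b1 + m * b2 + 2 * r2) = c * (d1 + m * d2 + 2 * r3) ->
    r1 + r2 = c * r3.
  move=> H1 H2; have : m * (a2 + b2) = m * (c * d2) by rewrite H2.
  lra.
have ReM (z a b d : C) : complex.Re (z * a) + complex.Re (z * b) = c * complex.Re (z * d) ->
    complex.Re (z * (a + b)) = complex.Re (z * (c%:C%C * d)).
  by rewrite !ReImE /=; lra.
apply: eq_complex_Re => z; apply: ReM.
have E1 : n2 mu4 (wSH (fun x => f x + z * k x)) = n2 mu4 (fun p => wSH f p + z * wSH k p).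
  by apply: (congr1 (n2 mu4)); apply/funext => p; exact: (wSH_lin z p Lf Lk).
have E2 : n2 mu2 (coef (fun x => f x + z * k x)) = n2 mu2 (fun t => coef f t + z * coef k t).
  apply: (congr1 fine); apply: ae_eq_sqn; last exact: (coef_lin z Lf Lk).
    by have [] := L2_coef (L2D Lf (L2Z z Lk)).
  by have [] := L2D (L2_coef Lf) (L2Z z (L2_coef Lk)).
have F1 := etrans E1 (n2DZ z (L2_wSH Hf) (L2_wSH Hk)).
have F2 := etrans E2 (n2DZ z (L2_coef Lf) (L2_coef Lk)).
have F3 := f_equal2 +%R (esym F1) (esym F2).
have F4 := etrans F3 (frame_n2 (L2cone_lin z Hf Hk)).
have F5 := etrans F4 (congr1 ( *%R c) (n2DZ z Lf Lk)).
exact: (alg _ _ _ _ _ _ _ _ _ _ (frame_n2 Hf) (frame_n2 Hk) F5).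
Qed.

(** The projection is symmetric and f is in its range, so projecting the shearlet does not change
    the coefficient. *)
Lemma dot_Pcone_dilate f p : L2cone u v f -> params Gamma Xi p ->
  dot f (Pcone u v (dilate psi p.1.1 p.1.2 p.2)) = SHf psi f p.
Proof.
move=> Hf pp; have [Lf _] := Hf; have [/andP[a0 _] _] := pp.
have Ld := L2_dilate p.1.2 p.2 a0 Lpsi.
rewrite -(SH_SHf Lpsi Lf pp).
have E1 := ipC (L2_Pcone u v Ld) Lf; have E2 := ip_Pcone Ld Hf; have E3 := ipC Ld Lf.
exact: (etrans E1 (etrans (congr1 (fun z => z^*%C) E2) (esym E3))).
Qed.

Lemma tight_frame_cone :
  tight_frame (L2cone u v) Gamma Xi (fun a s t => Pcone u v (dilate psi a s t))
    (translate_coef (PWhat u v What)) c.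
Proof.
rewrite PWhatE; split=> [//|p [/andP[a0 _] _]|f Hf].
  exact: (Pcone_cone u v (L2_dilate _ _ a0 Lpsi)).
have [Lf _] := Hf; split.
- apply: (eq_cmeasurable (f := SHf psi f)) => [p pp|].
    by rewrite (dot_Pcone_dilate Hf pp).
  exact: (@cmeasT R _ (plane * plane)%type (params Gamma Xi) _ (cmeas_SHf Lpsi Lf)).
- exact: (L2_coef Lf).1.
- have E : (\int[mu4]_(p in params Gamma Xi)
      (cabs (dot f (Pcone u v (dilate psi p.1.1 p.1.2 p.2))) ^+ 2 * p.1.1 ^- 3)%:E =
      sqn mu4 (wSH f))%E.
    apply: (etrans _ (esym (sqn_wSH Lf))); apply: eq_integral => p /set_mem pp.
    apply: (congr1 (fun z => (cabs z ^+ 2 * p.1.1 ^- 3)%:E)).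
    exact: (etrans (dot_Pcone_dilate Hf pp) (esym (SH_SHf Lpsi Lf pp))).
  exact: (etrans (congr1 (fun x => (x + _)%E) E) (frame_sum Hf)).
Qed.

(** Projecting changes the transform only off the cone, where [What] vanishes; [eq_fourier] upgrades
    this to an equality of functions. *)
Lemma coef_Pcone g : L2 g -> coef (Pcone u v g) = coef g.
Proof.
move=> Lg; have LP := L2_Pcone u v Lg.
have E : fourier (fun xi => fourier (Pcone u v g) xi * (What xi)^*%C) =
    fourier (fun xi => fourier g xi * (What xi)^*%C).
  apply: (eq_fourier (L2_coef_freq LP).1 (L2_coef_freq Lg).1).
  apply: aeS (fourier_Pcone u v Lg) => xi ->.
  have [cx|cx] := pselect (cone u v xi); first by rewrite (cindT cx) mulr1.
  rewrite (What_off_cone cx) (_ : (0 : C)^*%C = 0) ?mulr0//.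
  by apply: complex_eqP; rewrite /= ?oppr0.
by apply/funext => t; exact: (congr1 (fun F : R2 -> C => F (- t.1, - t.2)) E).
Qed.

(** As f lies in the cone space, g may be replaced by its projection in every pairing. This is
    [frame_ip] for f and [Pcone u v g], with the density a^-3 shared as one [weight] per factor. *)
Lemma weak_representation_cone f : L2cone u v f ->
  weak_representation u v Gamma Xi psi What c f.
Proof.
have scale (x y z : C) : y + z = c%:C%C * x -> x = (c^-1)%:C%C * y + (c^-1)%:C%C * z.
  move=> H; rewrite -mulrDr H mulrA -RtoCM mulVf; last by rewrite gt_eqF.
  by apply: complex_eqP; rewrite !ReImE /=; ring.
move=> Hf g Lg hW hpsi; have [Lf _] := Hf.
have Hk := Pcone_cone u v Lg; have Lk := L2_Pcone u v Lg.
have hWE : hW = fun t => coef f t * (coef (Pcone u v g) t)^*%C.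
  by rewrite /hW PWhatE (coef_Pcone Lg).
have hpsiE p : params Gamma Xi p ->
    hpsi p = wSH f p * (wSH (Pcone u v g) p)^*%C.
  move=> pp; have [/andP[a0 _] _] := pp.
  have Ld := L2_dilate p.1.2 p.2 a0 Lpsi.
  have Hd := Pcone_cone u v Ld.
  have E1 : dot (Pcone u v (dilate psi p.1.1 p.1.2 p.2)) g =
      (SHf psi (Pcone u v g) p)^*%C.
    apply: (etrans (ipC Lg Hd.1)); apply: (congr1 (fun z => z^*%C)).
    exact: (etrans (esym (ip_Pcone Lg Hd)) (dot_Pcone_dilate Hk pp)).
  have alg (x y a b : C) (w : R) : x = a -> y = b^*%C -> w ^+ 2 = p.1.1 ^- 3 ->
      x * y * (p.1.1 ^- 3)%:C%C = (w%:C%C * a) * (w%:C%C * b)^*%C.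
    by move=> -> -> <-; apply: complex_eqP; rewrite !ReImE /=; ring.
  exact: (alg _ _ _ _ _ (SH_SHf Lpsi Lf pp) E1 (weight2 pp)).
have iW : cintegrable mu2 setT hW.
  by rewrite hWE; exact: (ip_int (L2_coef Lf) (L2_coef Lk)).
have off p : ~ params Gamma Xi p -> wSH f p * (wSH (Pcone u v g) p)^*%C = 0.
  by move=> np; rewrite (wSH_off f np) mul0r.
have [ipsi Epsi] := cintegral_mkcond (measurable_params Gamma Xi) hpsiE off
  (ip_int (L2_wSH Hf) (L2_wSH Hk)).
split; first exact: iW.
  exact: ipsi.
have E1 : dot f g = ip mu2 f (Pcone u v g).
  apply: (etrans (ipC Lg Lf)).
  exact: (etrans (congr1 (fun z => z^*%C) (esym (ip_Pcone Lg Hf))) (esym (ipC Lk Lf))).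
have E2 : cintegral mu2 setT hW = ip mu2 (coef f) (coef (Pcone u v g)).
  exact: (congr1 (cintegral mu2 setT) hWE).
apply: (etrans E1); apply: scale.
apply: (etrans (f_equal2 +%R E2 Epsi)); apply: (etrans (addrC _ _)).
exact: (frame_ip Hf Hk).
Qed.

End TightFrame.

(** * Test functions and weak derivatives *)

Section SmoothFunctions.
Context {R : realType}.
Implicit Types (f g : R -> R) (p : {poly R}).

(** The derivative is a witness, so that sums, products and affine substitutions are handled by
    induction on n, without a formula for iterated derivatives. *)
Fixpoint diffn (n : nat) f : Prop :=
  if n is n.+1 then exists2 g, (forall x : R, is_derive x (1 : R) f (g x)) & diffn n g
  else True.

Definition smooth1 f := forall n, diffn n f.

Lemma diffnS n f : diffn n.+1 f -> diffn n f.
Proof.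
elim: n f => // n IH f [g fg Hg]; exists g => //; exact: IH.
Qed.

Lemma diffnD n f g : diffn n f -> diffn n g -> diffn n (fun x => f x + g x).
Proof.
elim: n f g => // n IH f g [f' df Hf] [g' dg Hg]; exists (fun x => f' x + g' x); last exact: IH.
by move=> x; exact: (@is_deriveD _ _ _ f g).
Qed.

Lemma diffnM n f g : diffn n f -> diffn n g -> diffn n (fun x => f x * g x).
Proof.
elim: n f g => // n IH f g Hf Hg.
have [f' df Hf'] := Hf; have [g' dg Hg'] := Hg.
exists (fun x => f x * g' x + g x * f' x).
  by move=> x; exact: (@is_deriveM _ _ f g).
by apply: diffnD; apply: IH => //; exact: diffnS.
Qed.

Lemma is_derive_affine (k c x : R) : is_derive (x : R) (1 : R) (fun x : R => k * x + c) k.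
Proof.
have : is_derive (x : R) (1 : R) (k \*: id + cst c) (k *: 1 + 0) by exact: is_deriveD.
by rewrite addr0 [_ *: _]mulr1.
Qed.

Lemma diffn_affine (k c : R) n f : diffn n f -> diffn n (fun x => f (k * x + c)).
Proof.
elim: n f => // n IH f [f' df Hf]; exists (fun x => f' (k * x + c) * k).
  move=> x; exact: (@is_derive1_comp R f (fun x : R => k * x + c) x _ _ _ (is_derive_affine k c x)).
apply: diffnM; first exact: IH.
elim: {IH Hf} n => // n IH; pose z : R -> R := cst 0.
have Hz m : diffn m z by elim: m => // m Hm; exists z => // x; exact: is_derive_cst.
by exists z; [move=> x; exact: is_derive_cst|exact: Hz].
Qed.

Lemma smooth1M f g : smooth1 f -> smooth1 g -> smooth1 (fun x => f x * g x).
Proof. by move=> Hf Hg n; exact: diffnM. Qed.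

Lemma smooth1_affine (k c : R) f : smooth1 f -> smooth1 (fun x => f (k * x + c)).
Proof. by move=> Hf n; exact: diffn_affine. Qed.

Lemma smooth1_is_derive f x : smooth1 f -> is_derive (x : R) (1 : R) f (derive1 f x).
Proof.
by move=> /(_ 1%N)[g fg _]; have [df dv] := fg x; rewrite derive1E; split.
Qed.

Lemma smooth1_derive1 f : smooth1 f -> smooth1 (derive1 f).
Proof.
move=> Hf n; have [g fg Hg] := Hf n.+1.
rewrite (_ : derive1 f = g)//; apply/funext => x.
by have := fg x; rewrite derive1E => -[_ ->].
Qed.

Lemma smooth1_continuous f : smooth1 f -> continuous f.
Proof.
move=> Hf x; apply/differentiable_continuous/derivable1_diffP.
by case: (smooth1_is_derive x Hf).
Qed.

(* The derivative of [flat p] is [flat q] with q = 'X^2 * (p - p^`()). *)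
Definition flat p (x : R) : R := if 0 < x then p.[x^-1] * expR (- x^-1) else 0.

(** Each monomial is at most a multiple of one term of the exponential series: y^i <= i! exp y. *)
Lemma horner_le_expR p : exists2 K : R, 0 <= K & forall y, 0 <= y -> `|p.[y]| <= K * expR y.
Proof.
exists (\sum_(i < size p) `|p`_i| * i`!%:R); first by rewrite sumr_ge0.
move=> y y0; rewrite horner_coef mulr_suml; apply: le_trans (ler_norm_sum _ _ _) _.
apply: ler_sum => i _; rewrite normrM normrX (ger0_norm y0) -mulrA ler_wpM2l//.
case: (nat_of_ord i) => [|n]; first by rewrite expr0 fact0 mul1r -expR0 ler_expR.
have := expR_ge1Dxn n y0.
have f0 : (0 : R) < n.+1`!%:R by rewrite ltr0n fact_gt0.
move=> H; rewrite -ler_pdivrMl// mulrC; apply: le_trans H; rewrite lerDr; exact: ler01.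
Qed.

(** The exponential bound is applied to p X^2 at 1 / x, which gains the factor x^2. It makes the
    difference quotient at the origin at most K |h|, so the derivative there is 0. *)
Lemma flat_le p : exists2 K : R, 0 <= K & forall x, `|flat p x| <= K * x ^+ 2.
Proof.
have [K K0 HK] := horner_le_expR (p * 'X^2); exists K => // x.
rewrite /flat; case: ltP => x0; last by rewrite normr0 mulr_ge0 ?sqr_ge0.
have y0 : 0 < x^-1 by rewrite invr_gt0.
have := HK _ (ltW y0); rewrite hornerM hornerXn normrM (ger0_norm (exprn_ge0 2 (ltW y0))) => H.
rewrite normrM.
rewrite (gtr0_norm (expR_gt0 _)) expRN ler_pdivrMr ?expR_gt0//.
have -> : `|p.[x^-1]| = `|p.[x^-1]| * x^-1 ^+ 2 * x ^+ 2.
  by rewrite -mulrA -exprMn mulVf ?gt_eqF// expr1n mulr1.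
by rewrite [leRHS]mulrAC ler_wpM2r ?sqr_ge0.
Qed.

Lemma is_derive_flat p (x : R) : is_derive (x : R) (1 : R) (flat p) (flat ('X^2 * (p - p^`())) x).
Proof.
have [x0|x0|x0] := ltgtP x 0.
- have -> : flat ('X^2 * (p - p^`())) x = 0 by rewrite /flat ltNge (ltW x0).
  have H0 : is_derive (x : R) (1 : R) (fun=> 0 : R) (0 : R) by exact: is_derive_cst.
  apply: (near_eq_is_derive _ H0).
  near=> y; rewrite /flat /= ltNge; apply/esym/ifF; apply/negbTE; rewrite negbK ltW//.
  by near: y; exact: lt_nbhsl.
- have -> : flat ('X^2 * (p - p^`())) x =
      p.[x^-1] *: (expR (- x^-1) * - (- x ^- 2 *: 1)) + expR (- x^-1) *: (p^`().[x^-1] * (- x ^- 2 *: 1)).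
    rewrite /flat x0 hornerM hornerXn hornerD hornerN /GRing.scale /=.
    by rewrite exprVn; ring.
  have iV : is_derive (x : R) (1 : R) (fun y : R => y^-1) (- x ^- 2 *: 1).
    by apply: (@is_deriveV R id x 1 1) => //; rewrite gt_eqF.
  have iE : is_derive (x : R) (1 : R) (fun y : R => expR (- y^-1)) (expR (- x^-1) * - (- x ^- 2 *: 1)).
    exact: (@is_derive1_comp R expR (fun y : R => - y^-1) x _ _ _ (is_deriveN iV)).
  have iP : is_derive (x : R) (1 : R) (fun y : R => p.[y^-1]) (p^`().[x^-1] * (- x ^- 2 *: 1)).
    exact: (@is_derive1_comp R (horner p) (fun y : R => y^-1) x _ _ (is_derive_poly p _) iV).
  apply: (near_eq_is_derive _ (is_deriveM iP iE)).
  by near=> y; rewrite /flat ifT//; near: y; exact: lt_nbhsr.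
- have -> : flat ('X^2 * (p - p^`())) x = 0 by rewrite /flat x0 ltxx.
  have [K K0 HK] := flat_le p.
  have H : (fun h : R => h^-1 *: ((flat p \o shift x) (h *: 1) - flat p x)) @ 0^' --> (0 : R).
    have f0 : flat p x = 0 by rewrite /flat x0 ltxx.
    apply/cvgr0Pnorm_le => e e0; near=> h.
    have h0 : h != 0 by near: h; exact: nbhs_dnbhs_neq.
    rewrite f0 subr0 /= x0 addr0 [_ *: 1]mulr1 normrM normfV ler_pdivrMl ?normr_gt0//.
    apply: le_trans (HK h) _; rewrite -normr_id -real_normK ?num_real// expr2 mulrA [leRHS]mulrC normr_id.
    rewrite ler_wpM2r//.
    have : `|h| <= e / (K + 1).
      near: h; apply: dnbhs0_le; rewrite divr_gt0// ltr_wpDl//.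
    rewrite ler_pdivlMr ?ltr_wpDl// => He; apply: le_trans He.
    by rewrite mulrC ler_wpM2l// lerDl.
  by split; [apply/cvg_ex; exists 0; exact: H|exact: cvg_lim H].
Unshelve. all: by end_near. Qed.

Lemma smooth1_flat p : smooth1 (flat p).
Proof.
move=> n; elim: n p => // n IH p.
by exists (flat ('X^2 * (p - p^`()))) => // x; exact: is_derive_flat.
Qed.

(** The first factor vanishes for x <= -1 and the second for x >= 1; the affine arguments are
    spelled out to match [smooth1_affine]. *)
Definition bump (x : R) : R := flat 1 (1 * x + 1) * flat 1 ((-1) * x + 1).

Lemma smooth1_bump : smooth1 bump.
Proof. by apply: smooth1M; apply: smooth1_affine; exact: smooth1_flat. Qed.

Lemma flat_ge0 x : 0 <= flat 1 x.
Proof. by rewrite /flat; case: ifP => // _; rewrite hornerC mul1r expR_ge0. Qed.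

Lemma bump_ge0 x : 0 <= bump x.
Proof. by rewrite mulr_ge0 ?flat_ge0. Qed.

Lemma bump_off x : 1 <= `|x| -> bump x = 0.
Proof.
rewrite ler_normr /bump /flat => /orP[x1|x1].
  by rewrite (ltNge 0 (-1 * x + 1)) (_ : _ <= 0) ?mulr0//; lra.
by rewrite (ltNge 0 (1 * x + 1)) (_ : _ <= 0) ?mul0r//; lra.
Qed.

(** Both factors are evaluated at some y >= 1 / 2, where exp (- 1 / y) >= exp (-2). *)
Lemma bump_gt x : `|x| <= 1 / 2 -> expR (-4) <= bump x.
Proof.
have H y : 1 / 2 <= y -> expR (-2) <= flat 1 y.
  move=> y2; rewrite /flat ifT ?hornerC ?mul1r ?ler_expR ?lerN2; last by lra.
  by rewrite invf_ple ?posrE; lra.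
rewrite ler_norml => /andP[x1 x2].
rewrite (_ : -4 = -2 + -2); last by ring.
by rewrite expRD; apply: ler_pM; rewrite ?expR_ge0//; apply: H; lra.
Qed.

End SmoothFunctions.

(** * Test functions with separated variables *)

Section TensorTestFunctions.
Context {R : realType}.
Local Notation C := R[i].
Local Notation R2 := (R * R)%type.
Local Notation plane := (measurableTypeR R * measurableTypeR R)%type.
Local Notation mu := (@lebesgue_measure R).
Local Notation mu2 := (@mu2 R).
Local Notation L2 := (isL2 mu2).
Local Opaque fourier fourier_int.
Implicit Types (p q : R -> R).

Definition tens p q (x : R2) : R := p x.1 * q x.2.

Lemma is_derive_tens1 p q (x : R2) (dp : R) : is_derive (x.1 : R) (1 : R) p dp ->
  is_derive x (dir false) (tens p q) (dp * q x.2).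
Proof.
move=> [dfp <-].
have H : (fun h : R => h^-1 *: ((tens p q \o shift x) (h *: dir false) - tens p q x)) @ 0^'
    --> 'D_1 p x.1 * q x.2.
  have -> : (fun h : R => h^-1 *: ((tens p q \o shift x) (h *: dir false) - tens p q x)) =
      (fun h : R => h^-1 *: ((p \o shift x.1) (h *: 1) - p x.1) * q x.2).
    apply/funext => h; rewrite /tens /dir /= [_ *: 0]mulr0 add0r.
    by rewrite /GRing.scale /=; ring.
  by apply: cvgM; [exact: dfp|exact: cvg_cst].
by split; [apply/cvg_ex; eexists; exact: H|exact: cvg_lim H].
Qed.

Lemma is_derive_tens2 p q (x : R2) (dq : R) : is_derive (x.2 : R) (1 : R) q dq ->
  is_derive x (dir true) (tens p q) (p x.1 * dq).
Proof.
move=> [dfq <-].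
have H : (fun h : R => h^-1 *: ((tens p q \o shift x) (h *: dir true) - tens p q x)) @ 0^'
    --> p x.1 * 'D_1 q x.2.
  have -> : (fun h : R => h^-1 *: ((tens p q \o shift x) (h *: dir true) - tens p q x)) =
      (fun h : R => p x.1 * (h^-1 *: ((q \o shift x.2) (h *: 1) - q x.2))).
    apply/funext => h; rewrite /tens /dir /= [_ *: 0]mulr0 add0r.
    by rewrite /GRing.scale /=; ring.
  by apply: cvgM; [exact: cvg_cst|exact: dfq].
by split; [apply/cvg_ex; eexists; exact: H|exact: cvg_lim H].
Qed.

Lemma partial1_tens p q : smooth1 p -> partial (tens p q) false = tens (derive1 p) q.
Proof.
move=> sp; apply/funext => x.
by have [_] := is_derive_tens1 q (smooth1_is_derive x.1 sp).
Qed.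

Lemma partial2_tens p q : smooth1 q -> partial (tens p q) true = tens p (derive1 q).
Proof.
move=> sq; apply/funext => x.
by have [_] := is_derive_tens2 p (smooth1_is_derive x.2 sq).
Qed.

Lemma continuous_tens p q : continuous p -> continuous q -> continuous (tens p q).
Proof.
move=> cp cq x; apply: cvgM.
  exact: (@cvg_comp _ _ _ fst p _ _ _ cvg_fst (cp x.1)).
exact: (@cvg_comp _ _ _ snd q _ _ _ cvg_snd (cq x.2)).
Qed.

Lemma smooth_tens p q : smooth1 p -> smooth1 q -> smooth (tens p q).
Proof.
move=> sp sq w; elim: w p q sp sq => [|b w IH] p q sp sq /=; last first.
  case: b; [rewrite (partial2_tens p sq)|rewrite (partial1_tens q sp)].
    exact: (IH _ _ sp (smooth1_derive1 sq)).
  exact: (IH _ _ (smooth1_derive1 sp) sq).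
split; first by apply: continuous_tens; exact: smooth1_continuous.
case=> x; first by have [] := is_derive_tens2 p (smooth1_is_derive x.2 sq).
by have [] := is_derive_tens1 q (smooth1_is_derive x.1 sp).
Qed.

(** One-variable building blocks: the weak derivative is tested only against products of two of
    them, whose partial derivatives and transforms factor. *)
Definition bumpy p := smooth1 p /\ exists2 r : R, 0 < r & forall x, r < `|x| -> p x = 0.

Lemma test_function_tens p q : bumpy p -> bumpy q -> test_function (tens p q).
Proof.
move=> [sp [r r0 pr]] [sq [r' r'0 qr]]; split; first exact: smooth_tens.
exists (Num.max r r') => x; rewrite prod_normE lt_max /tens !gt_max => /orP[]/andP[H1 H2].
  by rewrite pr ?mul0r.
by rewrite qr ?mulr0.
Qed.

Lemma bumpy_derive1 p : bumpy p -> bumpy (derive1 p).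
Proof.
move=> [sp [r r0 pr]]; split; first exact: smooth1_derive1.
exists r => // x rx; rewrite derive1E.
have : is_derive (x : R) (1 : R) p (0 : R).
  have H0 : is_derive (x : R) (1 : R) (fun=> 0 : R) (0 : R) by exact: is_derive_cst.
  apply: (near_eq_is_derive _ H0).
  have : \forall y \near x, r < `|y|.
    have e0 : 0 < `|x| - r by rewrite subr_gt0.
    apply: filterS (nbhsx_ballx x _ e0) => y; rewrite /ball /= => xy.
    by have := ler_normD (x - y) y; rewrite subrK; lra.
  by apply: filterS => y ry; rewrite pr.
by case.
Qed.

Lemma bumpy_shift p (c : R) : bumpy p -> bumpy (fun x => p (x + c)).
Proof.
move=> [sp [r r0 pr]]; split.
  rewrite (_ : (fun x => p (x + c)) = (fun x => p (1 * x + c))); first exact: smooth1_affine.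
  by apply/funext => x; rewrite mul1r.
exists (r + `|c|); first by rewrite ltr_wpDr.
move=> x rx; apply: pr; have := ler_normB (x + c) c; rewrite addrK; lra.
Qed.

Lemma bumpyM p q : bumpy p -> bumpy q -> bumpy (fun x => p x * q x).
Proof.
move=> [sp [r r0 pr]] [sq _]; split; first exact: smooth1M.
by exists r => // x rx; rewrite pr ?mul0r.
Qed.

Lemma integrable_bumpy p : bumpy p -> mu.-integrable setT (EFin \o p).
Proof.
move=> [/smooth1_continuous cp [r r0 pr]].
have : mu.-integrable `[- r, r] (EFin \o p).
  apply: continuous_compact_integrable; first exact: segment_compact.
  by apply: continuous_subspaceT.
rewrite integrable_mkcond//; congr (integrable _ _ _); apply/funext => x.
rewrite patchE; case: ifPn => //; rewrite notin_setE /= in_itv /= -ler_norml => /negP.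
by rewrite -ltNge => /pr ->.
Qed.

Lemma Rintegral_derive_bumpy (f F : R -> R) (r : R) : 0 < r -> continuous f ->
  (forall x, is_derive (x : R) 1 F (f x)) -> (forall x, r < `|x| -> F x = 0) ->
  (forall x, r < `|x| -> f x = 0) -> Rintegral mu setT f = 0.
Proof.
move=> r0 cf dF Fr fr; rewrite /Rintegral.
have -> : (\int[mu]_x (f x)%:E = \int[mu]_(x in `[(- (r + 1))%R, (r + 1)%R]) (f x)%:E)%E.
  rewrite [RHS]integral_mkcond; apply: eq_integral => x _; rewrite patchE.
  case: ifPn => //; rewrite notin_setE /= in_itv /= -ler_norml => /negP.
  by rewrite -ltNge => rx; rewrite fr//; lra.
rewrite (@FTC2_total _ f F)//; last by lra.
by rewrite !Fr ?subrr//; [rewrite normrN|]; rewrite ger0_norm; lra.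
Qed.

Definition fourier1 p (w : R) : C :=
  cintegral mu setT (fun x => (p x)%:C%C * cis (- (2 * pi * (x * w)))).

Lemma cint_bumpy p : bumpy p -> cintegrable mu setT (fun x => (p x)%:C%C).
Proof.
move=> bp; split; first exact: integrable_bumpy.
have -> : (fun x => (complex.Im (p x)%:C%C)%:E) = (fun=> 0%E) :> (R -> \bar R) by [].
exact: integrable0.
Qed.

Lemma cint_fourier1 p w : bumpy p ->
  cintegrable mu setT (fun x => (p x)%:C%C * cis (- (2 * pi * (x * w)))).
Proof.
move=> bp; apply: (cintMb measurableT (B := 1)) (cint_bumpy bp) => [|x _]; last by rewrite cabs_cis.
apply: cmeas_cis; apply: measurableT_comp => //; apply: measurable_funM => //.
exact: measurable_funM.
Qed.

(** Integration by parts: the difference of the two sides is the integral of the derivative of p (x)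
    exp (- 2 pi i x w), which vanishes because the support is compact. *)
Lemma fourier1_derive p w : bumpy p ->
  fourier1 (derive1 p) w = (0 +i* (2 * pi * w))%C * fourier1 p w.
Proof.
move=> bp; have bp' := bumpy_derive1 bp; have [sp [r r0 pr]] := bp.
have [sp' [r' r'0 pr']] := bp'.
pose z : C := (0 +i* (2 * pi * w))%C.
have i1 := cint_fourier1 w bp; have i2 := cint_fourier1 w bp'.
apply/eqP; rewrite -subr_eq0 -(cintegralZ measurableT z i1).
rewrite -(cintegralB measurableT i2 (cintZ measurableT z i1)); apply/eqP.
pose s := Num.max r r'.
have s0 : 0 < s by rewrite lt_max r0.
have dlin x : is_derive (x : R) (1 : R) (fun x : R => - (2 * pi * (x * w))) (- (2 * pi * w)).
  rewrite (_ : (fun x : R => _) = (fun x : R => - (2 * pi * w) * x + 0)).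
    exact: is_derive_affine.
  by apply/funext => y; ring.
have dp x := smooth1_is_derive x sp.
have cp := smooth1_continuous sp; have cp' := smooth1_continuous sp'.
have cl : continuous (fun x : R => - (2 * pi * (x * w))).
  move=> x; apply/differentiable_continuous/derivable1_diffP.
  by case: (dlin x).
have dc x := @is_derive1_comp R (@cos R) _ x _ _ (is_derive_cos _) (dlin x).
have ds x := @is_derive1_comp R (@sin R) _ x _ _ (is_derive_sin _) (dlin x).
have ccos : continuous (fun x : R => cos (- (2 * pi * (x * w)))).
  by move=> x; apply/differentiable_continuous/derivable1_diffP; case: (dc x).
have csin : continuous (fun x : R => sin (- (2 * pi * (x * w)))).
  by move=> x; apply/differentiable_continuous/derivable1_diffP; case: (ds x).
have big x : s < `|x| -> p x = 0 /\ derive1 p x = 0.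
  by rewrite gt_max => /andP[? ?]; rewrite pr// pr'.
rewrite /cintegral; apply: complex_eqP => /=.
- apply: (@Rintegral_derive_bumpy _ (fun x => p x * cos (- (2 * pi * (x * w)))) s s0).
  + rewrite (_ : (fun x => _) = (fun x => derive1 p x * cos (- (2 * pi * (x * w))) +
        2 * pi * w * (p x * sin (- (2 * pi * (x * w)))))).
      move=> x; apply: cvgD; first by apply: cvgM; [exact: cp'|exact: ccos].
      by apply: cvgM; [exact: cvg_cst|apply: cvgM; [exact: cp|exact: csin]].
    by apply/funext => x; rewrite /=; ring.
  + move=> x; apply: (is_derive_eq (is_deriveM (dp x) (dc x))).
    by rewrite /= /GRing.scale /=; ring.
  + by move=> x /big[-> _]; rewrite mul0r.
  + by move=> x /big[-> ->]; rewrite /=; ring.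
- apply: (@Rintegral_derive_bumpy _ (fun x => p x * sin (- (2 * pi * (x * w)))) s s0).
  + rewrite (_ : (fun x => _) = (fun x => derive1 p x * sin (- (2 * pi * (x * w))) -
        2 * pi * w * (p x * cos (- (2 * pi * (x * w)))))).
      move=> x; apply: cvgB; first by apply: cvgM; [exact: cp'|exact: csin].
      by apply: cvgM; [exact: cvg_cst|apply: cvgM; [exact: cp|exact: ccos]].
    by apply/funext => x; rewrite /=; ring.
  + move=> x; apply: (is_derive_eq (is_deriveM (dp x) (ds x))).
    by rewrite /= /GRing.scale /=; ring.
  + by move=> x /big[-> _]; rewrite mul0r.
  + by move=> x /big[-> ->]; rewrite /=; ring.
Qed.

End TensorTestFunctions.

(** * The weak derivative on the Fourier side *)

Section WeakDerivative.
Context {R : realType}.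
Local Notation C := R[i].
Local Notation R2 := (R * R)%type.
Local Notation plane := (measurableTypeR R * measurableTypeR R)%type.
Local Notation mu := (@lebesgue_measure R).
Local Notation mu2 := (@mu2 R).
Local Notation L2 := (isL2 mu2).
Local Opaque fourier fourier_int.
Implicit Types (p q : R -> R).

Definition ctens p q (x : R2) : C := (tens p q x)%:C%C.

Lemma ctensE p q x : ctens p q x = (p x.1)%:C%C * (q x.2)%:C%C.
Proof. exact: RtoCM. Qed.

Lemma cint_ctens p q : bumpy p -> bumpy q -> cintegrable mu2 setT (ctens p q).
Proof.
move=> bp bq.
have H := @cint_tensor R _ _ _ _ mu mu (fun x => (p x)%:C%C) (fun x => (q x)%:C%C) (fun=> 1) 1
  (cint_bumpy bp) (cint_bumpy bq) (cmeas_cst _ _).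
have -> : ctens p q = (fun z => (p z.1)%:C%C * 1 * (q z.2)%:C%C).
  by apply/funext => z; rewrite mulr1 ctensE.
by apply: H => z; rewrite cabsR normr1.
Qed.

Lemma L2_ctens p q : bumpy p -> bumpy q -> L2 (ctens p q).
Proof.
move=> bp bq; apply: isL2P; first exact: (cintegrable_meas (cint_ctens bp bq)).
have [H _] := cint_ctens (bumpyM bp bp) (bumpyM bq bq).
apply: eq_integrable H => // x _; apply: (congr1 EFin).
by rewrite /ctens cabsR real_normK ?num_real// /tens /=; ring.
Qed.

Lemma fourier_int_ctens p q w : bumpy p -> bumpy q ->
  fourier_int (ctens p q) w = fourier1 p w.1 * fourier1 q w.2.
Proof.
move=> bp bq; rewrite -(cintegral_tensor (cint_fourier1 w.1 bp) (cint_fourier1 w.2 bq)).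
apply: eq_cintegral => x _; rewrite ctensE mulrACA -cisD /dot2.
by apply: (congr1 (fun t => _ * cis t)); ring.
Qed.

(** The Fourier symbol (2 pi i w)^n of the n-th derivative. *)
Definition imul (n : nat) (w : R) : C := (0 +i* (2 * pi * w))%C ^+ n.

Lemma bumpy_iter n p : bumpy p -> bumpy (iter n (@derive1 R R) p).
Proof. by move=> bp; elim: n => //= n; exact: bumpy_derive1. Qed.

Lemma fourier1_iter n p w : bumpy p ->
  fourier1 (iter n (@derive1 R R) p) w = imul n w * fourier1 p w.
Proof.
move=> bp; elim: n => [|n IH]; first by rewrite /imul expr0 mul1r.
rewrite iterS (fourier1_derive w (bumpy_iter n bp)) IH /imul exprS.
exact: mulrA.
Qed.

Lemma iter_partial_tens n p q : bumpy p ->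
  iter n (fun h => partial h false) (tens p q) = tens (iter n (@derive1 R R) p) q.
Proof.
move=> bp; elim: n => //= n ->; apply: partial1_tens.
by have [] := bumpy_iter n bp.
Qed.

Lemma bumpy_bump (n : nat) : (0 < n)%N -> bumpy (fun x : R => bump (n%:R * x + 0)).
Proof.
move=> n0; split; first exact: (smooth1_affine _ _ smooth1_bump).
exists 1 => // x x1; apply: bump_off; rewrite addr0 normrM ger0_norm//.
by rewrite -[leLHS]mulr1; apply: ler_pM; rewrite ?ler1n// ltW.
Qed.

(** On the support |x| <= 1 / n the phase 2 pi x w is at most 1 in modulus, so its cosine is at
    least cos 1 > 0 and the real part of the transform is positive. *)
Lemma fourier1_bump_neq0 (n : nat) (w : R) : (0 < n)%N -> 2 * pi * `|w| <= n%:R ->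
  fourier1 (fun x => bump (n%:R * x + 0)) w != 0.
Proof.
move=> n0 wn; have bp := bumpy_bump n0; set p := (fun x => _) in bp *.
have nR : 0 < n%:R :> R by rewrite ltr0n.
have pi0 := pi_ge0 R.
have [iR _] := cint_fourier1 w bp.
apply/negP => /eqP/(congr1 (@complex.Re R)); rewrite /fourier1 /cintegral /= => E0.
pose f (x : R) := complex.Re ((p x)%:C%C * cis (- (2 * pi * (x * w)))).
have fE x : f x = p x * cos (2 * pi * (x * w)).
  by rewrite /f /= mul0r subr0 cosN.
have c1 : 0 < cos (1 : R) by exact: cos1_gt0.
have fcos x : p x * cos 1 <= f x.
  rewrite fE; have [x1|x1] := leP 1 `|n%:R * x + 0|.
    by rewrite /p (bump_off x1) !mul0r.
  apply: ler_wpM2l; first exact: bump_ge0.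
  rewrite -(cos_norm (2 * pi * (x * w))).
  have y1 : `|2 * pi * (x * w)| <= 1.
    rewrite normrM (ger0_norm (mulr_ge0 _ pi0))// normrM mulrCA.
    move: x1; rewrite addr0 normrM (gtr0_norm nR) => x1.
    apply: le_trans (ltW x1); rewrite mulrC ler_wpM2r//.
  have pi2 := @pi_ge2 R.
  by rewrite leNgt ltr_cos -?leNgt ?in_itv/= ?normr_ge0 ?ler01//; lra.
have f0 x : 0 <= f x by apply: le_trans (fcos x); rewrite mulr_ge0 ?bump_ge0 ?ltW.
(* For |x| <= d the argument n x of the bump is at most 1 / 2 in modulus, where [bump_gt] bounds it
   below. *)
pose d := (2 * n%:R)^-1 : R.
have d0 : 0 < d by rewrite invr_gt0 mulr_gt0.
have mf : measurable_fun [set: measurableTypeR R] (EFin \o f) by case/integrableP: iR.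
have lb : ((expR (-4) * cos 1 * (d + d))%:E <= \int[mu]_x (f x)%:E)%E.
  apply: (@le_trans _ _ (\int[mu]_(x in `[(- d)%R, d]%classic) (f x)%:E)%E); last first.
    by apply: ge0_subset_integral => // x _; rewrite lee_fin f0.
  have -> : ((expR (-4) * cos 1 * (d + d))%:E =
      \int[mu]_(x in `[(- d)%R, d]%classic) (expR (-4) * cos 1)%:E)%E.
    have mI : mu `[(- d)%R, d]%classic = (d + d)%:E.
      by rewrite lebesgue_measure_itv /= lte_fin ifT; [rewrite -EFinB opprK|lra].
    by rewrite integral_cst// [X in (_ * X)%E]mI EFinM.
  apply: ge0_le_integral => //.
  - by move=> x _; rewrite lee_fin mulr_ge0 ?expR_ge0 ?ltW.
  - exact: measurable_funTS.
  move=> x; rewrite /= in_itv /= -ler_norml => xd; rewrite lee_fin.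
  apply: le_trans (fcos x); rewrite ler_wpM2r ?(ltW c1)//; apply: bump_gt.
  rewrite addr0 normrM (gtr0_norm nR) mul1r -[leRHS](_ : n%:R * d = _).
    by rewrite ler_wpM2l// ltW.
  by rewrite /d; field; rewrite gt_eqF.
have fin : (\int[mu]_x (f x)%:E)%E \is a fin_num by exact: integrable_fin_num.
move: E0 lb; rewrite /Rintegral -/f => E0; rewrite -(fineK fin).
rewrite (_ : fine _ = 0); last exact: E0.
by rewrite lee_fin leNgt !mulr_gt0 ?expR_gt0// addr_gt0.
Qed.

Context (M : nat) (psi theta : R2 -> C).
Hypothesis (Lpsi : L2 psi) (Ltheta : L2 theta) (Hw : weak_partial1 M theta psi).

(** The weak derivative identity tested against p (x_1) q (x_2) says, through Plancherel, that this
    function has integral 0. It is to vanish almost everywhere. *)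
Let h p q (w : R2) : C :=
  fourier psi w * (fourier_int (ctens p q) w)^*%C -
  (-1) ^+ M * (fourier theta w * (fourier_int (ctens (iter M (@derive1 R R) p) q) w)^*%C).

Let L2F p q : bumpy p -> bumpy q -> L2 (fourier_int (ctens p q)).
Proof.
by move=> bp bq; have [] := fourier_int_contraction (cint_ctens bp bq) (L2_ctens bp bq).
Qed.

Lemma cint_h p q : bumpy p -> bumpy q -> cintegrable mu2 setT (h p q).
Proof.
move=> bp bq; apply: (cintB measurableT).
  exact: (ip_int (L2_fourier Lpsi) (L2F bp bq)).
apply: (cintZ measurableT).
exact: (ip_int (L2_fourier Ltheta) (L2F (bumpy_iter M bp) bq)).
Qed.

Lemma L2_h p q : bumpy p -> bumpy q -> L2 (h p q).
Proof.
have bnd p' q' : bumpy p' -> bumpy q' -> exists K, forall w, cabs ((fourier_int (ctens p' q') w)^*%C) <= K.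
  move=> bp bq; exists (Rintegral mu2 setT (fun x => cabs (ctens p' q' x))) => w.
  by rewrite cabsJ; exact: (fourier_int_le w (cint_ctens bp bq)).
move=> bp bq; apply: L2B.
  have [K HK] := bnd _ _ bp bq; have [mF _] := L2F bp bq.
  exact: (L2Mb (L2_fourier Lpsi) (cmeasJ mF) HK).
have [K HK] := bnd _ _ (bumpy_iter M bp) bq; have [mF _] := L2F (bumpy_iter M bp) bq.
exact: (L2Z _ (L2Mb (L2_fourier Ltheta) (cmeasJ mF) HK)).
Qed.

Lemma integral_h p q : bumpy p -> bumpy q -> cintegral mu2 setT (h p q) = 0.
Proof.
move=> bp bq; have bM := bumpy_iter M bp.
have key f p' : L2 f -> bumpy p' ->
    ip mu2 (fourier f) (fourier_int (ctens p' q)) = cintegral mu2 setT (fun x => f x * ctens p' q x).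
  move=> Lf bp'; have LT := L2_ctens bp' bq; have [mF _] := L2_fourier LT.
  have [mf _] := L2_fourier Lf; have [mI _] := L2F bp' bq.
  transitivity (ip mu2 (fourier f) (fourier (ctens p' q))).
    apply: (ae_eq_ip mf mI mf mF); first exact: aeW.
    by apply: aeS (fourier_fourier_int LT (cint_ctens bp' bq)) => w ->.
  apply: (etrans (Plancherel Lf LT)); apply: eq_cintegral => x _.
  by apply: complex_eqP; rewrite !ReImE /= ?oppr0.
have i1 := ip_int (L2_fourier Lpsi) (L2F bp bq).
have i2 := ip_int (L2_fourier Ltheta) (L2F bM bq).
rewrite (cintegralB measurableT i1 (cintZ measurableT _ i2)) (cintegralZ measurableT _ i2).
have E := Hw (test_function_tens bp bq).
rewrite (iter_partial_tens M q bp) in E.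
have E1 := key _ _ Lpsi bp; have E2 := key _ _ Ltheta bM.
apply/eqP; rewrite subr_eq0; apply/eqP.
exact: (etrans E1 (etrans E (congr1 ( *%R ((-1) ^+ M)) (esym E2)))).
Qed.

(** Translating the test function multiplies its transform by a character, so [integral_h] for the
    translate by t is the Fourier integral of [h p q] at t. *)
Lemma fourier_int_h p q (t : R2) : bumpy p -> bumpy q -> fourier_int (h p q) t = 0.
Proof.
move=> bp bq.
have bp' := bumpy_shift t.1 bp; have bq' := bumpy_shift t.2 bq.
have sh p' q' w : bumpy p' -> bumpy q' ->
    fourier_int (ctens (fun x => p' (x + t.1)) (fun x => q' (x + t.2))) w =
    cis (2 * pi * dot2 w t) * fourier_int (ctens p' q') w.
  move=> b1 b2; have i1 := fourier_int_int w (cint_ctens b1 b2).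
  have sc : scales (affine 1 0 1 t.1 t.2) `|1 * 1|^-1.
    by apply: scales_affine; exact: oner_neq0.
  have [iA EA] := scales_cint sc i1.
  transitivity (cis (2 * pi * dot2 w t) * cintegral mu2 setT
      ((fun x => ctens p' q' x * cis (- (2 * pi * dot2 x w))) \o affine 1 0 1 t.1 t.2)).
    rewrite -(cintegralZ measurableT _ iA); apply: eq_cintegral => x _.
    rewrite /= [RHS]mulrCA -cisD; apply: f_equal2.
      by rewrite /ctens /tens /affine /= !mul1r mul0r addr0.
    by apply: (congr1 (@cis R)); rewrite /dot2 /affine /=; ring.
  by rewrite EA mulr1 normr1 invr1 mul1r.
have E0 : fourier_int (ctens (fun x => p (x + t.1)) (fun x => q (x + t.2))) =
    (fun w => cis (2 * pi * dot2 w t) * fourier_int (ctens p q) w).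
  by apply/funext => w; exact: sh.
have EM p' q' w : bumpy p' -> bumpy q' -> fourier_int (ctens (iter M (@derive1 R R) p') q') w =
    imul M w.1 * fourier_int (ctens p' q') w.
  move=> b1 b2; rewrite (fourier_int_ctens w (bumpy_iter M b1) b2) (fourier1_iter M w.1 b1).
  by rewrite (fourier_int_ctens w b1 b2) mulrA.
rewrite -(integral_h bp' bq').
apply: eq_cintegral => w _; rewrite /h (EM _ _ w bp bq) (EM _ _ w bp' bq') E0.
have alg (A B F I m c d : C) : c^*%C = d ->
    (A * F^*%C - m * (B * (I * F)^*%C)) * d = A * (c * F)^*%C - m * (B * (I * (c * F))^*%C).
  by move=> <-; apply: complex_eqP; rewrite !ReImE /=; ring.
by apply: alg; rewrite cisJ.
Qed.

Lemma h_ae0 p q : bumpy p -> bumpy q -> {ae mu2, forall w, h p q w = 0}.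
Proof.
move=> bp bq; have Lh := L2_h bp bq; have ih := cint_h bp bq.
have [mh _] := Lh; have [mF _] := L2_fourier Lh; apply: (sqn0_ae mh).
rewrite -(sqn_fourier Lh); transitivity (sqn mu2 (fun=> 0 : C)); last first.
  by apply: integral0_eq => x _; rewrite cabs0 expr0n.
apply: (ae_eq_sqn mF (cmeas_cst _ _)).
by apply: aeS (fourier_fourier_int Lh ih) => w ->; exact: fourier_int_h.
Qed.

Lemma cabs_imul n w : cabs (imul n w) = (2 * pi * `|w|) ^+ n.
Proof.
elim: n => [|n IH]; first by rewrite /imul !expr0 cabsR normr1.
rewrite /imul !exprS cabsM IH; congr (_ * _).
apply/eqP; rewrite -(eqrXn2 (ltn0Sn 1)) ?cabs_ge0 ?mulr_ge0 ?pi_ge0//.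
by rewrite cabsE2 /= expr0n/= add0r !exprMn real_normK ?num_real.
Qed.

(* The transform of a test function concentrated near 0 does not vanish on a large
   ball, so that it can be cancelled there. *)
Lemma fourier_weak_partial1 : {ae mu2, forall w : R2,
  cabs (fourier psi w) = (2 * pi * `|w.1|) ^+ M * cabs (fourier theta w)}.
Proof.
have H : {ae mu2, forall w : R2, forall n, h (fun x => bump (n.+1%:R * x + 0)) (fun x => bump (n.+1%:R * x + 0)) w = 0}.
  apply/ae_foralln => n; apply: h_ae0; exact: bumpy_bump.
apply: aeS H => w H.
(* Makes both 2 pi |w_1| and 2 pi |w_2| at most n + 1, so that both factors of the transformed bump
   are nonzero at w. *)
pose n := Num.truncn (2 * pi * (`|w.1| + `|w.2|)).
have Hn : 2 * pi * (`|w.1| + `|w.2|) <= n.+1%:R by apply/ltW; exact: truncnS_gt.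
have pi0 := pi_ge0 R.
have H1 : fourier1 (fun x : R => bump (n.+1%:R * x + 0)) w.1 != 0.
  apply: fourier1_bump_neq0 => //; apply: le_trans Hn.
  by rewrite ler_wpM2l ?mulr_ge0// lerDl.
have H2 : fourier1 (fun x : R => bump (n.+1%:R * x + 0)) w.2 != 0.
  apply: fourier1_bump_neq0 => //; apply: le_trans Hn.
  by rewrite ler_wpM2l ?mulr_ge0// lerDr.
have bb := @bumpy_bump n.+1 isT.
have := H n; rewrite /h (fourier_int_ctens w bb bb).
rewrite (fourier_int_ctens w (bumpy_iter M bb) bb) (fourier1_iter M w.1 bb).
move: (fourier1 _ _) (fourier1 _ _) H1 H2 (fourier psi w) (fourier theta w) => a b a0 b0 A B.
(* Passing to moduli removes the conjugations and the sign m = (-1)^M before the nonzero factor is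
   cancelled. *)
have alg (m z : C) : A * (b * a)^*%C - m * (B * (z * b * a)^*%C) = 0 -> cabs m = 1 ->
    cabs A = cabs z * cabs B.
  move=> /eqP; rewrite subr_eq0 => /eqP/(congr1 (@cabs R)); rewrite !cabsM !cabsJ !cabsM => E m1.
  have ca : cabs a != 0 by apply: contra b0 => /eqP/cabs0_eq0 ->.
  have cb : cabs b != 0 by apply: contra a0 => /eqP/cabs0_eq0 ->.
  apply: (mulIf (mulf_neq0 cb ca)); rewrite E m1; ring.
move=> /alg ->; first by rewrite cabs_imul.
elim: (M) => [|k IH]; first by rewrite expr0 cabsR normr1.
by rewrite exprS cabsM IH cabsN cabsR normr1 mulr1.
Qed.

End WeakDerivative.

Lemma ge0_integral_eq0_ae {R : realType} d (T : measurableType d)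
    (m : {measure set T -> \bar R}) (h : T -> R) : measurable_fun setT h ->
  (forall x, 0 <= h x) -> (\int[m]_x (h x)%:E = 0)%E -> {ae m, forall x, h x = 0}.
Proof.
move=> mh h0 E; have mE : measurable_fun setT (EFin \o h) by exact/measurable_EFinP.
have : ae_eq m setT (EFin \o h) (cst 0%E).
  apply/(ae_eq_integral_abs m measurableT mE); rewrite -[RHS]E.
  by apply: eq_integral => x _ /=; rewrite ger0_norm.
by apply: aeS => x /(_ I) [].
Qed.

(** * Decay of the window *)

Section FrequencyChange.
Context {R : realType}.
Local Notation C := R[i].
Local Notation R2 := (R * R)%type.
Local Notation plane := (measurableTypeR R * measurableTypeR R)%type.
Local Notation mu := (@lebesgue_measure R).
Local Notation mu2 := (@mu2 R).
Local Notation L2 := (isL2 mu2).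
Local Opaque fourier fourier_int.
Implicit Types psi : R2 -> C.

Definition half : set R2 := [set q | (0 < q.1)%R].

Lemma measurable_half : measurable (half : set plane).
Proof.
rewrite (_ : half = `]0, +oo[%classic `*` setT); first exact: measurableX.
by apply/seteqP; split => q /=; rewrite /half /= in_itv /= andbT; [|case].
Qed.

Section ChangeOfVariables.
Context (xi : R2) (xi0 : xi.1 != 0).

(* Jacobian of q |-> freqmap q.1 q.2 xi, whose range is only the half plane of the
   w such that w.1 has the sign of xi.1. *)
Definition jac (x : R) : R := \1_[set x : R | 0 < x / xi.1] x * (Num.sqrt (x / xi.1) * xi.1 ^+ 2)^-1.

Lemma jac_ge0 x : 0 <= jac x.
Proof. by rewrite /jac mulr_ge0 ?indicE// invr_ge0 mulr_ge0 ?sqrtr_ge0 ?sqr_ge0. Qed.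

Lemma measurable_jac : measurable_fun [set: measurableTypeR R] jac.
Proof.
have ml : measurable_fun [set: measurableTypeR R] (fun x : R => x / xi.1).
  exact: measurable_funM.
apply: measurable_funM.
  apply: measurable_indic; rewrite (_ : [set _ | _] = (fun x : R => x / xi.1) @^-1` `]0, +oo[).
    by rewrite -[X in measurable X]setTI; exact: ml.
  by apply/seteqP; split => x /=; rewrite in_itv /= andbT.
apply: (measurableT_comp measurable_inv); apply: measurable_funM => //.
apply: (measurableT_comp _ ml); apply: continuous_measurable_fun; exact: sqrt_continuous.
Qed.

Lemma measurable_freqmap1 : measurable_fun [set: plane] (fun q => freqmap q.1 q.2 xi : plane).
Proof.
have H : measurable_fun [set: plane] (fun q : plane => (q, xi) : plane * plane).
  exact: measurable_fun_pair.
exact: (measurableT_comp measurable_freqmap2 H).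
Qed.

(** One variable at a time: at fixed a, the map from s to w_2 is affine of slope - sqrt a xi_1; then
    w_1 = xi_1 a is linear in a. The two slopes multiply to sqrt a xi_1^2, the inverse of [jac]. *)
Lemma integral_freqmap (g : R2 -> R) : measurable_fun [set: plane] g -> (forall w, 0 <= g w) ->
  (\int[mu2]_q (\1_half q * g (freqmap q.1 q.2 xi))%:E = \int[mu2]_w (jac w.1 * g w)%:E)%E.
Proof.
move=> mg g0.
have mL : measurable_fun [set: plane] (fun q => (\1_half q * g (freqmap q.1 q.2 xi))%:E).
  apply/measurable_EFinP; apply: measurable_funM.
    by apply: measurable_indic; exact: measurable_half.
  exact: (measurableT_comp mg measurable_freqmap1).
have mR : measurable_fun [set: plane] (fun w => (jac w.1 * g w)%:E).
  apply/measurable_EFinP; apply: measurable_funM => //.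
  exact: (measurableT_comp measurable_jac).
have L0 q : (0 <= (\1_half q * g (freqmap q.1 q.2 xi))%:E)%E.
  by rewrite lee_fin mulr_ge0 ?indicE.
have R0 w : (0 <= (jac w.1 * g w)%:E)%E by rewrite lee_fin mulr_ge0 ?jac_ge0.
rewrite (integral_mu2 mL L0) (integral_mu2 mR R0).
have mgx x : measurable_fun [set: measurableTypeR R] (fun y => (g (x, y))%:E).
  by apply/measurable_EFinP; apply: (measurableT_comp mg); exact: measurable_fun_pair.
pose Phi (x : R) := (\int[mu]_y (jac x * g (x, y))%:E)%E.
have mPhi : measurable_fun [set: measurableTypeR R] Phi.
  by apply: (@measurable_fun_fubini_tonelli_F _ _ _ _ R mu _ mR) => z; exact: R0.
have Phi0 x : (0 <= Phi x)%E by apply: integral_ge0 => y _; exact: (R0 (x, y)).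
have PhiE x : Phi x = ((jac x)%:E * \int[mu]_y (g (x, y))%:E)%E.
  rewrite -ge0_integralZl//; last by rewrite lee_fin jac_ge0.
  by move=> y _; rewrite lee_fin.
transitivity (\int[mu]_a (`|xi.1|%:E * Phi (xi.1 * a + 0)%R))%E; last first.
  have mPa : measurable_fun [set: measurableTypeR R] (fun a : R => Phi (xi.1 * a + 0)).
    by apply: (measurableT_comp mPhi); exact: measurable_affine.
  rewrite ge0_integralZl//.
  rewrite (ge0_integral_affine 0 xi0 mPhi Phi0) muleA -EFinM mulfV ?normr_eq0// mul1e.
  by [].
apply: eq_integral => a _; rewrite addr0 PhiE.
have da : xi.1 * a / xi.1 = a by rewrite mulrAC divff// mul1r.
have [a0|a0] := leP a 0.
  have h0 : ~ half (a, 0) by rewrite /half /= => /(lt_le_trans)/(_ a0); rewrite ltxx.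
  have -> : jac (xi.1 * a) = 0.
    rewrite /jac da indicE memNset ?mul0r//= da => /(lt_le_trans)/(_ a0).
    by rewrite ltxx.
  rewrite mul0e mule0; apply: integral0_eq => s _; rewrite indicE memNset ?mul0r//.
have jE : `|xi.1| * jac (xi.1 * a) = `|- (Num.sqrt a * xi.1)|^-1.
  rewrite /jac da indicE mem_set /= ?da// mul1r normrN normrM.
  rewrite (ger0_norm (sqrtr_ge0 a)) -[xi.1 ^+ 2]real_normK ?num_real//.
  by field; rewrite normr_eq0 xi0 sqrtr_eq0 -ltNge a0.
have kn : - (Num.sqrt a * xi.1) != 0.
  by rewrite oppr_eq0 mulf_neq0// sqrtr_eq0 -ltNge.
rewrite muleA -EFinM jE.
have gx0 y : (0 <= (g (xi.1 * a, y))%:E)%E by rewrite lee_fin.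
rewrite -(ge0_integral_affine (Num.sqrt a * xi.2) kn (mgx (xi.1 * a)) gx0).
apply: eq_integral => s _; rewrite indicE mem_set// mul1r /freqmap /=.
apply: (congr1 (fun y => (g y)%:E)); apply: f_equal2; ring.
Qed.

(** The decay of the transforms is known for almost every w but is used along (a, s) at each fixed
    xi. The formula above, applied to the indicator of a null set, shows that its preimage is
    null. *)
Lemma ae_freqmap (P : R2 -> Prop) : {ae mu2, forall w, P w} ->
  {ae mu2, forall q : R2, 0 < q.1 -> P (freqmap q.1 q.2 xi)}.
Proof.
move=> [N [mN N0 PN]].
have mi : measurable_fun [set: plane] (\1_N : R2 -> R) by exact: measurable_indic.
have E := integral_freqmap mi (fun w => ltac:(by rewrite indicE)).
have E0 : (\int[mu2]_w (jac w.1 * \1_N w)%:E = 0)%E.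
  transitivity (\int[mu2]_w (cst 0 w))%E; last by rewrite integral0.
  apply: ge0_ae_eq_integral => //.
  - apply/measurable_EFinP; apply: measurable_funM => //.
    exact: (measurableT_comp measurable_jac).
  - by move=> w _; rewrite lee_fin mulr_ge0 ?jac_ge0 ?indicE.
  exists N; split=> // w /= H; apply: contrapT => nN; apply: H => _.
  by rewrite indicE memNset// mulr0.
rewrite E0 in E.
have mL : measurable_fun [set: plane] (fun q => \1_half q * \1_N (freqmap q.1 q.2 xi) : R).
  apply: measurable_funM; first by apply: measurable_indic; exact: measurable_half.
  exact: (measurableT_comp mi measurable_freqmap1).
have := ge0_integral_eq0_ae mL (fun q => ltac:(by rewrite mulr_ge0 ?indicE)) E.
apply: aeS => q + q0; rewrite indicE mem_set// mul1r => H.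
apply: contrapT => nP; have := PN _ nP => /mem_set.
by move: H; rewrite indicE; case: (_ \in _) => //= /eqP; rewrite oner_eq0.
Qed.

End ChangeOfVariables.

(** The factor a^(-3/2) is positive on the half plane a > 0, and [jac] is positive on the range of
    the frequency map, so the vanishing of the integral passes to the transform there. *)
Lemma shear_int_half0 psi (xi : R2) : L2 psi -> xi.1 != 0 ->
  shear_int psi half xi = 0%E -> {ae mu2, forall w : R2, 0 < w.1 / xi.1 -> fourier psi w = 0}.
Proof.
move=> Lpsi xi0 E0; have [mp _] := L2_fourier Lpsi.
have md : measurable_fun [set: plane] (fun q => dens psi (q, xi)).
  by apply: (measurableT_comp (measurable_dens Lpsi)); exact: measurable_fun_pair.
have m1 : measurable_fun [set: plane] (fun q => \1_half q * dens psi (q, xi)).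
  by apply: measurable_funM => //; apply: measurable_indic; exact: measurable_half.
have H1 : {ae mu2, forall q : R2, \1_half q * dens psi (q, xi) = 0}.
  apply: ge0_integral_eq0_ae => //.
    by move=> q; rewrite mulr_ge0 ?indicE// dens_ge0.
  exact: (etrans (esym (integral_indicl mu2 half (fun q => dens psi (q, xi)))) E0).
pose g (w : R2) : R := cabs (fourier psi w) ^+ 2.
have mg : measurable_fun [set: plane] g by exact: cmeas_cabs2.
have g0 w : 0 <= g w by exact: sqr_ge0.
have E := integral_freqmap xi0 mg g0.
have EL : (\int[mu2]_q (\1_half q * g (freqmap q.1 q.2 xi))%:E = 0)%E.
  transitivity (\int[mu2]_w (cst 0 w))%E; last by rewrite integral0.
  apply: ge0_ae_eq_integral => //.
  - apply/measurable_EFinP; apply: measurable_funM.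
      by apply: measurable_indic; exact: measurable_half.
    exact: (measurableT_comp mg (measurable_freqmap1 xi)).
  - by move=> w _; rewrite lee_fin mulr_ge0 ?indicE.
  apply: aeS H1 => q + _; rewrite indicE.
  have [/set_mem hq|_] := boolP (q \in _); last by rewrite !mul0r.
  rewrite !mul1r => /eqP; rewrite mulf_eq0 (gt_eqF (powR_gt0 _ hq)) orbF => /eqP H.
  exact: (congr1 EFin H).
have mR : measurable_fun [set: plane] (fun w => jac xi w.1 * g w).
  apply: measurable_funM => //; exact: (measurableT_comp (measurable_jac xi)).
have H2 := ge0_integral_eq0_ae mR
  (fun w => mulr_ge0 (jac_ge0 xi w.1) (g0 w)) (etrans (esym E) EL).
apply: aeS H2 => w + w0; rewrite /jac indicE mem_set// mul1r => /eqP.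
rewrite mulf_eq0 invr_eq0 mulf_eq0 sqrtr_eq0 leNgt w0 sqrf_eq0 (negbTE xi0) /= => /eqP/eqP.
by rewrite /g sqrf_eq0 => /eqP/cabs0_eq0.
Qed.

Lemma shearlet_const_gt0 psi (c : R) : shearlet psi c -> 0 < c.
Proof.
move=> [Lpsi psi0 _ Hc].
have e1 : ((1, 0) : R2).1 != 0 by exact: oner_neq0.
have e2 : ((-1, 0) : R2).1 != 0 by rewrite /= oppr_eq0 oner_neq0.
have c0 : 0 <= c.
  rewrite -lee_fin -(Hc _ e1); apply: integral_ge0 => q _.
  by rewrite lee_fin; exact: (dens_ge0 psi (q, (1, 0))).
rewrite lt_neqAle c0 andbT; apply/eqP => cE; apply: psi0.
(* xi = (1, 0) covers the half plane w_1 > 0 and xi = (-1, 0) the half plane w_1 < 0; the line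
   between them is null. *)
have H1 := shear_int_half0 Lpsi e1 (etrans (Hc _ e1) (congr1 EFin (esym cE))).
have H2 := shear_int_half0 Lpsi e2 (etrans (Hc _ e2) (congr1 EFin (esym cE))).
have H : {ae mu2, forall w : R2, fourier psi w = 0}.
  apply: aeS2 (aeS2 (fun x p q => conj p q) H1 H2) (ae_coord1 0) => w [h1 h2] w0.
  have [wn|wp|wz] := ltgtP w.1 0; last by rewrite wz eqxx in w0.
    by apply: h2; rewrite /= invrN invr1 mulrN1 oppr_gt0.
  by apply: h1; rewrite /= invr1 mulr1.
have [mp _] := Lpsi; have [mF _] := L2_fourier Lpsi.
apply: (sqn0_ae mp); rewrite -(sqn_fourier Lpsi).
transitivity (sqn mu2 (fun=> 0 : C)); first exact: (ae_eq_sqn mF (cmeas_cst _ _) H).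
by apply: integral0_eq => x _; rewrite cabs0 expr0n.
Qed.

End FrequencyChange.

(** * Integrals of powers *)

Section PowerIntegrals.
Context {R : realType}.
Local Notation mu := (@lebesgue_measure R).

Lemma powR_continuous_at (e x : R) : 0 < x -> {for x, continuous ((@powR R) ^~ e)}.
Proof.
move=> x0; apply/differentiable_continuous/derivable1_diffP.
by case: (is_derive1_powR e x0).
Qed.

Lemma integral_powR_itv (e x y : R) : 0 < x -> x < y -> e + 1 != 0 ->
  (\int[mu]_(a in `[x, y]) (a `^ e)%:E = ((y `^ (e + 1) - x `^ (e + 1)) / (e + 1))%:E)%E.
Proof.
move=> x0 xy e1; have y0 := lt_trans x0 xy.
pose F (a : R) := a `^ (e + 1) / (e + 1).
have dF (a : R) : 0 < a -> is_derive (a : R) (1 : R) F (a `^ e).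
  move=> a0; have H := is_deriveZ (e + 1)^-1 (is_derive1_powR (e + 1) a0).
  have FE : F = (e + 1)^-1 \*: ((@powR R) ^~ (e + 1)) by apply/funext => z; rewrite /F mulrC.
  rewrite FE; apply: (is_derive_eq H).
  by rewrite /GRing.scale /= addrK mulrA mulVf ?mul1r.
have cF (a : R) : 0 < a -> {for a, continuous F}.
  by move=> a0; apply/differentiable_continuous/derivable1_diffP; case: (dF _ a0).
rewrite (@continuous_FTC2 _ ((@powR R) ^~ e) F)//.
- by rewrite /F -EFinB mulrBl.
- apply: continuous_in_subspaceT => a; rewrite inE /= in_itv /= => /andP[xa _].
  by apply: powR_continuous_at; exact: lt_le_trans xa.
- split.
  + move=> a; rewrite in_itv /= => /andP[xa _].
    by case: (dF a (lt_trans x0 xa)).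
  + by apply: cvg_at_right_filter; exact: cF.
  + by apply: cvg_at_left_filter; exact: cF.
- move=> a; rewrite in_itv /= => /andP[xa _]; rewrite derive1E.
  by case: (dF a (lt_trans x0 xa)).
Qed.

Lemma measurable_indic_powR (D : set (measurableTypeR R)) (e : R) : measurable D ->
  measurable_fun [set: measurableTypeR R] (fun a => \1_D a * a `^ e).
Proof.
move=> mD; apply: measurable_funM; first exact: measurable_indic.
exact: measurable_powR.
Qed.

(* The bound passes to the increasing limit of the intervals by Fatou's lemma. *)
Lemma integral_powR_limit (D : set (measurableTypeR R)) (e K : R) (x_ y_ : nat -> R) :
  measurable D -> (forall n, 0 < x_ n < y_ n) -> e + 1 != 0 ->
  (forall n, (y_ n `^ (e + 1) - x_ n `^ (e + 1)) / (e + 1) <= K) ->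
  (forall a, exists N, forall n, (N <= n)%N -> (x_ n <= a <= y_ n) = (a \in D)) ->
  (\int[mu]_a (\1_D a * a `^ e)%:E <= K%:E)%E.
Proof.
move=> mD xy e1 HK HD.
apply: (@fatou_bound _ _ _ mu
  (fun n a => (\1_(`[x_ n, y_ n]%classic) a * a `^ e)%:E)).
- move=> n; apply/measurable_EFinP; apply: measurable_indic_powR.
  exact: measurable_itv.
- by move=> n a; rewrite lee_fin mulr_ge0 ?indicE ?powR_ge0.
- move=> a; have [N HN] := HD a; apply: cvg_near_cst; exists N => // n /= Nn.
  have E : (a \in `[x_ n, y_ n]%classic) = (a \in D).
    rewrite -(HN n Nn); apply/idP/idP; first by rewrite inE /= in_itv.
    by move=> H; rewrite inE /= in_itv.
  by rewrite !indicE E.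
- move=> n; have /andP[x0 xyn] := xy n.
  rewrite -(integral_indicl mu `[x_ n, y_ n]%classic (fun a => a `^ e)).
  by rewrite integral_powR_itv// lee_fin.
Qed.

Lemma integral_powR_0 (G e : R) : 0 < G -> -1 < e ->
  (\int[mu]_a (\1_(`]0, G]%classic) a * a `^ e)%:E < +oo)%E.
Proof.
move=> G0 e1; have ep : 0 < e + 1 by lra.
apply: (@le_lt_trans _ _ (G `^ (e + 1) / (e + 1))%:E); last exact: ltry.
(* The divisor n + 2 keeps the left end strictly below G already at n = 0. *)
apply: (@integral_powR_limit _ _ _ (fun n => G / n.+2%:R) (fun=> G)).
- exact: measurable_itv.
- move=> n; rewrite divr_gt0//= ltr_pdivrMr// ltr_pMr// ltr1n//.
- by rewrite gt_eqF.
- move=> n; rewrite ler_pM2r ?invr_gt0// gerBl; exact: powR_ge0.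
move=> a; have [a0|a0] := leP a 0.
  exists 0%N => n _; rewrite [RHS](_ : _ = false); last first.
    by apply/negP; rewrite inE /= in_itv /= ltNge a0.
  by apply/negP => /andP[/(le_trans)/(_ a0)]; rewrite leNgt divr_gt0.
exists (Num.truncn (G / a)) => n Nn; apply/idP/idP.
  by move=> /andP[_ aG]; rewrite inE /= in_itv /= a0.
rewrite inE /= in_itv /= => /andP[_ ->]; rewrite andbT ler_pdivrMr// mulrC -ler_pdivrMr//.
apply/ltW/(lt_le_trans (truncnS_gt (G / a))); rewrite ler_nat.
by apply: ltnW; rewrite !ltnS.
Qed.

Lemma integral_powR_y (G e : R) : 0 < G -> e < -1 ->
  (\int[mu]_a (\1_(`[G, +oo[%classic) a * a `^ e)%:E < +oo)%E.
Proof.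
move=> G0 e1; have en : e + 1 < 0 by lra.
apply: (@le_lt_trans _ _ (- G `^ (e + 1) / (e + 1))%:E); last exact: ltry.
apply: (@integral_powR_limit _ _ _ (fun=> G) (fun n => G + n.+1%:R)).
- exact: measurable_itv.
- by move=> n; rewrite G0 ltrDl ltr0n.
- by rewrite lt_eqF.
- move=> n; rewrite ler_nM2r ?invr_lt0// lerBrDr addNr; exact: powR_ge0.
move=> a; exists (Num.truncn a) => n Nn; apply/idP/idP.
  by move=> /andP[Ga _]; rewrite inE /= in_itv /= Ga.
rewrite inE /= in_itv /= andbT => Ga; rewrite Ga /=.
have : a < n.+1%:R by apply: lt_le_trans (truncnS_gt a) _; rewrite ler_nat.
lra.
Qed.

(** The maps s - v and - s - v carry the two half lines of s onto [Xi - v, +oo[, which stays away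
    from the singularity at 0 because Xi > v. *)
Lemma integral_powR_abs (v Xi e : R) : v < Xi -> e < -1 ->
  (\int[mu]_s (\1_[set s : R | Xi <= `|s|] s * (`|s| - v) `^ e)%:E < +oo)%E.
Proof.
move=> vX e1; have G0 : 0 < Xi - v by rewrite subr_gt0.
pose h (a : R) : R := \1_(`[Xi - v, +oo[%classic) a * a `^ e.
have h0 a : 0 <= h a by rewrite /h mulr_ge0 ?indicE ?powR_ge0.
have mh : measurable_fun [set: measurableTypeR R] h.
  by apply: measurable_indic_powR; exact: measurable_itv.
have mEh : measurable_fun [set: measurableTypeR R] (EFin \o h) by exact/measurable_EFinP.
have aff (k : R) : k != 0 -> `|k| = 1 ->
    (\int[mu]_s (h (k * s - v))%:E < +oo)%E.
  move=> k0 k1; have := @ge0_integral_affine R k (- v) (EFin \o h) k0 mEh (fun x => h0 x).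
  by rewrite k1 invr1 mul1e => ->; exact: integral_powR_y.
have maff (k : R) : measurable_fun [set: measurableTypeR R] (fun s : R => (h (k * s - v))%:E).
  by apply: (measurableT_comp mEh); exact: measurable_affine.
apply: (@le_lt_trans _ _ (\int[mu]_s ((h (1 * s - v))%:E + (h (-1 * s - v))%:E))%E).
  apply: ge0_le_integral => //.
  - by move=> s _; rewrite lee_fin mulr_ge0 ?indicE ?powR_ge0.
  - apply/measurable_EFinP; apply: measurable_funM.
      apply: measurable_indic; rewrite (_ : [set _ | _] = (fun s : R => `|s|) @^-1` `[Xi, +oo[).
        rewrite -[X in measurable X]setTI; exact: (@normr_measurable _ setT).
      by apply/seteqP; split => x /=; rewrite in_itv /= andbT.
    apply: (measurableT_comp (@measurable_powR _ _)).
    by apply: measurable_funB => //; exact: normr_measurable.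
  - by apply: emeasurable_funD; exact: maff.
  move=> s _; rewrite -EFinD lee_fin indicE.
  have [/set_mem sX|_] := boolP (s \in _); last by rewrite mul0r addr_ge0.
  rewrite mul1r; have [s0|s0] := leP 0 s.
    rewrite -[leLHS]addr0; apply: lerD => //; move: sX; rewrite /= ger0_norm// => sX.
    by rewrite /h mul1r indicE mem_set ?mul1r//= in_itv /= andbT lerD2r.
  rewrite -[leLHS]add0r; apply: lerD => //; move: sX; rewrite /= ltr0_norm// => sX.
  by rewrite /h mulN1r indicE mem_set ?mul1r//= in_itv /= andbT lerD2r.
rewrite ge0_integralD//; [|by move=> s _; rewrite lee_fin|by move=> s _; rewrite lee_fin].
by apply: lte_add_pinfty; apply: aff; rewrite ?normrN ?normr1 ?oppr_eq0 ?oner_neq0.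
Qed.

End PowerIntegrals.

(** * Pointwise estimates for the transform of psi *)

Section PointwiseBounds.
Context {R : realType}.
Implicit Types (a x y : R).

Lemma le_powR r x y : 0 <= r -> 0 <= x -> x <= y -> x `^ r <= y `^ r.
Proof. by move=> r0 x0 xy; apply: ge0_ler_powR; rewrite ?nnegrE// (le_trans x0). Qed.

Lemma powRND a r s : 0 < a -> a `^ (r + s) = a `^ r * a `^ s.
Proof. by move=> a0; rewrite powRD// (gt_eqF a0) implybT. Qed.

(** Inside the cone the shear s x dominates y as soon as |s| > v; this is where the margin Xi > v
    enters the estimates. *)
Lemma shear_lower v s x y : `|y| <= v * `|x| -> (`|s| - v) * `|x| <= `|y - s * x|.
Proof.
move=> yv; have := ler_normB y (y - s * x); rewrite opprB addrC subrK normrM; lra.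
Qed.

Lemma decay_powRN K L y z : 0 <= K -> 0 <= L -> 0 < z -> z <= y ->
  K / (1 + y `^ L) <= K * z `^ (- L).
Proof.
move=> K0 L0 z0 zy; have zL : 0 < z `^ L by exact: powR_gt0.
have yL := powR_ge0 y L.
rewrite powRN; apply: ler_wpM2l => //; rewrite lef_pV2 ?posrE//; last lra.
by have := le_powR L0 (ltW z0) zy; lra.
Qed.

(** For a >= G the decay at a X is at most K G^(-L) X^(-L), and X >= 1 allows L to be lowered to m
    in the last factor only. *)
Lemma decay_coarse K L a G X m T : 0 <= K -> 0 <= L -> 0 < G -> G <= a -> 1 <= X ->
  m <= L -> T <= K / (1 + (a * X) `^ L) -> T <= K * G `^ (- L) * X `^ (- m).
Proof.
move=> K0 L0 G0 Ga X1 mL HT; have X0 : 0 < X by lra.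
apply: (le_trans HT); rewrite -mulrA.
apply: (le_trans (@decay_powRN K L (a * X) (G * X) K0 L0 _ _)).
- exact: mulr_gt0.
- by rewrite ler_wpM2r// ltW.
- apply: ler_wpM2l => //; rewrite (powRM _ (ltW G0) (ltW X0)); apply: ler_wpM2l; first exact: powR_ge0.
  by apply: ler_powR => //; rewrite lerN2.
Qed.

(** A count of powers: (a X)^M (sqrt a S X)^(-L) = a^(M - L/2) S^(-L) X^(M - L), and X >= 1 lets the
    exponent M - L be raised to - m. *)
Lemma decay_derivative K L a S X m y T (k : R) (M : nat) : 0 <= K -> 0 <= L -> 0 <= k -> 0 < a ->
  0 < S -> 1 <= X -> m <= L - M%:R -> Num.sqrt a * (S * X) <= y ->
  T <= (k * (a * X)) ^+ M * (K / (1 + y `^ L)) ->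
  T <= K * k ^+ M * (a `^ (M%:R - L / 2) * S `^ (- L)) * X `^ (- m).
Proof.
move=> K0 L0 k0 a0 S0 X1 mL Hy HT; have X0 : 0 < X by lra.
have s0 : 0 < Num.sqrt a by rewrite sqrtr_gt0.
apply: (le_trans HT).
have z0 : 0 < Num.sqrt a * (S * X) by rewrite !mulr_gt0.
apply: (@le_trans _ _ ((k * (a * X)) ^+ M * (K * (Num.sqrt a * (S * X)) `^ (- L)))).
  apply: ler_wpM2l; last exact: decay_powRN.
  by rewrite exprn_ge0// mulr_ge0// mulr_ge0// ltW.
have -> : (k * (a * X)) ^+ M * (K * (Num.sqrt a * (S * X)) `^ (- L)) =
    K * k ^+ M * (a `^ (M%:R - L / 2) * S `^ (- L)) * X `^ (M%:R - L).
  rewrite !powRM ?mulr_ge0 ?ltW// -powR12_sqrt ?ltW// -powRrM !powRND// !powR_mulrn ?ltW//.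
  rewrite !exprMn (_ : 2^-1 * - L = - (L / 2)); last by field.
  ring.
apply: ler_wpM2l; last by apply: ler_powR => //; lra.
by rewrite !mulr_ge0 ?exprn_ge0 ?powR_ge0.
Qed.

(** The square of T / P splits into exponents 2 - r and r, each bounded by one of the two
    estimates. *)
Lemma interpolation T P A b (r : R) : 0 <= T -> 0 < P -> 0 <= r <= 2 ->
  T <= A * P -> T <= b * P -> T ^+ 2 <= P ^+ 2 * (A `^ (2 - r) * b `^ r).
Proof.
move=> T0 P0 /andP[r0 r2] TA Tb; pose t := T / P.
have t0 : 0 <= t by rewrite divr_ge0// ltW.
have tA : t <= A by rewrite ler_pdivrMr.
have tb : t <= b by rewrite ler_pdivrMr.
have -> : T ^+ 2 = P ^+ 2 * t ^+ 2 by rewrite /t; field; rewrite gt_eqF.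
apply: ler_wpM2l; first exact: sqr_ge0.
have -> : t ^+ 2 = t `^ (2 - r) * t `^ r.
  rewrite -powRD ?subrK ?powR_mulrn//.
  by rewrite (_ : 2 == 0 = false)// pnatr_eq0.
by apply: ler_pM; rewrite ?powR_ge0//; apply: le_powR; rewrite ?subr_ge0.
Qed.

End PointwiseBounds.

(** * Domination of the outer integral and decay of W *)

Section Decay.
Context {R : realType}.
Local Notation C := R[i].
Local Notation R2 := (R * R)%type.
Local Notation plane := (measurableTypeR R * measurableTypeR R)%type.
Local Notation mu := (@lebesgue_measure R).
Local Notation mu2 := (@mu2 R).
Local Notation isL2 := (isL2 mu2).
Local Opaque fourier fourier_int.
Context (u v Gamma Xi c B : R) (psi theta What : R2 -> C) (M : nat) (L1 L2 : R).
Hypothesis (u0 : 0 < u) (v0 : 0 < v) (G0 : 0 < Gamma) (vX : v < Xi) (Lpsi : isL2 psi).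
Hypothesis Hc : forall xi : R2, xi.1 != 0 -> shear_int psi half xi = c%:E.
Hypothesis WB : forall xi, cabs (What xi) <= B.
Hypothesis HW : forall xi : R2,
  (Delta u v Gamma Xi psi xi + (cabs (What xi) ^+ 2)%:E = (c * \1_(cone u v) xi)%:E)%E.
Hypothesis (M0 : (0 < M)%N) (ML2 : M%:R < L2) (L2M : L2 < 2 * M%:R - 1 / 2).
Hypothesis psi_theta : {ae mu2, forall w : R2,
  cabs (fourier psi w) = (2 * pi * `|w.1|) ^+ M * cabs (fourier theta w)}.
Hypothesis decay1 : fourier_decay1 L1 psi.
Hypothesis decay2 : fourier_decay2 L2 theta.

Definition outer : set R2 := half `\` region Gamma Xi.

Lemma measurable_outer : measurable (outer : set plane).
Proof. by apply: measurableD; [exact: measurable_half|exact: (measurable_region Gamma Xi)]. Qed.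

Lemma region_half : region Gamma Xi `<=` half.
Proof. by move=> q [/andP[]]. Qed.

Let i0 (D : set plane) xi q : (0 <= (\1_D q * dens psi (q, xi))%:E)%E.
Proof. by rewrite lee_fin mulr_ge0 ?dens_ge0. Qed.

Let mi (D : set plane) xi : measurable D ->
  measurable_fun [set: plane] (fun q => (\1_D q * dens psi (q, xi))%:E).
Proof.
have md : measurable_fun [set: plane] (fun q => dens psi (q, xi)).
  by apply: (measurableT_comp (measurable_dens Lpsi)); exact: measurable_fun_pair.
by move=> mD; apply/measurable_EFinP; apply: measurable_funM => //; exact: measurable_indic.
Qed.

Lemma shear_int_halfD xi : shear_int psi half xi = (shear_int psi (region Gamma Xi) xi +
  \int[mu2]_q (\1_outer q * dens psi (q, xi))%:E)%E.
Proof.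
have EH D : shear_int psi D xi = (\int[mu2]_q (\1_D q * dens psi (q, xi))%:E)%E.
  exact: (integral_indicl mu2 D (fun q => dens psi (q, xi))).
rewrite !EH -ge0_integralD//; last 2 first.
- exact: (mi _ (measurable_region Gamma Xi)).
- exact: (mi _ measurable_outer).
apply: eq_integral => q _; rewrite -EFinD -mulrDl.
apply: (congr1 (fun z => (z * dens psi (q, xi))%:E)); rewrite !indicE.
have [rq|rq] := pselect (region Gamma Xi q).
  rewrite (mem_set (region_half rq)) (mem_set rq) memNset ?addr0// => -[_]; exact.
rewrite (memNset rq) add0r; have [hq|hq] := pselect (half q).
  by rewrite !mem_set.
by rewrite !memNset// => -[].
Qed.

Lemma shear_int_region_le xi : xi.1 != 0 -> (shear_int psi (region Gamma Xi) xi <= c%:E)%E.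
Proof.
move=> x0; rewrite -(Hc x0) shear_int_halfD; apply: leeDl.
by apply: integral_ge0 => q _; exact: i0.
Qed.

(** The integral over the whole half plane a > 0 is c, so removing the part over the region, which
    is finite and equals [Delta] on the cone, leaves the outer part. On the cone xi_1 is nonzero
    since u > 0. *)
Lemma What_outer xi : cone u v xi -> (cabs (What xi) ^+ 2)%:E =
  (\int[mu2]_q (\1_outer q * dens psi (q, xi))%:E)%E.
Proof.
move=> cx; have x0 : xi.1 != 0.
  by move: cx => [ux _]; rewrite -normr_gt0; exact: lt_le_trans ux.
have := HW xi; rewrite /Delta indicE mem_set// mul1e mulr1.
rewrite -[X in _ = X -> _](Hc x0) shear_int_halfD -/(region Gamma Xi).
have : (shear_int psi (region Gamma Xi) xi <= c%:E)%E.
  exact: shear_int_region_le.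
have : (0 <= shear_int psi (region Gamma Xi) xi)%E.
  by apply: integral_ge0 => q _; rewrite lee_fin; exact: (dens_ge0 psi (q, xi)).
case: (shear_int _ _ _) => [r| |]// _ _.
by case: (integral _ _ _) => [z| |]//; rewrite -!EFinD => -[/addrI ->].
Qed.

Let sig (e s : R) : R := \1_[set s : R | Xi <= `|s|] s * (`|s| - v) `^ e.
Let low (e a : R) : R := \1_(`]0, Gamma]%classic) a * a `^ e.
Let high (e a : R) : R := \1_(`[Gamma, +oo[%classic) a * a `^ e.
Let flat_s (s : R) : R := \1_(`[- Xi, Xi]%classic) s.

Let msig e : measurable_fun [set: measurableTypeR R] (sig e).
Proof.
apply: measurable_funM.
  apply: measurable_indic; rewrite (_ : [set _ | _] = (fun s : R => `|s|) @^-1` `[Xi, +oo[).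
    rewrite -[X in measurable X]setTI; exact: (@normr_measurable _ setT).
  by apply/seteqP; split => x /=; rewrite in_itv /= andbT.
apply: (measurableT_comp (@measurable_powR _ _)).
by apply: measurable_funB => //; exact: normr_measurable.
Qed.

Let mlow e : measurable_fun [set: measurableTypeR R] (low e).
Proof. by apply: measurable_indic_powR; exact: measurable_itv. Qed.

Let mhigh e : measurable_fun [set: measurableTypeR R] (high e).
Proof. by apply: measurable_indic_powR; exact: measurable_itv. Qed.

Let mflat : measurable_fun [set: measurableTypeR R] flat_s.
Proof. by apply: measurable_indic; exact: measurable_itv. Qed.

Let sig0 e s : 0 <= sig e s. Proof. by rewrite mulr_ge0 ?indicE ?powR_ge0. Qed.
Let low0 e s : 0 <= low e s. Proof. by rewrite mulr_ge0 ?indicE ?powR_ge0. Qed.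
Let high0 e s : 0 <= high e s. Proof. by rewrite mulr_ge0 ?indicE ?powR_ge0. Qed.
Let flat0 s : 0 <= flat_s s. Proof. by rewrite /flat_s indicE. Qed.

Lemma tensor_lty (k : R) (p q : R -> R) : 0 <= k ->
  measurable_fun [set: measurableTypeR R] p -> measurable_fun [set: measurableTypeR R] q ->
  (forall x, 0 <= p x) -> (forall x, 0 <= q x) ->
  (\int[mu]_x (p x)%:E < +oo)%E -> (\int[mu]_x (q x)%:E < +oo)%E ->
  (\int[mu2]_x (k * (p x.1 * q x.2))%:E < +oo)%E.
Proof.
move=> k0 mp mq p0 q0 fp fq.
have mpq : measurable_fun [set: plane] (fun x => (p x.1 * q x.2)%:E).
  apply/measurable_EFinP; apply: measurable_funM.
    exact: (measurableT_comp mp).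
  exact: (measurableT_comp mq).
under eq_integral do rewrite EFinM.
rewrite ge0_integralZl//; last by move=> x _; rewrite lee_fin mulr_ge0.
rewrite (integral_mu2_tensor mp mq p0 q0) lte_mul_pinfty// lte_mul_pinfty//.
  by apply: integral_ge0 => x _; rewrite lee_fin.
by rewrite ge0_fin_numE//; apply: integral_ge0 => x _; rewrite lee_fin.
Qed.

Let lsig e : e < -1 -> (\int[mu]_s (sig e s)%:E < +oo)%E.
Proof. exact: integral_powR_abs. Qed.
Let llow e : -1 < e -> (\int[mu]_s (low e s)%:E < +oo)%E.
Proof. exact: integral_powR_0. Qed.
Let lhigh e : e < -1 -> (\int[mu]_s (high e s)%:E < +oo)%E.
Proof. exact: integral_powR_y. Qed.
Let lflat : (\int[mu]_s (flat_s s)%:E < +oo)%E.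
Proof.
rewrite (_ : (fun s => _) = (fun s : R => (\1_(`[- Xi, Xi]%classic) s)%:E))//.
have mI : (mu `[(- Xi)%R, Xi]%classic < +oo)%E.
  by rewrite lebesgue_measure_itv /=; case: ifP => // _; rewrite -EFinB ltry.
by rewrite integral_indic ?setIT//; exact: measurable_itv.
Qed.

Section Dominant.
Context (A1 B1 : R) (A10 : 0 <= A1) (B10 : 0 <= B1).
Let r : R := M%:R^-1.

(* One term for each of the regions a < Gamma and |s| >= Xi, a >= Gamma and |s| < Xi,
   a >= Gamma and |s| >= Xi.  In the last one, the decay of psi alone is not
   integrable in s and that of theta alone need not be in a; weighting them by
   1 - 1/(2M) and 1/(2M) turns the conditions into L2 > M in both variables. *)
Definition dominant (q : R2) : R :=
  B1 ^+ 2 * (low (2 * M%:R - L2 - 3 / 2) q.1 * sig (- (2 * L2)) q.2) +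
  A1 ^+ 2 * (high (- (3 / 2)) q.1 * flat_s q.2) +
  A1 `^ (2 - r) * B1 `^ r * (high (- (1 / 2) - L2 * r / 2) q.1 * sig (- (L2 * r)) q.2).

Let M1 : 1 <= M%:R :> R. Proof. by rewrite ler1n. Qed.
Let Mr : M%:R * r = 1. Proof. by rewrite mulfV// gt_eqF//; have := M1; lra. Qed.
Let r0 : 0 < r. Proof. by rewrite invr_gt0; have := M1; lra. Qed.
Let r1 : r <= 1. Proof. by rewrite invf_le1 ?M1//; have := M1; lra. Qed.
Let L2r : 1 < L2 * r. Proof. by rewrite -Mr ltr_pM2r. Qed.

Let term_ge0 (k x y : R) : 0 <= k -> 0 <= x -> 0 <= y -> 0 <= k * (x * y).
Proof. by move=> k0 x0 y0; rewrite mulr_ge0// mulr_ge0. Qed.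

Let k3 : 0 <= A1 `^ (2 - r) * B1 `^ r.
Proof. by rewrite mulr_ge0 ?powR_ge0. Qed.

Lemma dominant_ge0 q : 0 <= dominant q.
Proof. by rewrite !addr_ge0// term_ge0// ?sqr_ge0. Qed.

Let mterm (k : R) (p q : R -> R) : measurable_fun [set: measurableTypeR R] p ->
  measurable_fun [set: measurableTypeR R] q ->
  measurable_fun [set: plane] (fun x => k * (p x.1 * q x.2)).
Proof.
move=> mp mq; apply: measurable_funM => //; apply: measurable_funM.
  exact: (measurableT_comp mp).
exact: (measurableT_comp mq).
Qed.

Lemma measurable_dominant : measurable_fun [set: plane] dominant.
Proof.
apply: measurable_funD; last exact: mterm.
by apply: measurable_funD; exact: mterm.
Qed.

Lemma dominant_lty : (\int[mu2]_q (dominant q)%:E < +oo)%E.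
Proof.
have m1 := @mterm (B1 ^+ 2) _ _ (mlow (2 * M%:R - L2 - 3 / 2)) (msig (- (2 * L2))).
have m2 := @mterm (A1 ^+ 2) _ _ (mhigh (- (3 / 2))) mflat.
have m3 := @mterm (A1 `^ (2 - r) * B1 `^ r) _ _ (mhigh (- (1 / 2) - L2 * r / 2)) (msig (- (L2 * r))).
under eq_integral do rewrite /dominant !EFinD.
rewrite ge0_integralD//; last 4 first.
- by move=> q _; rewrite adde_ge0// lee_fin term_ge0// ?sqr_ge0.
- by apply: emeasurable_funD; exact/measurable_EFinP.
- by move=> q _; rewrite lee_fin term_ge0.
- exact/measurable_EFinP.
rewrite ge0_integralD//; last 4 first.
- by move=> q _; rewrite lee_fin term_ge0// ?sqr_ge0.
- exact/measurable_EFinP.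
- by move=> q _; rewrite lee_fin term_ge0// ?sqr_ge0.
- exact/measurable_EFinP.
have [LM Lr] := (M1, L2r).
(* Equivalent to L2 < 2 M - 1/2: integrability at a = 0 for |s| >= Xi. Likewise [h4] and [h5] both
   amount to L2 / M > 1, for a and for s in the third term. *)
have h1 : -1 < 2 * M%:R - L2 - 3 / 2 by move: L2M; lra.
have h2 : - (2 * L2) < -1 by move: ML2 LM; lra.
have h3 : - (3 / 2) < -1 :> R by lra.
have h4 : - (1 / 2) - L2 * r / 2 < -1 by move: Lr; lra.
have h5 : - (L2 * r) < -1 by lra.
apply: lte_add_pinfty; first apply: lte_add_pinfty.
- exact: (tensor_lty (sqr_ge0 _) (mlow _) (msig _) (low0 _) (sig0 _) (llow h1) (lsig h2)).
- exact: (tensor_lty (sqr_ge0 _) (mhigh _) mflat (high0 _) flat0 (lhigh h3) lflat).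
- exact: (tensor_lty k3 (mhigh _) (msig _) (high0 _) (sig0 _) (lhigh h4) (lsig h5)).
Qed.

(** Off the region at least one of the two bounds is available. Where only one is, its square is a
    term of [dominant]; where both are, they are interpolated with r = 1 / M. *)
Lemma dens_dominant (P T a s : R) : 0 <= T -> 0 < P -> 0 < a ->
  ~ region Gamma Xi (a, s) ->
  (Gamma <= a -> T <= A1 * P) ->
  (Xi <= `|s| -> T <= B1 * (a `^ (M%:R - L2 / 2) * (`|s| - v) `^ (- L2)) * P) ->
  T ^+ 2 * a `^ (- (3 / 2)) <= P ^+ 2 * dominant (a, s).
Proof.
move=> T0 P0 a0 nreg HA HB.
have P2 : 0 <= P ^+ 2 by exact: sqr_ge0.
have ap : 0 <= a `^ (- (3 / 2)) by exact: powR_ge0.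
pose t1 := B1 ^+ 2 * (low (2 * M%:R - L2 - 3 / 2) a * sig (- (2 * L2)) s).
pose t2 := A1 ^+ 2 * (high (- (3 / 2)) a * flat_s s).
pose t3 := A1 `^ (2 - r) * B1 `^ r * (high (- (1 / 2) - L2 * r / 2) a * sig (- (L2 * r)) s).
have t10 : 0 <= t1 by rewrite term_ge0// ?sqr_ge0.
have t20 : 0 <= t2 by rewrite term_ge0// ?sqr_ge0.
have t30 : 0 <= t3 by rewrite term_ge0.
have dE : dominant (a, s) = t1 + t2 + t3 by [].
pose b := B1 * (a `^ (M%:R - L2 / 2) * (`|s| - v) `^ (- L2)).
have b0 : 0 <= b by rewrite mulr_ge0// mulr_ge0 ?powR_ge0.
have sigE e : Xi <= `|s| -> sig e s = (`|s| - v) `^ e.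
  by move=> Xs; rewrite /sig indicE mem_set ?mul1r.
have highE e : Gamma <= a -> high e a = a `^ e.
  by move=> Ga; rewrite /high indicE mem_set ?mul1r//= in_itv /= andbT.
have [Ga|aG] := leP Gamma a; have [Xs|sX] := leP Xi `|s|.
- apply: (@le_trans _ _ (P ^+ 2 * t3)); last by rewrite dE ler_wpM2l//; lra.
  have r02 : 0 <= r <= 2 by have := r0; have := r1; lra.
  have H := interpolation T0 P0 r02 (HA Ga) (HB Xs).
  apply: (le_trans (ler_wpM2r ap H)).
  rewrite /t3 (highE _ Ga) (sigE _ Xs) !powRM ?mulr_ge0 ?powR_ge0// -!powRrM.
  (* The choice of r: with M r = 1 the growth a^(M r) contributes only a single power of a. *)
  rewrite (_ : - (1 / 2) - L2 * r / 2 = (M%:R - L2 / 2) * r + - (3 / 2)); last first.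
    by rewrite mulrBl Mr; field.
  rewrite (powRND _ _ a0) mulNr le_eqVlt; apply/orP; left; apply/eqP; ring.
- apply: (@le_trans _ _ (P ^+ 2 * t2)); last by rewrite dE ler_wpM2l//; lra.
  have -> : t2 = A1 ^+ 2 * a `^ (- (3 / 2)).
    rewrite /t2 (highE _ Ga) /flat_s indicE mem_set ?mulr1//=.
    by rewrite in_itv /= -ler_norml ltW.
  rewrite mulrA ler_wpM2r// -exprMn mulrC ler_sqr ?nnegrE ?mulr_ge0 ?(ltW P0)//; exact: HA.
- apply: (@le_trans _ _ (P ^+ 2 * t1)); last by rewrite dE ler_wpM2l//; lra.
  have H : T ^+ 2 <= (b * P) ^+ 2.
    by rewrite !expr2; apply: ler_pM => //; exact: HB.
  apply: (le_trans (ler_wpM2r ap H)).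
  have lowE e : low e a = a `^ e.
    by rewrite /low indicE mem_set ?mul1r//= in_itv /= a0 ltW.
  rewrite /t1 lowE (sigE _ Xs) /b.
  rewrite (_ : 2 * M%:R - L2 - 3 / 2 = (M%:R - L2 / 2) + (M%:R - L2 / 2) + - (3 / 2)); last by field.
  rewrite (_ : - (2 * L2) = - L2 + - L2); last by ring.
  have S0 : 0 < `|s| - v by rewrite subr_gt0; exact: lt_le_trans Xs.
  rewrite !(powRND _ _ a0) (powRND _ _ S0) le_eqVlt; apply/orP; left; apply/eqP; ring.
- by case: nreg; split; rewrite /= ?a0.
Qed.

End Dominant.

(** K is the integral of [dominant], which is free of xi: all the dependence on xi sits in the
    factor |xi_1|^(-m) of the two bounds. *)
Lemma What_decay_cone (A1 B1 m : R) : 0 <= A1 -> 0 <= B1 ->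
  (forall xi : R2, 1 <= `|xi.1| -> cone u v xi -> {ae mu2, forall q : R2, 0 < q.1 ->
     (Gamma <= q.1 -> cabs (fourier psi (freqmap q.1 q.2 xi)) <= A1 * `|xi.1| `^ (- m)) /\
     (Xi <= `|q.2| -> cabs (fourier psi (freqmap q.1 q.2 xi)) <=
        B1 * (q.1 `^ (M%:R - L2 / 2) * (`|q.2| - v) `^ (- L2)) * `|xi.1| `^ (- m))}) ->
  exists2 K : R, 0 <= K & forall xi : R2, 1 <= `|xi.1| -> cone u v xi ->
    cabs (What xi) ^+ 2 <= K * (`|xi.1| `^ (- m)) ^+ 2.
Proof.
move=> A10 B10 H; exists (fine (\int[mu2]_q (dominant A1 B1 q)%:E)).
  by apply: fine_ge0; apply: integral_ge0 => q _; rewrite lee_fin dominant_ge0.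
move=> xi x1 cx; set P := _ `^ _; have P0 : 0 < P by apply: powR_gt0; lra.
have fin : (\int[mu2]_q (dominant A1 B1 q)%:E)%E \is a fin_num.
  rewrite ge0_fin_numE; first exact: dominant_lty.
  by apply: integral_ge0 => q _; rewrite lee_fin dominant_ge0.
rewrite -lee_fin (What_outer cx) mulrC EFinM fineK// -ge0_integralZl//; last 3 first.
- by apply/measurable_EFinP; exact: measurable_dominant.
- by move=> q _; rewrite lee_fin dominant_ge0.
- by rewrite lee_fin sqr_ge0.
apply: ae_ge0_le_integral => //.
- exact: (mi _ measurable_outer).
- by move=> q _; rewrite -EFinM lee_fin mulr_ge0 ?sqr_ge0 ?dominant_ge0.
- apply: measurable_funeM; apply/measurable_EFinP; exact: measurable_dominant.
apply: aeS (H xi x1 cx) => q Hq _; rewrite -EFinM lee_fin indicE.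
have [/set_mem [q0 nreg]|_] := boolP (q \in _); last first.
  by rewrite mul0r mulr_ge0 ?sqr_ge0 ?dominant_ge0.
have [HA HB] := Hq q0; rewrite mul1r.
case: q {Hq} q0 nreg HA HB => a s q0 nreg HA HB.
exact: (dens_dominant A10 B10 (cabs_ge0 _) P0 q0 nreg HA HB).
Qed.

Lemma psi_bounds (m : R) : 0 <= L1 -> m <= L1 -> m <= L2 - M%:R ->
  exists A1 B1 : R, [/\ 0 <= A1, 0 <= B1 &
  forall xi : R2, 1 <= `|xi.1| -> cone u v xi -> {ae mu2, forall q : R2, 0 < q.1 ->
     (Gamma <= q.1 -> cabs (fourier psi (freqmap q.1 q.2 xi)) <= A1 * `|xi.1| `^ (- m)) /\
     (Xi <= `|q.2| -> cabs (fourier psi (freqmap q.1 q.2 xi)) <=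
        B1 * (q.1 `^ (M%:R - L2 / 2) * (`|q.2| - v) `^ (- L2)) * `|xi.1| `^ (- m))}].
Proof.
move=> L10 mL1 mL2; have [K1 HK1] := decay1; have [K2 HK2] := decay2.
have pi0 := pi_ge0 R.
(* The constants of the decay hypotheses carry no sign condition, hence the absolute values.
   Gamma^(-L1) comes from a >= Gamma, and (2 pi)^M from the symbol of the derivative. *)
exists (`|K1| * Gamma `^ (- L1)), (`|K2| * (2 * pi) ^+ M); split.
- by rewrite mulr_ge0 ?powR_ge0.
- by rewrite mulr_ge0 ?exprn_ge0 ?mulr_ge0.
move=> xi x1 [ux vx]; have x0 : xi.1 != 0 by rewrite -normr_gt0; lra.
have norm_le (K y : R) : 0 <= y -> K / (1 + y) <= `|K| / (1 + y).
  by move=> y0; rewrite ler_pM2r ?ler_norm// invr_gt0; lra.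
have H1 := ae_freqmap x0 HK1; have H2 := ae_freqmap x0 HK2.
have H3 := ae_freqmap x0 psi_theta.
apply: aeS2 (aeS2 (fun x p q => conj p q) H1 H2) H3 => q [h1 h2] h3 a0.
have ax : `|(freqmap q.1 q.2 xi).1| = q.1 * `|xi.1| by rewrite normrM (gtr0_norm a0).
split=> [Ga|Xs].
  apply: (decay_coarse (normr_ge0 K1) L10 G0 Ga x1 mL1).
  by apply: le_trans (h1 a0) _; rewrite ax; apply: norm_le; exact: powR_ge0.
have S0 : 0 < `|q.2| - v by rewrite subr_gt0; exact: lt_le_trans Xs.
have L20 : 0 <= L2 by apply: le_trans (ltW ML2); exact: ler0n.
have Hy : Num.sqrt q.1 * ((`|q.2| - v) * `|xi.1|) <= `|(freqmap q.1 q.2 xi).2|.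
  rewrite /freqmap /= normrM (ger0_norm (sqrtr_ge0 _)) ler_wpM2l ?sqrtr_ge0//.
  exact: shear_lower.
have p20 : 0 <= 2 * pi :> R by rewrite mulr_ge0.
apply: (decay_derivative (normr_ge0 K2) L20 p20 a0 S0 x1 mL2 Hy).
rewrite (h3 a0) ax; apply: ler_wpM2l.
  by rewrite exprn_ge0// mulr_ge0// mulr_ge0// ltW.
by apply: le_trans (h2 a0) _; apply: norm_le; exact: powR_ge0.
Qed.

Lemma What_decay : exists K r : R, forall xi : R2, r <= enorm xi ->
  cabs (What xi) ^+ 2 <= K * enorm xi `^ (- (2 * Num.min L1 (L2 - M%:R))).
Proof.
set m := Num.min _ _.
have [L10|L10] := leP 0 L1; last first.
  (* For L1 < 0 the exponent on the right is positive, and the boundedness of W suffices. *)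
  exists (B ^+ 2), 1 => xi x1; have BW : cabs (What xi) ^+ 2 <= B ^+ 2.
    by rewrite ler_sqr ?nnegrE ?cabs_ge0 ?(le_trans (cabs_ge0 _) (WB xi)).
  apply: (le_trans BW); rewrite -[leLHS]mulr1 ler_wpM2l ?sqr_ge0//.
  rewrite -[X in X <= _](powRr0 (enorm xi)); apply: ler_powR => //.
  have : m <= L1 by rewrite /m ge_min lexx.
  lra.
have m0 : 0 <= m by rewrite /m le_min L10 subr_ge0 ltW.
have mL1 : m <= L1 by rewrite /m ge_min lexx.
have mL2 : m <= L2 - M%:R by rewrite /m ge_min lexx orbT.
have [A1 [B1 [A10 B10 HAB]]] := psi_bounds L10 mL1 mL2.
have [K K0 HK] := What_decay_cone A10 B10 HAB.
(* On the cone |xi| <= k |xi_1|; hence |xi| >= k forces |xi_1| >= 1, and a power of |xi_1| converts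
   to one of |xi| at the cost of k^(2 m). *)
pose k := Num.sqrt (1 + v ^+ 2).
have k2 : k ^+ 2 = 1 + v ^+ 2 by rewrite sqr_sqrtr// addr_ge0// sqr_ge0.
have k1 : 1 <= k.
  by rewrite -sqrtr1; apply: ler_wsqrtr; rewrite lerDl sqr_ge0.
exists (K * k `^ (2 * m)), k => xi kxi.
have [cx|ncx] := pselect (cone u v xi); last first.
  rewrite (What_off_cone HW ncx) cabs0 expr0n /=.
  by rewrite !mulr_ge0 ?powR_ge0.
have [ux vx] := cx.
have en : enorm xi <= k * `|xi.1|.
  rewrite /enorm -(ger0_norm (normr_ge0 xi.1)) -(sqrtr_sqr `|xi.1|) -sqrtrM.
    apply: ler_wsqrtr; rewrite real_normK ?num_real// mulrDl mul1r lerD2l.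
    rewrite -(real_normK (num_real xi.2)) -(real_normK (num_real xi.1)) -exprMn.
    by rewrite ler_sqr ?nnegrE ?mulr_ge0 ?(ltW v0).
  by rewrite addr_ge0// sqr_ge0.
have kp : 0 < k by lra.
have x1 : 1 <= `|xi.1| by rewrite -(ler_pM2l kp) mulr1; exact: le_trans en.
apply: (le_trans (HK xi x1 cx)); rewrite -mulrA; apply: ler_wpM2l => //.
have x0 : 0 < `|xi.1| by lra.
have e0 : 0 < enorm xi by lra.
have E : enorm xi `^ (2 * m) <= k `^ (2 * m) * `|xi.1| `^ (2 * m).
  by rewrite -powRM ?(ltW kp) ?(ltW x0)//; apply: le_powR; rewrite ?mulr_ge0 ?(ltW e0).
rewrite -powR_mulrn ?powR_ge0// -powRrM mulNr [m * 2]mulrC !powRN.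
by rewrite ler_pdivlMr ?powR_gt0// [leLHS]mulrC ler_pdivrMr ?powR_gt0.
Qed.

End Decay.

Unset Implicit Arguments.

Theorem theorem4p9 (R : realType) (u v Gamma Xi : R) (M : nat) (L1 L2 Cpsi : R)
    (psi theta What : R * R -> R[i])
    (hu : 0 < u) (hv : 0 < v) (hGamma : 0 < Gamma) (hXi : v < Xi)
    (hpsi : shearlet psi Cpsi)
    (htheta : L2R2 theta)
    (hderiv : weak_partial1 M theta psi)
    (hmom : vanishing_moments psi M)
    (hdecay1 : fourier_decay1 L1 psi)
    (hdecay2 : fourier_decay2 L2 theta)
    (hL2 : L2 < 2 * M%:R - 1 / 2) (hML2 : M%:R < L2) (hM : 1 / 2 < M%:R :> R)
    (hWm : cmeasurable [set: measurableTypeR R * measurableTypeR R] What)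
    (hWb : exists B : R, forall xi, cabs (What xi) <= B)
    (hW : forall xi : R * R,
        (Delta u v Gamma Xi psi xi + (cabs (What xi) ^+ 2)%:E
         = (Cpsi * \1_(cone u v) xi)%:E)%E) :
  [/\ tight_frame (L2cone u v) Gamma Xi
        (fun a s t => Pcone u v (dilate psi a s t))
        (translate_coef (PWhat u v What)) Cpsi,
      forall f, L2cone u v f -> weak_representation u v Gamma Xi psi What Cpsi f &
      exists K r : R, forall xi : R * R, r <= enorm xi ->
        cabs (What xi) ^+ 2 <= K * enorm xi `^ (- (2 * Num.min L1 (L2 - M%:R)))].
Proof.
have c0 := shearlet_const_gt0 hpsi; have [Lpsi _ _ hc] := hpsi.
have [B WB] := hWb.
(* For a natural number M > 1/2 means M >= 1, as the exponent 1 / M of the interpolation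
   requires. *)
have M0 : (0 < M)%N.
  by rewrite lt0n; apply/eqP => E; move: hM; rewrite E mulr0n; lra.
(* The region lies in the half plane a > 0, over which the integral is [Cpsi]. *)
have hle (xi : R * R) : xi.1 != 0 -> (shear_int psi (region Gamma Xi) xi <= Cpsi%:E)%E.
  exact: shear_int_region_le.
split.
- exact: (tight_frame_cone c0 Lpsi hle hWm WB hW).
- exact: (weak_representation_cone c0 Lpsi hle hWm WB hW).
- have hpt := fourier_weak_partial1 Lpsi htheta hderiv.
  exact: (What_decay hu hv hGamma hXi Lpsi hc WB hW M0 hML2 hL2 hpt hdecay1 hdecay2).
Qed.
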